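(* Let $\nu>0$, $R>0$, $\mu>0$, let $N$ be a positive integer, and let $v_0,\tilde v_0\in H_0^1(0,1)$, $U_0,\tilde U_0\in\mathbb{R}$. Let $[v,U]$ be the strong solution of $$\begin{cases}\partial_t v-Uv-\nu\partial_x^2v+2v\,\partial_xv=0, & x\in(0,1),\ t>0,\\ U'(t)-R+\nu U(t)=-\int_0^1v^2\,dx, & t>0,\\ v|_{x=0}=v|_{x=1}=0,\quad U(0)=U_0,\quad v|_{t=0}=v_0,\end{cases}$$ and let $[\tilde v,\tilde U]$ be the strong solution of the feedback system $$\begin{cases}\partial_t\tilde v=\tilde U\tilde v+\nu\partial_x^2\tilde v-2\tilde v\,\partial_x\tilde v-\mu\sum_{k=1}^N(\tilde v-v,w_k)w_k, & x\in(0,1),\ t>0,\\ \tilde U'(t)=R-\nu\tilde U(t)-\|\tilde v(t)\|^2, & t>0,\\ \tilde v|_{x=0}=\tilde v|_{x=1}=0,\quad \tilde U(0)=\tilde U_0,\quad \tilde v|_{t=0}=\tilde v_0.\end{cases}$$ Suppose that $$M_5\le\mu\quad\text{and}\quad \lambda_{N+1}^{-1}M_5\le\frac{\nu}{4},$$ where $$M_5:=\sqrt{M_3}+\frac1{2\nu}M_3+\frac34\nu^{-1/3}\beta^{8/3}\big(\sqrt{M_4}+2\sqrt{M_2}\big)^{4/3}$$ and $\beta,M_2,M_3,M_4$ are the constants described in the context. Then there exists $t_0>0$ such that for all $t\ge t_0$ $$\|\tilde v(t)-v(t)\|^2+|\tilde U(t)-U(t)|^2\le\big(\|v(t_0)-\tilde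 v(t_0)\|^2+|U(t_0)-\tilde U(t_0)|^2\big)e^{-d_2(t-t_0)},$$ where $d_2=\nu\min\{1,\lambda_1\}$.
   Context: $(\cdot,\cdot)$ and $\|\cdot\|$ are the inner product and norm of $L^2(0,1)$. $w_1,w_2,\dots$ are the eigenfunctions, orthonormal in $L^2(0,1)$, of $-\frac{d^2}{dx^2}$ on $(0,1)$ with homogeneous Dirichlet boundary conditions, corresponding to the eigenvalues $\lambda_1<\lambda_2<\cdots$. A strong solution of the first (uncontrolled) system is a pair $[v,U]$ such that for every $T>0$: $v\in L^\infty(0,T;H_0^1(0,1))\cap L^2(0,T;H^2(0,1))$, $U\in C^1(0,T)$, the equation for $v$ holds in the $L^2$ sense, the equation for $U$ holds, and the initial conditions are attained. A strong solution of the feedback system is defined in the same way. Both problems have unique strong solutions. Constants. $\beta>0$ is a constant in the Gagliardo–Nirenberg inequality $\|\phi\|_{L^4(0,1)}\le\beta\|\phi\|^{3/4}\|\partial_x\phi\|^{1/4}$ for all $\phi\in H_0^1(0,1)$. Set $d_0=d_1=\nu\min\{1,2\lambda_1\}$, $$M_1:=\frac{2R^2}{\nu d_0},\qquad M_3:=\frac{2R^2}{\nu d_1}+\frac{\mu}{d_1}M_1;$$ for all sufficiently large $t$ one has $\|v(t)\|^2+|U(t)|^2\le M_1$ and $\|\tilde v(t)\|^2+|\tilde U(t)|^2\le M_3$. $M_2>0$ (depending only on $\nu,R$) is a constant such that for every strong solution $[v,U]$ of the uncontrolled system there is $T_2>0$ with $\|\partial_xv(t)\|^2\le M_2$ for all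 $t\ge T_2$. $M_4>0$ (depending only on $\nu,R,\mu$, not on $N$ or the initial data) is a constant such that for every strong solution $[\tilde v,\tilde U]$ of the feedback system there is $T_4>0$ with $\|\partial_x\tilde v(t)\|^2\le M_4$ for all $t\ge T_4$. *)

(* Defs.v *)
From HB Require Import structures.
From mathcomp Require Import all_boot all_order all_algebra.
From mathcomp Require Import all_classical all_reals all_analysis.

Set Implicit Arguments.
Unset Strict Implicit.
Unset Printing Implicit Defensive.

Import Order.TTheory GRing.Theory Num.Theory.
Import numFieldNormedType.Exports.

Local Open Scope classical_set_scope.
Local Open Scope ring_scope.

(* Elements of spaces of functions on (0,1) are represented by functions
   R -> R, of which only the values on ]0,1[ matter, up to a.e. equality.
   A time-dependent function v is used as v t x. *)

Section Spaces.
Context {R : realType}.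

Definition leb : {measure set (measurableTypeR R) -> \bar R} :=
  @lebesgue_measure R.

Definition I01 : set R := `]0, 1[.

Definition Lp (p : \bar R) (f : R -> R) : Prop := (f \_ I01) \in Lfun leb p.

(* For p = 2%:E this is the norm written ||.|| without index. *)
Definition Lp_norm (p : \bar R) (f : R -> R) : R :=
  fine ('N[leb]_p [EFin \o (f \_ I01)])%E.

Definition L2 : set (R -> R) := Lp 2%:E.
Definition norm2 (f : R -> R) : R := Lp_norm 2%:E f.

Definition inner (f g : R -> R) : R := \int[leb]_(x in I01) (f x * g x).

(* C_c^oo(]a,b[) *)
Definition test_fun (a b : R) (phi : R -> R) : Prop :=
  (forall (n : nat) (x : R), derivable (derive1n n phi) x 1) /\
  exists c d : R, [/\ a < c, d < b & forall x, phi x != 0 -> c <= x <= d].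

Definition weak_deriv (u g : R -> R) : Prop :=
  forall phi, test_fun 0 1 phi ->
    \int[leb]_(x in I01) (u x * derive1 phi x) =
    - \int[leb]_(x in I01) (g x * phi x).

(* A representative of the weak derivative of u, unique up to a.e. equality
   when u is in H^1(0,1); the default 0 is taken when u has no weak derivative
   in L^2. *)
Definition dx (u : R -> R) : R -> R :=
  xget (fun=> 0) [set g | L2 g /\ weak_deriv u g].

Definition H1 : set (R -> R) :=
  [set u | L2 u /\ exists2 g, L2 g & weak_deriv u g].

Definition H1_norm (u : R -> R) : R :=
  Num.sqrt (norm2 u ^+ 2 + norm2 (dx u) ^+ 2).

(* H^1_0(0,1): the closure of C_c^oo(0,1) in H^1(0,1) *)
Definition H10 : set (R -> R) :=
  [set u | H1 u /\
    exists2 phi : nat -> R -> R, (forall n, test_fun 0 1 (phi n)) &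
      H1_norm (fun x => phi n x - u x) @[n --> \oo] --> (0 : R)].

Definition H2 : set (R -> R) := [set u | H1 u /\ H1 (dx u)].

Definition H2_norm (u : R -> R) : R :=
  Num.sqrt (norm2 u ^+ 2 + norm2 (dx u) ^+ 2 + norm2 (dx (dx u)) ^+ 2).

(* Bochner spaces L^p(0,T;X), where X is one of the spaces above, normed
   by nX. *)

Definition simple_fun (X : set (R -> R)) (s : R -> R -> R) : Prop :=
  exists (m : nat) (A : 'I_m -> set R) (c : 'I_m -> R -> R),
    [/\ forall i, measurable (A i), forall i, X (c i) &
        forall t x, s t x = \sum_(i < m) \1_(A i) t * c i x].

Definition strongly_measurable (X : set (R -> R)) (nX : (R -> R) -> R)
    (T : R) (u : R -> R -> R) : Prop :=
  exists2 s : nat -> R -> R -> R, (forall n, simple_fun X (s n)) &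
    {ae leb, forall t, t \in `]0, T[ ->
      nX (fun x => s n t x - u t x) @[n --> \oo] --> (0 : R)}.

(* The function h absorbs the fact that t |-> nX (u t) is only a.e. equal to
   a Borel function. *)
Definition Bochner (p : \bar R) (X : set (R -> R)) (nX : (R -> R) -> R)
    (T : R) (u : R -> R -> R) : Prop :=
  [/\ {ae leb, forall t, t \in `]0, T[ -> X (u t)},
      strongly_measurable X nX T u &
      exists2 h : R -> R, (h \_ `]0, T[) \in Lfun leb p &
        {ae leb, forall t, t \in `]0, T[ -> h t = nX (u t)}].

(* w is the weak derivative of v : (0,T) -> L^2(0,1): the identity
   int_0^T psi' v dt = - int_0^T psi w dt of Bochner integrals in L^2(0,1),
   which are determined by their inner products with the elements of L^2. *)
Definition weak_dt (T : R) (v w : R -> R -> R) : Prop :=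
  forall phi psi, L2 phi -> test_fun 0 T psi ->
    \int[leb]_(t in `]0, T[) (inner (v t) phi * derive1 psi t) =
    - \int[leb]_(t in `]0, T[) (inner (w t) phi * psi t).

(* The equation F t (v_t(t)) = 0 holds in L^2(0,1) for a.e. t in (0,T), with
   v_t in L^2(0,T;L^2(0,1)). *)
Definition holds_in_L2 (T : R) (v : R -> R -> R)
    (F : R -> (R -> R) -> R -> R) : Prop :=
  exists vt : R -> R -> R,
    [/\ Bochner 2%:E L2 norm2 T vt, weak_dt T v vt &
        {ae leb, forall t, t \in `]0, T[ ->
          {ae leb, forall x, x \in I01 -> F t (vt t) x = 0}}].

End Spaces.

Section Problem.
Context {R : realType}.

(* v being in H^1(0,T;L^2) for all T, it has a representative which is
   continuous in time with values in L^2; v denotes this representative, so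
   that v t is meaningful for every t >= 0. *)
Definition solution_class (v0 : R -> R) (U0 : R) (v : R -> R -> R)
    (U : R -> R) : Prop :=
  [/\ (forall t, 0 <= t -> L2 (v t) /\
         norm2 (fun x => v s x - v t x) @[s --> within `[0, +oo[ (nbhs t)]
           --> (0 : R)),
      (forall T, 0 < T ->
         Bochner +oo%E H10 H1_norm T v /\ Bochner 2%:E H2 H2_norm T v),
      (forall t, 0 < t -> derivable U t 1 /\ {for t, continuous (derive1 U)}),
      (U 0 = U0 /\ U t @[t --> 0^'+] --> U0) &
      {ae leb, forall x, x \in I01 -> v 0 x = v0 x}].

Definition strong_solution (nu r : R) (v0 : R -> R) (U0 : R)
    (v : R -> R -> R) (U : R -> R) : Prop :=
  [/\ solution_class v0 U0 v U,
      (forall T, 0 < T -> holds_in_L2 T v (fun t vt x =>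
         vt x - U t * v t x - nu * dx (dx (v t)) x + 2 * v t x * dx (v t) x)) &
      (forall t, 0 < t ->
         derive1 U t - r + nu * U t = - \int[leb]_(x in I01) (v t x ^+ 2))].

Definition feedback_solution (nu r mu : R) (N : nat) (w : nat -> R -> R)
    (v : R -> R -> R) (v0' : R -> R) (U0' : R)
    (v' : R -> R -> R) (U' : R -> R) : Prop :=
  [/\ solution_class v0' U0' v' U',
      (forall T, 0 < T -> holds_in_L2 T v' (fun t vt x =>
         vt x - (U' t * v' t x + nu * dx (dx (v' t)) x
                 - 2 * v' t x * dx (v' t) x
                 - mu * \sum_(1 <= k < N.+1)
                     inner (fun y => v' t y - v t y) (w k) * w k x))) &
      (forall t, 0 < t -> derive1 U' t = r - nu * U' t - norm2 (v' t) ^+ 2)].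

Definition dirichlet_eigenfunction (lam : R) (phi : R -> R) : Prop :=
  [/\ H10 phi, H2 phi, norm2 phi != 0 &
      {ae leb, forall x, x \in I01 -> - dx (dx phi) x = lam * phi x}].

(* Indices start at 1; w 0 and lam 0 are not used. *)
Definition dirichlet_eigensystem (w : nat -> R -> R) (lam : nat -> R) : Prop :=
  [/\ (forall k, (0 < k)%N -> dirichlet_eigenfunction (lam k) (w k)),
      (forall j k, (0 < j)%N -> (0 < k)%N -> inner (w j) (w k) = (j == k)%:R),
      (forall j k, (0 < j)%N -> (j < k)%N -> lam j < lam k) &
      (forall a phi, dirichlet_eigenfunction a phi ->
         exists2 k, (0 < k)%N & a = lam k)].

Definition gagliardo_nirenberg (beta : R) : Prop :=
  forall phi, H10 phi ->
    Lp_norm 4%:E phi <= beta * norm2 phi `^ (3 / 4) * norm2 (dx phi) `^ (1 / 4).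

Definition eventual_H1_bound (nu r M2 : R) : Prop :=
  forall v0 U0 v U, H10 v0 -> strong_solution nu r v0 U0 v U ->
    exists2 T2, 0 < T2 & forall t, T2 <= t -> norm2 (dx (v t)) ^+ 2 <= M2.

Definition feedback_eventual_H1_bound (nu r mu : R) (w : nat -> R -> R)
    (M4 : R) : Prop :=
  forall (N : nat) v0 U0 v U v0' U0' v' U', (0 < N)%N -> H10 v0 -> H10 v0' ->
    strong_solution nu r v0 U0 v U ->
    feedback_solution nu r mu N w v v0' U0' v' U' ->
    exists2 T4, 0 < T4 & forall t, T4 <= t -> norm2 (dx (v' t)) ^+ 2 <= M4.

(* lam1 is the first eigenvalue. *)
Definition d0 (nu lam1 : R) : R := nu * Num.min 1 (2 * lam1).
Definition d1 (nu lam1 : R) : R := nu * Num.min 1 (2 * lam1).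
Definition d2 (nu lam1 : R) : R := nu * Num.min 1 lam1.

Definition M1 (nu r lam1 : R) : R := 2 * r ^+ 2 / (nu * d0 nu lam1).

Definition M3 (nu r mu lam1 : R) : R :=
  2 * r ^+ 2 / (nu * d1 nu lam1) + mu / d1 nu lam1 * M1 nu r lam1.

Definition M5 (nu r mu lam1 beta M2 M4 : R) : R :=
  let m3 := M3 nu r mu lam1 in
  Num.sqrt m3 + (2 * nu)^-1 * m3
  + 3 / 4 * nu `^ (- (1 / 3)) * beta `^ (8 / 3)
    * (Num.sqrt M4 + 2 * Num.sqrt M2) `^ (4 / 3).

End Problem.

(* Main.v *)
Require Import Defs.
From HB Require Import structures.
From mathcomp Require Import all_boot all_order all_algebra.
From mathcomp Require Import all_classical all_reals all_analysis.
From mathcomp Require Import measurable_realfun ring lra.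

Set Implicit Arguments.
Unset Strict Implicit.
Unset Printing Implicit Defensive.

Import Order.TTheory GRing.Theory Num.Theory.
Import numFieldNormedType.Exports.

Local Open Scope classical_set_scope.
Local Open Scope ring_scope.

(** Let z = v' - v and V = U' - U. Testing the difference of the two equations
    for v' and v with z, and the difference of the equations for U' and U with
    V, bounds half the time derivative of E = ||z||^2 + V^2 by

      U' ||z||^2 - V (z, v') - nu ||z_x||^2 - nu V^2 - mu ||P_N z||^2
        - int z^2 (2 v_x - v'_x),

    where P_N is the projection onto the first N modes. For large times U' and
    ||v'|| are bounded by the square root of M3, and ||v_x||, ||v'_x|| by those
    of M2 and M4. The inequalities of Gagliardo-Nirenberg and Young
    ([gagliardo_young]) then bound the sum by
    M5 ||z||^2 - mu ||P_N z||^2 - (3/4) nu ||z_x||^2 - (nu/2) V^2. The low modes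
    of M5 ||z||^2 are absorbed by the feedback, as M5 <= mu; the high ones by
    viscosity, as ||z||^2 - ||P_N z||^2 <= ||z_x||^2 / lam (N+1). What is left is
    at most -(nu/2) (||z_x||^2 + V^2), and the Poincare inequality yields
    E' <= - d2 E. This is [difference_rate]. The bounds M1 and M3 come from the
    same computation for each system alone ([uncontrolled_absorbing],
    [feedback_absorbing]).

    Three things have to be established before this computation makes sense.

    Sobolev calculus. Weak derivatives are unique because plateau test functions
    tend to indicators of intervals ([weak_FTC], [orth_test_ae0]). Elements of
    H10 are limits of test functions, which gives integration by parts
    ([weak_IBP]), essential boundedness ([H10_bounded]) and the vanishing of the
    integral of (u z^2)' ([H10_sqr_IBP]).

    Spectral gap ([eigensystem_gap]). An abstract Dirichlet eigensystem is that
    of the normalized sines up to signs. The inequality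
    lam (n+1) (||z||^2 - ||P_n z||^2) <= ||z_x||^2 is proved by interpolation: a
    function that vanishes at the points j / (n+1) satisfies
    lam (n+1) ||f||^2 <= ||f'||^2, by the inequality of Wirtinger on each
    subinterval ([wirtinger_nodes]), and every function agrees at these points
    with a combination of the first n sines ([interpolation]).

    Energy inequality ([energy_le]). The equations hold with a weak time
    derivative z_t in L2(0,T;L2(0,1)). An upper bound of 2 (z_t, z) almost
    everywhere in time is turned into a bound of the increments of ||z||^2, and
    the integral form of the lemma of Gronwall ([gronwall]) concludes. *)

#[global] Instance ae_leb_filter {R : realType} :
  Filter (nbhs (almost_everywhere (@leb R))).
Proof. exact: (ae_filter_ringOfSetsType (@lebesgue_measure R)). Qed.

(** * Integrable functions and null sets *)

Section L1.
Context {R : realType}.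
Implicit Types (D : set (measurableTypeR R)) (f g h : R -> R).

Definition intble D f := leb.-integrable D (EFin \o f).

Lemma measurable_I01 : measurable (@I01 R : set (measurableTypeR R)).
Proof. exact: measurable_itv. Qed.

Lemma intble_meas D f : intble D f -> measurable_fun D f.
Proof. by move=> /measurable_int /measurable_EFinP. Qed.

Lemma le_intble D f g : measurable D -> measurable_fun D f -> intble D g ->
  (forall x, D x -> `|f x| <= g x) -> intble D f.
Proof.
move=> mD mf ig fg; apply: (le_integrable _ _ _ ig) => //.
- exact/measurable_EFinP.
- by move=> x Dx /=; rewrite lee_fin (le_trans (fg x Dx))// ler_norm.
Qed.

Lemma intble_ae D f g : measurable D -> measurable_fun D f -> intble D g ->
  {ae leb, forall x, D x -> `|f x| <= g x} -> intble D f.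
Proof.
move=> mD mf ig fg; apply/integrableP; split; first exact/measurable_EFinP.
have /integrableP[mg] := ig.
apply: le_lt_trans; apply: ae_ge0_le_integral => //.
- by do 2 apply: measurableT_comp => //.
- by do 2 apply: measurableT_comp => //; exact/measurable_EFinP.
- apply: filterS fg => x fg Dx /=; rewrite lee_fin.
  by rewrite (le_trans (fg Dx))// ler_norm.
Qed.

Lemma intbleD D f g : measurable D -> intble D f -> intble D g ->
  intble D (fun x => f x + g x).
Proof. by move=> mD fi gi; have := integrableD mD fi gi. Qed.

Lemma intbleB D f g : measurable D -> intble D f -> intble D g ->
  intble D (fun x => f x - g x).
Proof. by move=> mD fi gi; have := integrableB mD fi gi. Qed.

Lemma intbleZ D k f : measurable D -> intble D f -> intble D (fun x => k * f x).
Proof. by move=> mD fi; have := integrableZl mD k fi. Qed.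

Lemma intble_norm D f : intble D f -> intble D (fun x => `|f x|).
Proof. exact: integrable_norm. Qed.

Lemma intble_sub D D' f : measurable D -> measurable D' -> D' `<=` D ->
  intble D f -> intble D' f.
Proof. by move=> mD mD' DD'; apply: integrableS. Qed.

Lemma intble_cst (a b : R) (b0 b1 : bool) k :
  intble [set` Interval (BSide b0 a) (BSide b1 b)] (fun=> k).
Proof.
apply/integrableP; split; first exact: measurable_cst.
rewrite integral_cst//= /leb lebesgue_measure_itv /=.
by case: ifP => _; rewrite ?mule0 -?EFinD -?EFinM ltry.
Qed.

Lemma Rintegral_ae D f g : measurable D -> measurable_fun D f ->
  measurable_fun D g -> {ae leb, forall x, D x -> f x = g x} ->
  \int[leb]_(x in D) f x = \int[leb]_(x in D) g x.
Proof.
move=> mD mf mg fg; congr fine; apply: ae_eq_integral => //.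
- exact/measurable_EFinP.
- exact/measurable_EFinP.
- by apply: filterS fg => x fg Dx; rewrite fg.
Qed.

Lemma le_Rintegral_ae D f g : measurable D -> intble D f -> intble D g ->
  {ae leb, forall x, D x -> f x <= g x} ->
  \int[leb]_(x in D) f x <= \int[leb]_(x in D) g x.
Proof.
move=> mD fi gi fg.
have gfi : intble D (fun x => g x - f x) by exact: intbleB.
rewrite -subr_ge0 -RintegralB//.
have mgf := intble_meas gfi.
have -> : \int[leb]_(x in D) (g x - f x) = \int[leb]_(x in D) `|g x - f x|.
  apply: Rintegral_ae => //; first by apply: measurableT_comp.
  by apply: filterS fg => x fg Dx; rewrite ger0_norm// subr_ge0 fg.
by apply: Rintegral_ge0.
Qed.

Import HBNNSimple.

(** Nonmeasurable integrands occur because functions of Bochner spaces are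
    only almost everywhere limits of simple functions. A simple function below
    f, set to 0 on the null set, lies below g and keeps its integral. *)
Lemma integral_ae_any D (f g : R -> \bar R) :
  {ae leb, forall x, D x -> f x = g x} ->
  (\int[leb]_(x in D) f x = \int[leb]_(x in D) g x)%E.
Proof.
move=> [N [mN N0 NS]].
have fgN x : ~ N x -> (f \_ D) x = (g \_ D) x.
  move=> Nx; rewrite !patchE; case: ifPn => // Dx.
  apply: contrapT => H; apply: Nx; apply: NS => /= H'; apply: H.
  by apply: H'; rewrite inE in Dx.
have sub (p q : R -> \bar R) : (forall x, ~ N x -> p x = q x) ->
    (forall x, 0 <= q x)%E ->
    [set sintegral leb h | h in
       [set h : {nnsfun measurableTypeR R >-> R} | forall x, ((h x)%:E <= p x)%E]]
    `<=` [set sintegral leb h | h in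
       [set h : {nnsfun measurableTypeR R >-> R} | forall x, ((h x)%:E <= q x)%E]].
  move=> pq q0 _ [h /= hp <-]; exists (proj_nnsfun h (measurableC mN)) => /=.
    move=> x; rewrite mindicE; have [xN|xN] := boolP (x \in ~` N).
      by rewrite mulr1 -pq//; move: xN; rewrite inE.
    by rewrite mulr0.
  transitivity (\int[leb]_(x in setT) (proj_nnsfun h (measurableC mN) x)%:E)%E.
    by rewrite integral_nnsfun// patch_setT.
  transitivity (\int[leb]_(x in setT) (h x)%:E)%E; last first.
    by rewrite integral_nnsfun// patch_setT.
  apply: ae_eq_integral => //.
  - exact/measurable_EFinP.
  - exact/measurable_EFinP.
  exists N; split=> // x /= H; apply: contrapT => Nx; apply: H => _.
  by rewrite mindicE mem_set// mulr1.
rewrite /integral; congr (_ - _)%E; congr ereal_sup; apply/seteqP; split;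
  apply: sub => x; rewrite ?funepos_ge0 ?funeneg_ge0//;
  by move=> Nx; rewrite ?funeposE ?funenegE fgN.
Qed.

Lemma Rintegral_ae_any D f g : {ae leb, forall x, D x -> f x = g x} ->
  \int[leb]_(x in D) f x = \int[leb]_(x in D) g x.
Proof.
move=> fg; congr fine; apply: integral_ae_any.
by apply: filterS fg => x fg Dx; rewrite fg.
Qed.

End L1.

(** * The Hilbert space L2(0,1) *)

Section L2.
Context {R : realType}.
Implicit Types (f g h : R -> R).

(** The set D is arbitrary because square integrability is used both on the
    space interval and on time intervals. *)
Lemma Lfun2P (D : set (measurableTypeR R)) f : measurable D ->
  (f \_ D) \in Lfun leb 2%:E <->
  measurable_fun D f /\ intble D (fun x => f x * f x).
Proof.
move=> mD.
have E : ('N[leb]_2%:E [EFin \o (f \_ D)] `^ 2 =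
   \int[leb]_(x in D) (f x * f x)%:E)%E.
  rewrite powR_Lnorm// [RHS]integral_mkcond; apply: eq_integral => x _.
  rewrite /= !patchE; case: ifPn => _ /=.
    by rewrite powR_mulrn// real_normK ?num_real// expr2.
  by rewrite ?normr0 powR0.
have mE : measurable_fun D f <-> measurable_fun setT (f \_ D).
  by apply: (measurable_restrictT _ _).
split.
- rewrite inE => /andP[]; rewrite !inE/=.
  move=> /mE mf.
  rewrite /finite_norm => fN; split=> //; apply/integrableP; split.
    by apply/measurable_EFinP; exact: measurable_funM.
  rewrite (eq_integral (fun x : measurableTypeR R => (f x * f x)%:E)); last first.
    by move=> x _; rewrite /= ger0_norm// -expr2 sqr_ge0.
  by rewrite -E; apply: poweR_lty.
- move=> [mf /integrableP[_ fi]]; rewrite inE.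
  apply/andP; rewrite !inE/=; split; first exact/mE.
  rewrite /finite_norm; apply: (@lty_poweRy _ _ 2) => //.
  rewrite E; move: fi; rewrite (eq_integral (fun x : measurableTypeR R => (f x * f x)%:E))//.
  by move=> x _; rewrite /= ger0_norm// -expr2 sqr_ge0.
Qed.

Lemma L2P f : L2 f <->
  measurable_fun I01 f /\ intble I01 (fun x => f x * f x).
Proof. exact: Lfun2P (@measurable_I01 R). Qed.

(** If the integral is infinite, both sides take the default value 0 of fine.
    *)
Lemma norm2_sq f : norm2 f ^+ 2 = inner f f.
Proof.
rewrite /norm2 /Lp_norm /inner /Rintegral.
have -> : (\int[leb]_(x in I01) (f x * f x)%:E =
    'N[leb]_2%:E [EFin \o (f \_ I01)] `^ 2)%E.
  rewrite powR_Lnorm// [LHS]integral_mkcond; apply: eq_integral => x _.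
  rewrite /= !patchE; case: ifPn => _ /=.
    by rewrite powR_mulrn// real_normK ?num_real// expr2.
  by rewrite ?normr0 powR0.
have := @Lnorm_ge0 _ _ _ leb 2%:E (EFin \o (f \_ I01)).
case: Lnorm => [r||]//=.
- by rewrite lee_fin => r0; rewrite powR_mulrn.
- by move=> _; rewrite ifF ?pnatr_eq0 //= expr0n.
Qed.

End L2.

Section L2b.
Context {R : realType}.
Implicit Types (f g h : R -> R).
Let mI := @measurable_I01 R.

Lemma L2_meas f : L2 f -> measurable_fun I01 f.
Proof. by move=> /L2P[]. Qed.

Lemma L2M f g : L2 f -> L2 g -> intble I01 (fun x => f x * g x).
Proof.
move=> /L2P[mf f2] /L2P[mg g2].
apply: (@le_intble _ _ _ (fun x => f x * f x + g x * g x)) => //.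
- exact: measurable_funM.
- exact: intbleD.
- move=> x _; rewrite normrM -[f x * f x]ger0_norm -?expr2 ?sqr_ge0//.
  rewrite -[g x ^+ 2]ger0_norm ?sqr_ge0// !normrX.
  have := normr_ge0 (f x); have := normr_ge0 (g x).
  by move: `|f x| `|g x| => a b *; nra.
Qed.

Lemma sq_sum_le (a b c : R) : 0 <= a -> a <= b + c ->
  a ^+ 2 <= 2 * b ^+ 2 + 2 * c ^+ 2.
Proof.
move=> a0 abc; have : a ^+ 2 <= (b + c) ^+ 2.
  by rewrite ler_sqr ?nnegrE// (le_trans a0).
by have := sqr_ge0 (b - c); lra.
Qed.

Lemma L2_sum_sq f g h : measurable_fun I01 f -> L2 g -> L2 h ->
  {ae leb, forall x, I01 x -> `|f x| <= `|g x| + `|h x|} -> L2 f.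
Proof.
move=> mf /L2P[mg g2] /L2P[mh h2] fg; apply/L2P; split=> //.
apply: (@intble_ae _ _ _ (fun x => 2 * (g x * g x) + 2 * (h x * h x))) => //.
- exact: measurable_funM.
- by apply: intbleD => //; exact: intbleZ.
- apply: filterS fg => x fg Ix; have {}fg := fg Ix.
  rewrite normrM -!expr2 -[g x ^+ 2]ger0_norm ?sqr_ge0//.
  rewrite -[h x ^+ 2]ger0_norm ?sqr_ge0// !normrX.
  exact: sq_sum_le.
Qed.

Lemma L20 : L2 (fun=> 0 : R).
Proof.
apply/L2P; split => //; under eq_fun do rewrite mulr0.
exact: (@intble_cst R 0 1).
Qed.

Lemma L2_cst (k : R) : L2 (fun=> k : R).
Proof. by apply/L2P; split => //; exact: (@intble_cst R 0 1). Qed.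

Lemma L2D f g : L2 f -> L2 g -> L2 (fun x => f x + g x).
Proof.
move=> f2 g2; apply: (L2_sum_sq _ f2 g2).
  by apply: measurable_funD; exact: L2_meas.
by apply: aeW => x _; exact: ler_normD.
Qed.

Lemma L2B f g : L2 f -> L2 g -> L2 (fun x => f x - g x).
Proof.
move=> f2 g2; apply: (L2_sum_sq _ f2 g2).
  by apply: measurable_funB; exact: L2_meas.
by apply: aeW => x _; exact: ler_normB.
Qed.

Lemma L2_boundedM k f g : measurable_fun I01 f ->
  {ae leb, forall x, I01 x -> `|f x| <= k} -> L2 g -> L2 (fun x => f x * g x).
Proof.
move=> mf fk /[dup] /L2_meas mg /L2P[_ g2]; apply/L2P; split.
  exact: measurable_funM.
apply: (@intble_ae _ _ _ (fun x => k ^+ 2 * (g x * g x))) => //.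
- by do 2 (apply: measurable_funM => //).
- exact: intbleZ.
- apply: filterS fk => x fk Ix; have {}fk := fk Ix.
  rewrite -!expr2 exprMn normrM !normrX -[g x ^+ 2]ger0_norm ?sqr_ge0//.
  rewrite normrX ler_wpM2r ?sqr_ge0// ler_sqr ?nnegrE//.
  exact: le_trans fk.
Qed.

Lemma L2Z k f : L2 f -> L2 (fun x => k * f x).
Proof.
move=> f2; apply: (@L2_boundedM `|k| (fun=> k)) => //.
by apply: aeW => x _.
Qed.

Lemma L2N f : L2 f -> L2 (fun x => - f x).
Proof.
by move=> /(@L2Z (-1)); under eq_fun do rewrite mulN1r.
Qed.

Lemma L2_sum (I : Type) (r : seq I) (F : I -> R -> R) :
  (forall i, L2 (F i)) -> L2 (fun x => \sum_(i <- r) F i x).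
Proof.
move=> F2; elim: r => [|i r ih].
  by under eq_fun do rewrite big_nil; exact: L20.
by under eq_fun do rewrite big_cons; exact: L2D.
Qed.

Lemma intble_L2 f : L2 f -> intble I01 f.
Proof.
by move=> /L2M /(_ (L2_cst 1)); under eq_fun do rewrite mulr1.
Qed.

Lemma innerC f g : inner f g = inner g f.
Proof. by apply: eq_Rintegral => x _; rewrite mulrC. Qed.

Lemma innerDl f g h : L2 f -> L2 g -> L2 h ->
  inner (fun x => f x + g x) h = inner f h + inner g h.
Proof.
move=> f2 g2 h2; rewrite /inner -RintegralD//; [|exact: L2M..].
by apply: eq_Rintegral => x _; rewrite mulrDl.
Qed.

Lemma innerZl k f h : L2 f -> L2 h ->
  inner (fun x => k * f x) h = k * inner f h.
Proof.
move=> f2 h2; rewrite /inner -RintegralZl//; [|exact: L2M..].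
by apply: eq_Rintegral => x _; rewrite mulrA.
Qed.

Lemma innerBl f g h : L2 f -> L2 g -> L2 h ->
  inner (fun x => f x - g x) h = inner f h - inner g h.
Proof.
move=> f2 g2 h2; rewrite /inner -RintegralB//; [|exact: L2M..].
by apply: eq_Rintegral => x _; rewrite mulrBl.
Qed.

Lemma inner0l h : inner (fun=> 0) h = 0 :> R.
Proof.
rewrite /inner; under eq_Rintegral do rewrite mul0r.
by rewrite Rintegral_cst// mul0r.
Qed.

Lemma innerDr f g h : L2 f -> L2 g -> L2 h ->
  inner h (fun x => f x + g x) = inner h f + inner h g.
Proof. by move=> *; rewrite innerC innerDl// !(innerC h). Qed.

Lemma innerBr f g h : L2 f -> L2 g -> L2 h ->
  inner h (fun x => f x - g x) = inner h f - inner h g.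
Proof. by move=> *; rewrite innerC innerBl// !(innerC h). Qed.

Lemma innerZr k f h : L2 f -> L2 h ->
  inner h (fun x => k * f x) = k * inner h f.
Proof. by move=> *; rewrite innerC innerZl// !(innerC h). Qed.

Lemma inner_suml (I : Type) (r : seq I) (F : I -> R -> R) h :
  (forall i, L2 (F i)) -> L2 h ->
  inner (fun x => \sum_(i <- r) F i x) h = \sum_(i <- r) inner (F i) h.
Proof.
move=> F2 h2; elim: r => [|i r ih].
  by under eq_fun do rewrite big_nil; rewrite inner0l big_nil.
under eq_fun do rewrite big_cons; rewrite innerDl// ?ih ?big_cons//.
exact: L2_sum.
Qed.

Lemma inner_aeS f g h : L2 f -> L2 g -> L2 h ->
  {ae leb, forall x, I01 x -> f x = g x} -> inner f h = inner g h.
Proof.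
move=> f2 g2 h2 fg; apply: Rintegral_ae => //.
- by apply: intble_meas; exact: L2M.
- by apply: intble_meas; exact: L2M.
- by apply: filterS fg => x fg Ix; rewrite fg.
Qed.

Lemma inner_ge0 f : 0 <= inner f f.
Proof. by rewrite -norm2_sq sqr_ge0. Qed.

Lemma norm2_ge0 f : 0 <= norm2 f.
Proof. by rewrite /norm2 /Lp_norm fine_ge0// Lnorm_ge0. Qed.
Hint Resolve norm2_ge0 : core.

Lemma norm2_sqrt f : norm2 f = Num.sqrt (inner f f).
Proof. by rewrite -norm2_sq sqrtr_sqr ger0_norm. Qed.

Lemma norm2_ae f g : L2 f -> L2 g ->
  {ae leb, forall x, I01 x -> f x = g x} -> norm2 f = norm2 g.
Proof.
move=> f2 g2 fg; rewrite !norm2_sqrt; congr Num.sqrt.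
by rewrite (inner_aeS f2 g2 f2 fg) innerC (inner_aeS f2 g2 g2 fg).
Qed.

Lemma cauchy_schwarz f g : L2 f -> L2 g ->
  `|inner f g| <= norm2 f * norm2 g.
Proof.
move=> f2 g2.
have expand s t : 0 <= s ^+ 2 * inner f f - 2 * s * t * inner f g
    + t ^+ 2 * inner g g.
  have := inner_ge0 (fun x => s * f x - t * g x).
  have sf := L2Z s f2; have tg := L2Z t g2.
  rewrite innerBl ?innerBr ?innerZl ?innerZr//; [|exact: L2B..].
  by rewrite (innerC g f); congr (0 <= _); ring.
rewrite -ler_sqr ?nnegrE ?mulr_ge0// exprMn !norm2_sq real_normK ?num_real//.
have := expand (inner g g) (inner f g).
have : 0 <= inner g g by exact: inner_ge0.
rewrite le_eqVlt => /predU1P[g0 _|g0 H].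
  have [->|B0] := eqVneq (inner f g) 0.
    by rewrite expr0n/= mulr_ge0// inner_ge0.
  (* If inner g g = 0, the quadratic polynomial in t is affine and takes the
     value -1 for this t. *)
  have := expand 1 ((inner f f + 1) / (2 * inner f g)).
  rewrite -g0 mulr0 addr0 expr1n mul1r mulr1.
  have -> : 2 * ((inner f f + 1) / (2 * inner f g)) * inner f g =
    inner f f + 1 by field.
  by lra.
by rewrite -(ler_pM2l g0); move: H; rewrite -subr_ge0; lra.
Qed.

Lemma norm2D f g : L2 f -> L2 g ->
  norm2 (fun x => f x + g x) <= norm2 f + norm2 g.
Proof.
move=> f2 g2; rewrite -ler_sqr ?nnegrE ?addr_ge0// norm2_sq.
rewrite innerDl ?innerDr//; last exact: L2D.
rewrite sqrrD !norm2_sq (innerC g f).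
have := cauchy_schwarz f2 g2; have := ler_norm (inner f g).
by rewrite -mulr_natl; lra.
Qed.

Lemma norm2Z k f : L2 f -> norm2 (fun x => k * f x) = `|k| * norm2 f.
Proof.
move=> f2; rewrite !norm2_sqrt innerZl ?innerZr//; last exact: L2Z.
by rewrite mulrA -expr2 sqrtrM ?sqr_ge0// sqrtr_sqr.
Qed.

Lemma norm2BC f g : norm2 (fun x => f x - g x) = norm2 (fun x => g x - f x).
Proof.
rewrite !norm2_sqrt; congr Num.sqrt; apply: eq_Rintegral => x _.
by rewrite -[f x - g x]opprB mulrNN.
Qed.

Lemma norm2B f g : L2 f -> L2 g ->
  norm2 (fun x => f x - g x) <= norm2 f + norm2 g.
Proof.
move=> f2 g2; have -> : norm2 g = norm2 (fun x => -1 * g x).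
  by rewrite norm2Z// normrN1 mul1r.
under [X in norm2 X]eq_fun do rewrite -mulN1r.
by apply: norm2D => //; exact: L2Z.
Qed.

Lemma norm2_eq0_ae f : L2 f -> norm2 f = 0 ->
  {ae leb, forall x, I01 x -> f x = 0}.
Proof.
move=> f2 f0; have /L2P[mf iff] := f2.
have : (\int[leb]_(x in I01) (f x * f x)%:E = 0)%E.
  have := norm2_sq f; rewrite f0 expr0n/= /inner /Rintegral => /esym/eqP.
  by rewrite fine_eq0 ?(integrable_fin_num _ iff)// => /eqP.
move=> H.
have : (\int[leb]_(x in I01) `|(EFin \o (fun x => f x * f x)%R) x| = 0)%E.
  rewrite -H; apply: eq_integral => x _ /=.
  by rewrite ger0_norm// -expr2 sqr_ge0.
move=> /ae_eq_integral_abs /= -/(_ mI (measurable_int _ iff)).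
apply: filterS => x /[apply] -[] /eqP.
by rewrite mulf_eq0 orbb => /eqP.
Qed.

Lemma norm2_small_ae f : L2 f -> (forall e, 0 < e -> norm2 f <= e) ->
  {ae leb, forall x, I01 x -> f x = 0}.
Proof.
move=> f2 fe; apply: norm2_eq0_ae => //; apply/eqP; rewrite eq_le norm2_ge0.
by rewrite andbT; apply/ler_addgt0Pl => e e0; rewrite addr0 fe.
Qed.

Lemma norm2_le f g : L2 f -> L2 g ->
  {ae leb, forall x, I01 x -> `|f x| <= `|g x|} -> norm2 f <= norm2 g.
Proof.
move=> f2 g2 fg; rewrite -ler_sqr ?nnegrE// !norm2_sq.
apply: le_Rintegral_ae => //; [exact: L2M..|].
apply: filterS fg => x fg Ix.
by rewrite -!expr2 -[_ (f x) _]real_normK ?num_real// -[leRHS]real_normK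
  ?num_real// ler_sqr ?nnegrE// fg.
Qed.

Definition cvgL2 (u : nat -> R -> R) f :=
  norm2 (fun x => u n x - f x) @[n --> \oo] --> (0 : R).

Lemma cvg_inner (u w : nat -> R -> R) f g :
  (forall n, L2 (u n)) -> (forall n, L2 (w n)) -> L2 f -> L2 g ->
  cvgL2 u f -> cvgL2 w g ->
  inner (u n) (w n) @[n --> \oo] --> inner f g.
Proof.
move=> u2 w2 f2 g2 uf wg.
have uf2 n : L2 (fun x => u n x - f x) by exact: L2B.
have wg2 n : L2 (fun x => w n x - g x) by exact: L2B.
have bound n : `|inner (u n) (w n) - inner f g| <=
    norm2 (fun x => u n x - f x) * norm2 (fun x => w n x - g x)
    + norm2 (fun x => u n x - f x) * norm2 g
    + norm2 f * norm2 (fun x => w n x - g x).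
  have -> : inner (u n) (w n) - inner f g =
     inner (fun x => u n x - f x) (fun x => w n x - g x) +
     inner (fun x => u n x - f x) g + inner f (fun x => w n x - g x).
    by rewrite !innerBl ?innerBr//; ring.
  apply: le_trans (ler_normD _ _) _; apply: lerD; last exact: cauchy_schwarz.
  by apply: le_trans (ler_normD _ _) _; apply: lerD; exact: cauchy_schwarz.
apply/cvgrPdist_le => e e0.
have : norm2 (fun x => u n x - f x) * norm2 (fun x => w n x - g x)
    + norm2 (fun x => u n x - f x) * norm2 g
    + norm2 f * norm2 (fun x => w n x - g x) @[n --> \oo] --> (0 : R).
  have -> : (0 : R) = 0 * 0 + 0 * norm2 g + norm2 f * 0 by ring.
  apply: cvgD; [apply: cvgD|]; [exact: cvgM| exact: cvgMl|exact: cvgMr].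
move=> /cvgrPdist_le /(_ e e0); apply: filterS => n.
rewrite sub0r normrN => H; rewrite distrC; apply: le_trans (bound n) _.
exact: le_trans (ler_norm _) H.
Qed.

Lemma cvgL2_cst f : cvgL2 (fun=> f) f.
Proof.
rewrite /cvgL2; under eq_fun do under eq_fun do rewrite subrr.
rewrite norm2_sqrt inner0l sqrtr0; exact: cvg_cst.
Qed.

Lemma cvgL2_boundedM k (b : R -> R) (u : nat -> R -> R) f : measurable_fun I01 b ->
  {ae leb, forall x, I01 x -> `|b x| <= k} ->
  (forall n, L2 (u n)) -> L2 f -> cvgL2 u f ->
  cvgL2 (fun n x => b x * u n x) (fun x => b x * f x).
Proof.
move=> mb bk u2 f2 uf; rewrite /cvgL2.
apply: (@squeeze_cvgr _ _ _ _ (fun=> 0)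
    (fun n => `|k| * norm2 (fun x => u n x - f x))).
- near=> n; rewrite norm2_ge0/= -norm2Z; last exact: L2B.
  apply: norm2_le.
  + by apply: L2B; exact: (L2_boundedM mb bk).
  + by apply: L2Z; exact: L2B.
  + apply: filterS bk => x bk Ix; rewrite -mulrBr normrM [leRHS]normrM.
    by apply: ler_wpM2r => //; rewrite (le_trans (bk Ix))// ler_norm.
- exact: cvg_cst.
- by rewrite -[X in _ --> X](mulr0 `|k|); exact: cvgMr.
Unshelve. all: by end_near. Qed.

End L2b.
#[global] Hint Resolve norm2_ge0 : core.

(** * Smooth functions and smooth steps *)

Section calculus.
Context {R : realType}.
Implicit Types (f g : R -> R) (x a b k : R).

(** The differentiation rules are stated for functions given pointwise, the
    form in which derivatives are computed below. *)
Lemma isd_add f g x a b : is_derive x 1 f a -> is_derive x 1 g b ->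
  is_derive x 1 (fun y => f y + g y) (a + b).
Proof. exact: is_deriveD. Qed.

Lemma isd_sub f g x a b : is_derive x 1 f a -> is_derive x 1 g b ->
  is_derive x 1 (fun y => f y - g y) (a - b).
Proof. exact: is_deriveB. Qed.

Lemma isd_mul f g x a b : is_derive x 1 f a -> is_derive x 1 g b ->
  is_derive x 1 (fun y => f y * g y) (a * g x + f x * b).
Proof.
move=> fa gb; apply: is_derive_eq (is_deriveM fa gb) _.
by rewrite addrC [X in X + _]mulrC.
Qed.

Lemma isd_cst k x : is_derive x 1 (fun=> k) 0.
Proof. exact: is_derive_cst. Qed.

Lemma isd_id x : is_derive x 1 (fun y => y) 1.
Proof. exact: is_derive_id. Qed.

Lemma isd_scale k f x a : is_derive x 1 f a -> is_derive x 1 (fun y => k * f y) (k * a).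
Proof. by move=> fa; apply: is_derive_eq (isd_mul (isd_cst k x) fa) _; rewrite mul0r add0r. Qed.

Lemma isd_comp f g x a b : is_derive (g x) 1 f a -> is_derive x 1 g b ->
  is_derive x 1 (fun y => f (g y)) (a * b).
Proof. exact: is_derive1_comp. Qed.

Lemma isd_inv f x a : f x != 0 -> is_derive x 1 f a ->
  is_derive x 1 (fun y => (f y)^-1) (- (a * ((f x)^-1 * (f x)^-1))).
Proof.
move=> fx fa; apply: is_derive_eq (is_deriveV fx fa) _.
by rewrite -[_ *: _]/(_ * _) mulNr mulrC -exprVn expr2.
Qed.

Lemma isd_exp (k : nat) f x a : is_derive x 1 f a ->
  is_derive x 1 (fun y => f y ^+ k) (k%:R * f x ^+ k.-1 * a).
Proof.
move=> fa; elim: k => [|k ih].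
  by rewrite !mul0r; under eq_fun do rewrite expr0; exact: isd_cst.
under eq_fun do rewrite exprS.
apply: is_derive_eq (isd_mul fa ih) _.
by case: k {ih} => [|k] /=; rewrite ?expr0 ?exprS -?natr1; ring.
Qed.

Lemma isd_affine f x a k (c : R) : is_derive (k * x + c) 1 f a ->
  is_derive x 1 (fun y => f (k * y + c)) (k * a).
Proof.
move=> fa; rewrite mulrC; apply: (@isd_comp f (fun y => k * y + c) x a k fa).
by apply: is_derive_eq (isd_add (isd_scale k (isd_id x)) (isd_cst c x)) _; rewrite mulr1 addr0.
Qed.

Lemma derive1_of f g : (forall x, is_derive x 1 f (g x)) -> derive1 f = g.
Proof. by move=> fg; apply/funext => x; rewrite derive1E; have [_ ->] := fg x. Qed.

Lemma derivable_of f x a : is_derive x 1 f a -> derivable f x 1.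
Proof. by case. Qed.

Lemma continuous_of f g : (forall x, is_derive x 1 f (g x)) -> continuous f.
Proof.
move=> fg x; apply: differentiable_continuous; apply/derivable1_diffP.
exact: derivable_of (fg x).
Qed.

Lemma derivableE f x : derivable f x 1 -> is_derive x 1 f (derive1 f x).
Proof. by move=> df; rewrite derive1E; exact: derivableP. Qed.

(** Counting derivatives through the derivative of f, rather than through
    derivatives of order n, makes stability under products and quotients an
    induction on n. *)
Fixpoint Ck (n : nat) f : Prop :=
  (forall x, derivable f x 1) /\ (if n is m.+1 then Ck m (derive1 f) else True).

Lemma Ck_derivable n f x : Ck n f -> derivable f x 1.
Proof. by case: n => [|n] []. Qed.

Lemma Ck_is_derive n f x : Ck n f -> is_derive x 1 f (derive1 f x).
Proof. by move=> /(@Ck_derivable _ _ x) /derivableE. Qed.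

Lemma CkS n f : Ck n.+1 f -> Ck n f.
Proof. by elim: n f => [|n ih] f [df H]; split => //; exact: ih. Qed.

Lemma CkI n f g : (forall x, is_derive x 1 f (g x)) ->
  (if n is m.+1 then Ck m g else True) -> Ck n f.
Proof.
case: n => [|n] fg gn; (split; first by move=> x; exact: derivable_of (fg x)) => //.
by rewrite (derive1_of fg).
Qed.

Definition smooth f := forall n, Ck n f.

Lemma smoothP f : smooth f <-> forall n x, derivable (derive1n n f) x 1.
Proof.
split.
  move=> + n; elim: n f => [|n ih] f sf x; first exact: Ck_derivable (sf 0%N).
  by rewrite derive1Sn; apply: ih => m; have [] := sf m.+1.
move=> + n; elim: n f => [|n ih] f df; split=> //; try exact: (df 0%N).
by apply: ih => m x; rewrite -derive1Sn.
Qed.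

Lemma smooth_is_derive f x : smooth f -> is_derive x 1 f (derive1 f x).
Proof. by move=> /(_ 0%N); exact: Ck_is_derive. Qed.

Lemma smooth_derive f : smooth f -> smooth (derive1 f).
Proof. by move=> sf n; have [] := sf n.+1. Qed.

Lemma smooth_continuous f : smooth f -> continuous f.
Proof. move=> sf; apply: continuous_of => x; exact: smooth_is_derive. Qed.

Lemma smooth_cst k : smooth (fun=> k).
Proof.
move=> n; elim: n k => [|n ih] k; apply: (CkI (fun x => isd_cst k x)) => //=.
Qed.

Lemma CkD n f g : Ck n f -> Ck n g -> Ck n (fun x => f x + g x).
Proof.
elim: n f g => [|n ih] f g fn gn;
  apply: (CkI (fun x => isd_add (Ck_is_derive x fn) (Ck_is_derive x gn))) => //.
by apply: ih; [case: fn|case: gn].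
Qed.

Lemma CkM n f g : Ck n f -> Ck n g -> Ck n (fun x => f x * g x).
Proof.
elim: n f g => [|n ih] f g fn gn;
  apply: (CkI (fun x => isd_mul (Ck_is_derive x fn) (Ck_is_derive x gn))) => //.
by apply: CkD; apply: ih; try exact: CkS; [case: fn|case: gn].
Qed.

Lemma CkZ n k f : Ck n f -> Ck n (fun x => k * f x).
Proof. by apply: CkM; exact: smooth_cst. Qed.

Lemma CkV n f : (forall x, f x != 0) -> Ck n f -> Ck n (fun x => (f x)^-1).
Proof.
move=> f0; elim: n => [|n ih] fn;
  apply: (CkI (fun x => isd_inv (f0 x) (Ck_is_derive x fn))) => //.
have iv := ih (CkS fn).
under eq_fun do rewrite -mulN1r.
by apply: CkZ; apply: CkM; [case: fn|exact: CkM].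
Qed.

Lemma Ck_aff n f k c : Ck n f -> Ck n (fun x => f (k * x + c)).
Proof.
elim: n f => [|n ih] f fn;
  apply: (CkI (fun x => isd_affine (Ck_is_derive (k * x + c) fn))) => //.
by apply: CkZ; apply: ih; case: fn.
Qed.

Lemma smoothD f g : smooth f -> smooth g -> smooth (fun x => f x + g x).
Proof. by move=> sf sg n; exact: CkD. Qed.

Lemma smoothM f g : smooth f -> smooth g -> smooth (fun x => f x * g x).
Proof. by move=> sf sg n; exact: CkM. Qed.

Lemma smoothZ k f : smooth f -> smooth (fun x => k * f x).
Proof. by move=> sf n; exact: CkZ. Qed.

Lemma smoothB f g : smooth f -> smooth g -> smooth (fun x => f x - g x).
Proof.
move=> sf sg; under eq_fun do rewrite -mulN1r.
by apply: smoothD => //; exact: smoothZ.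
Qed.

Lemma smoothV f : (forall x, f x != 0) -> smooth f -> smooth (fun x => (f x)^-1).
Proof. by move=> f0 sf n; exact: CkV. Qed.

Lemma smooth_aff f k c : smooth f -> smooth (fun x => f (k * x + c)).
Proof. by move=> sf n; exact: Ck_aff. Qed.

Lemma smooth_sum (I : Type) (r : seq I) (F : I -> R -> R) :
  (forall i, smooth (F i)) -> smooth (fun x => \sum_(i <- r) F i x).
Proof.
move=> sF; elim: r => [|i r ih].
  by under eq_fun do rewrite big_nil; exact: smooth_cst.
by under eq_fun do rewrite big_cons; exact: smoothD.
Qed.

(** The classical flat functions. Differentiation sends the family over k into
    its own linear combinations, so that smoothness is an induction on the
    order of differentiation for all k at once. *)
Definition flat (k : nat) x : R := if 0 < x then x^-1 ^+ k * expR (- x^-1) else 0.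

Lemma flat_ge0 (k : nat) x : 0 <= flat k x.
Proof.
rewrite /flat; case: ifP => // x0.
by rewrite mulr_ge0 ?expR_ge0// exprn_ge0// invr_ge0 ltW.
Qed.

Lemma flat_gt0 (k : nat) x : 0 < x -> 0 < flat k x.
Proof.
by move=> x0; rewrite /flat x0 mulr_gt0 ?expR_gt0// exprn_gt0// invr_gt0.
Qed.

Lemma flat_le0 (k : nat) x : x <= 0 -> flat k x = 0.
Proof. by rewrite /flat leNgt; case: ltP. Qed.

Lemma flatS (k : nat) x : flat k x = flat k.+1 x * x.
Proof.
rewrite /flat; case: ifP => x0; last by rewrite mul0r.
rewrite exprS; move: (x^-1 ^+ k) (expR _) => y E; field.
by rewrite gt_eqF.
Qed.

(** At y = 1/x, the exponential is at least y^(k+1) / (k+1)!. *)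
Lemma flat_small (k : nat) x : flat k x <= k.+1`!%:R * `|x|.
Proof.
rewrite /flat; case: ifP => x0; last by rewrite mulr_ge0.
rewrite (gtr0_norm x0) expRN.
have y0 : 0 < x^-1 by rewrite invr_gt0.
have fk : 0 < k.+1`!%:R :> R by rewrite ltr0n fact_gt0.
have := expR_ge1Dxn k (ltW y0).
rewrite ler_pdivrMr ?expR_gt0// => H.
have -> : x^-1 ^+ k = x * x^-1 ^+ k.+1 by rewrite exprS mulrA divff ?mul1r ?gt_eqF.
have {}H : x^-1 ^+ k.+1 <= k.+1`!%:R * expR x^-1.
  rewrite -ler_pdivrMl// mulrC (le_trans _ H)//.
  by rewrite lerDr.
by rewrite [leRHS](_ : _ = x * (k.+1`!%:R * expR x^-1)) ?ler_pM2l//; ring.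
Qed.

(** At 0 the difference quotient of flat k is flat k.+1, which tends to 0 by
    flat_small. *)
Lemma flat_derive (k : nat) x : is_derive x 1 (flat k) (flat k.+2 x - k%:R * flat k.+1 x).
Proof.
have [x0|x0|->] := ltgtP x 0.
- rewrite !flat_le0 ?ltW// mulr0 subr0.
  apply: near_eq_is_derive (isd_cst 0 x).
  by near=> y; rewrite flat_le0// ltW//; near: y; exact: lt_nbhsl.
- have xN0 : x != 0 by rewrite gt_eqF.
  have D : is_derive x 1 (fun y => y^-1 ^+ k * expR (- y^-1))
    (x^-1 ^+ k.+2 * expR (- x^-1) - k%:R * (x^-1 ^+ k.+1 * expR (- x^-1))).
    have dV := isd_inv xN0 (isd_id x).
    have dE : is_derive x 1 (fun y => expR (- y^-1))
        (expR (- x^-1) * (x^-1 * x^-1)).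
      have dN : is_derive x 1 (fun y => - y^-1) (x^-1 * x^-1).
        apply: is_derive_eq (is_deriveN dV) _.
        by rewrite opprK mul1r.
      exact: isd_comp (is_derive_expR _) dN.
    apply: is_derive_eq (isd_mul (isd_exp k dV) dE) _.
    by case: k => [|k] /=; rewrite ?expr0 !exprS -?natr1; ring.
  rewrite /flat x0; apply: near_eq_is_derive D.
  by near=> y; rewrite ifT//; near: y; exact: lt_nbhsr.
- rewrite !flat_le0// mulr0 subr0.
  apply/is_derive1_caratheodory; exists (flat k.+1); split.
  + by move=> z; rewrite [flat k 0]flat_le0// !subr0 flatS.
  + apply/cvgrPdist_le => e e0; rewrite flat_le0//.
    have c0 : 0 < k.+2`!%:R :> R by rewrite ltr0n fact_gt0.
    near=> y; rewrite sub0r normrN ger0_norm ?flat_ge0//.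
    rewrite (le_trans (flat_small _ _))// mulrC -ler_pdivlMr//.
    near: y; apply: (@nbhs0_le _ R^o); exact: divr_gt0.
  + by rewrite flat_le0.
Unshelve. all: by end_near. Qed.

Lemma smooth_flat (k : nat) : smooth (flat k).
Proof.
move=> n; elim: n k => [|n ih] k; apply: (CkI (flat_derive k)) => //.
under eq_fun do rewrite -mulN1r mulrA.
by apply: CkD => //; exact: CkZ.
Qed.

Lemma flat_nd : {homo flat 0 : x y / x <= y}.
Proof.
move=> x y xy; have [x0|x0] := leP x 0.
  by rewrite flat_le0// flat_ge0.
have y0 := lt_le_trans x0 xy.
rewrite /flat x0 y0 !expr0 !mul1r ler_expR lerN2.
by rewrite lef_pV2.
Qed.

(** A smooth nondecreasing transition from 0, left of a, to 1, right of b. *)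
Definition step a b x : R := flat 0 (x - a) / (flat 0 (x - a) + flat 0 (b - x)).

Section step.
Variables (a b : R).
Hypothesis ab : a < b.

Lemma step_den x : 0 < flat 0 (x - a) + flat 0 (b - x).
Proof.
have [xa|xa] := leP x a.
  rewrite ltr_wpDl ?flat_ge0// flat_gt0// subr_gt0.
  exact: le_lt_trans ab.
by rewrite ltr_wpDr ?flat_ge0// flat_gt0// subr_gt0.
Qed.

Lemma step_left x : x <= a -> step a b x = 0.
Proof. by move=> xa; rewrite /step flat_le0 ?mul0r// subr_le0. Qed.

Lemma step_right x : b <= x -> step a b x = 1.
Proof.
move=> bx; rewrite /step [flat 0 (b - x)]flat_le0 ?subr_le0//.
by rewrite addr0 divff// gt_eqF// flat_gt0// subr_gt0 (lt_le_trans ab).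
Qed.

Lemma smooth_step : smooth (step a b).
Proof.
have s1 : smooth (fun x => flat 0 (x - a)).
  have := smooth_aff 1 (- a) (smooth_flat 0).
  by under eq_fun do rewrite mul1r.
have s2 : smooth (fun x => flat 0 (b - x)).
  have := smooth_aff (- 1) b (smooth_flat 0).
  by under eq_fun do rewrite mulN1r addrC.
apply: smoothM => //; apply: smoothV; last exact: smoothD.
by move=> x; rewrite gt_eqF// step_den.
Qed.

(** Cross-multiplication reduces the claim to the monotonicity of flat 0. *)
Lemma step_nd : {homo step a b : x y / x <= y}.
Proof.
move=> x y xy; rewrite /step ler_pdivrMr ?step_den//.
rewrite mulrAC ler_pdivlMr ?step_den//.
rewrite !mulrDr mulrC lerD2l ler_pM ?flat_ge0//; apply: flat_nd.
  by rewrite lerD2r.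
by rewrite lerD2l lerN2.
Qed.

Lemma step_ge0 x : 0 <= step a b x.
Proof. by rewrite /step divr_ge0 ?addr_ge0 ?flat_ge0. Qed.

Lemma step_le1 x : step a b x <= 1.
Proof. by rewrite /step ler_pdivrMr ?step_den// mul1r lerDl flat_ge0. Qed.

End step.

End calculus.

(** * The fundamental theorem of calculus and dominated convergence *)

Section ftc_tools.
Context {R : realType}.
Implicit Types (f g : R -> R) (x a b k : R).

Lemma within_cc f a b : (forall x, a <= x <= b -> {for x, continuous f}) ->
  {within `[a, b], continuous f}.
Proof.
by move=> cf; apply: continuous_in_subspaceT => x; rewrite inE/= in_itv/= => /cf.
Qed.

Lemma intble_cont f a b : (forall x, a <= x <= b -> {for x, continuous f}) ->
  intble `]a, b[ f.
Proof.
move=> cf; apply: (@intble_sub _ `[a, b]) => //; first exact: subset_itv_oo_cc.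
apply: continuous_compact_integrable; first exact: segment_compact.
exact: within_cc.
Qed.

Lemma Rint_oc f a b : intble `]a, b[ f ->
  \int[leb]_(x in `]a, b[) f x = \int[leb]_(x in `]a, b]) f x.
Proof. by move=> fi; rewrite /leb (Rintegral_itv_bndo_bndc fi). Qed.

Lemma FTC F f a b : a <= b ->
  (forall x, a <= x <= b -> is_derive x 1 F (f x)) ->
  (forall x, a <= x <= b -> {for x, continuous f}) ->
  \int[leb]_(x in `]a, b[) f x = F b - F a.
Proof.
rewrite le_eqVlt => /predU1P[<- _ _|ab Ff cf].
  by rewrite subrr set_itvoo0 Rintegral_set0.
have fi := intble_cont cf.
have cF x : a <= x <= b -> {for x, continuous F}.
  move=> xab; apply: differentiable_continuous; apply/derivable1_diffP.
  by have [] := Ff x xab.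
have cc : (a <= a <= b) && (a <= b <= b) by rewrite lexx (ltW ab) lexx.
move/andP : cc => [ca cb].
rewrite /Rintegral.
have -> : (\int[leb]_(x in `]a, b[) (f x)%:E =
           \int[leb]_(x in `[a, b]) (f x)%:E)%E.
  rewrite /leb integral_itv_bndo_bndc//; last first.
    by apply/measurable_EFinP; exact: intble_meas fi.
  rewrite integral_itv_obnd_cbnd//.
  apply/measurable_EFinP; apply: (@measurable_funS _ _ _ _ `[a, b]) => //.
    by move=> x /=; rewrite !in_itv/= => /andP[/ltW -> ->].
  apply: subspace_continuous_measurable_fun => //; exact: within_cc.
rewrite (continuous_FTC2 ab (within_cc cf) (F := F))//.
- split.
  + move=> x /[!in_itv]/= /andP[ax xb].
    by have [|] := Ff x _; rewrite ?(ltW ax) ?(ltW xb).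
  + by apply: cvg_at_right_filter; exact: cF.
  + by apply: cvg_at_left_filter; exact: cF.
- move=> x /[!in_itv]/= /andP[ax xb]; rewrite derive1E.
  by have [|_ ->] := Ff x _; rewrite ?(ltW ax) ?(ltW xb).
Qed.

Lemma bounded_cont f a b : (forall x, a <= x <= b -> {for x, continuous f}) ->
  exists k, forall x, a <= x <= b -> `|f x| <= k.
Proof.
move=> cf; have [ab|ab] := leP a b; last first.
  exists 0 => x /andP[ax xb]; have := le_trans ax xb.
  by rewrite leNgt ab.
have cn : {within `[a, b], continuous (fun x => `|f x|)}.
  apply: within_cc => x xab; apply: continuous_comp (cf x xab) _.
  exact: norm_continuous.
have [c _ H] := EVT_max ab cn.
by exists `|f c| => x xab; apply: H; rewrite in_itv.
Qed.

Lemma meas_cont f a b : (forall x, a <= x <= b -> {for x, continuous f}) ->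
  measurable_fun (`]a, b[ : set (measurableTypeR R)) f.
Proof. by move=> /intble_cont /intble_meas. Qed.

Lemma Rintegral_dc (D : set (measurableTypeR R)) (u : nat -> R -> R) f g :
  measurable D ->
  (forall n, measurable_fun D (u n)) -> intble D g ->
  (forall n x, D x -> `|u n x| <= g x) ->
  (forall x, D x -> u n x @[n --> \oo] --> f x) ->
  \int[leb]_(x in D) u n x @[n --> \oo] --> \int[leb]_(x in D) f x.
Proof.
move=> mD mu gi ug uf.
have ufE x : D x -> (u n x)%:E @[n --> \oo] --> (f x)%:E.
  by move=> Dx; apply: cvg_EFin; [exact: nearW|exact: uf].
have mf : measurable_fun D (EFin \o f).
  apply: (@emeasurable_fun_cvg _ _ _ D (fun n => EFin \o u n)) => //.
  by move=> n; exact/measurable_EFinP.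
have fint : intble D f.
  apply: (@le_intble _ _ _ g) => //; first exact/measurable_EFinP.
  move=> x Dx.
  have c1 : `|u n x| @[n --> \oo] --> `|f x| by apply: cvg_norm; exact: uf.
  rewrite -(cvg_lim _ c1)//; apply: limr_le; first by apply/cvg_ex; exists `|f x|.
  by apply: nearW => n; exact: ug.
have := @dominated_cvg _ _ R leb D mD (fun n => EFin \o u n) (EFin \o f)
   (EFin \o g).
have mu' n : measurable_fun D (EFin \o u n) by exact/measurable_EFinP.
have ug' n x : D x -> (`|(EFin \o u n) x| <= (EFin \o g) x)%E.
  by move=> Dx /=; rewrite lee_fin ug.
move=> /(_ mu' ufE) H; rewrite /Rintegral.
apply: fine_cvg; rewrite fineK; last exact: (integrable_fin_num mD fint).
by apply: H.
Qed.

End ftc_tools.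

(** * From weak to integrated derivatives *)

Section weak.
Context {R : realType}.
Implicit Types (f g : R -> R) (x a b k s t T : R).

Lemma derive1_step_ge0 p q x : p < q -> 0 <= derive1 (step p q) x.
Proof.
move=> pq; have sd := smooth_is_derive x (smooth_step pq).
rewrite derive1E; set d := 'D_1 _ x.
have /cvg_lim <- // : (fun h => h^-1 *: (((step p q) \o shift x) (h *: 1) - step p q x)) @ 0^' --> d.
  by have [/= + _] := sd; exact.
apply: limr_ge; first by have [/=] := sd.
near=> h.
have hN0 : h != 0 by near: h; exact: nbhs_dnbhs_neq.
rewrite -[_ *: _]/(_ * _) /= -[h *: 1]/(h * 1) mulr1.
have [h0|h0|] := ltgtP h 0; last by move/eqP; rewrite (negPf hN0).
- apply: mulr_le0; first by rewrite invr_le0 ltW.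
  by rewrite subr_le0; apply: step_nd => //; rewrite gerDr ltW.
- apply: mulr_ge0; first by rewrite invr_ge0 ltW.
  by rewrite subr_ge0; apply: step_nd => //; rewrite lerDr ltW.
Unshelve. all: by end_near. Qed.

Lemma derive1_near_cst f k x : (\forall y \near x, k = f y) -> derive1 f x = 0.
Proof.
move=> fk; rewrite derive1E.
by have [_ ->] := near_eq_is_derive fk (isd_cst k x).
Qed.

Lemma derive1_step_out p q x : p < q -> x < p \/ q < x ->
  derive1 (step p q) x = 0.
Proof.
move=> pq [xp|qx].
- apply: (@derive1_near_cst _ 0); near=> y; rewrite step_left// ltW//.
  by near: y; exact: lt_nbhsl.
- apply: (@derive1_near_cst _ 1); near=> y; rewrite step_right// ltW//.
  by near: y; exact: lt_nbhsr.
Unshelve. all: by end_near. Qed.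

(** The derivative of step p q is nonnegative, has integral 1 and is supported
    in [p, q]: it is an approximate Dirac mass at p. *)
Lemma step_mass f a p q b e : a <= p -> p < q -> q <= b ->
  (forall x, a <= x <= b -> {for x, continuous f}) ->
  (forall x, p <= x <= q -> `|f x - f p| <= e) ->
  `|\int[leb]_(x in `]a, b[) (f x * derive1 (step p q) x) - f p| <= e.
Proof.
move=> ap pq qb cf fe; set s := step p q.
have ss : smooth s by exact: smooth_step.
have cs' x : {for x, continuous (derive1 s)}.
  exact/smooth_continuous/smooth_derive.
have is' : intble `]a, b[ (derive1 s) by apply: intble_cont => x _.
have ms' : \int[leb]_(x in `]a, b[) (derive1 s x) = 1.
  have ab : a <= b by rewrite (le_trans ap)// (le_trans (ltW pq)).
  rewrite (FTC ab (fun x _ => smooth_is_derive x ss) (fun x _ => cs' x)).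
  by rewrite /s step_right// step_left// subr0.
have cfs x : a <= x <= b -> {for x, continuous (fun x => f x * derive1 s x)}.
  by move=> xab; apply: cvgM; [exact: cf|exact: cs'].
have -> : f p = f p * \int[leb]_(x in `]a, b[) (derive1 s x).
  by rewrite ms' mulr1.
rewrite -RintegralZl// -RintegralB//; [|exact: intble_cont|exact: intbleZ].
apply: le_trans (le_normr_Rintegral _ _) _ => //.
  by apply: intbleB => //; [exact: intble_cont|exact: intbleZ].
have <- : \int[leb]_(x in `]a, b[) (e * derive1 s x) = e.
  by rewrite RintegralZl// ms' mulr1.
apply: le_Rintegral => //.
- apply: intble_norm; apply: intbleB => //; [exact: intble_cont|exact: intbleZ].
- exact: intbleZ.
- move=> x _; rewrite -mulrBl normrM (ger0_norm (derive1_step_ge0 _ pq)).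
  have [xp|px] := ltP x p.
    by rewrite derive1_step_out ?mulr0//; left.
  have [xq|xq] := ltP q x.
    by rewrite derive1_step_out ?mulr0//; right.
  by apply: ler_wpM2r; [exact: derive1_step_ge0|rewrite fe// px].
Qed.

Lemma test_fun_smooth a b phi : test_fun a b phi -> smooth phi.
Proof. by move=> [/smoothP]. Qed.

Lemma test_fun_out a b phi x : test_fun a b phi -> x <= a \/ b <= x -> phi x = 0.
Proof.
move=> [_ [c [d [ac db H]]]] xab; apply/eqP; apply: contraPT xab => /H /andP[cx xd].
case=> [xa|bx].
  by have := lt_le_trans ac (le_trans cx xa); rewrite ltxx.
by have := le_lt_trans (le_trans bx xd) db; rewrite ltxx.
Qed.

Lemma test_plateau a s s' t t' b : a < s -> s < s' -> s' <= t -> t < t' -> t' < b ->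
  test_fun a b (fun x => step s s' x - step t t' x).
Proof.
move=> as_ ss' s't tt' t'b; split.
  by apply/smoothP/smoothB; exact: smooth_step.
exists s, t'; split => // x; have [xs|sx] := leP s x.
  have [xt'|t'x] := leP x t' => //.
  rewrite !step_right ?subrr ?eqxx//; first exact: ltW.
  by rewrite (le_trans s't)// (le_trans (ltW tt'))// ltW.
rewrite !step_left ?subrr ?eqxx//; last exact: ltW.
by rewrite (le_trans (ltW sx))// (le_trans (ltW ss')).
Qed.

(** Take for psi plateaus that tend to the indicator of ]s, t]. By step_mass
    the left-hand side of the weak identity tends to f s - f t, and by
    dominated convergence its right-hand side tends to minus the integral of
    g. *)
Lemma weak_FTC T f g s t : (forall x, 0 < x < T -> {for x, continuous f}) ->
  intble `]0, T[ g ->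
  (forall psi, test_fun 0 T psi ->
    \int[leb]_(x in `]0, T[) (f x * derive1 psi x) =
    - \int[leb]_(x in `]0, T[) (g x * psi x)) ->
  0 < s -> s <= t -> t < T ->
  f t - f s = \int[leb]_(x in `]s, t[) g x.
Proof.
move=> cf gi fg s0; rewrite le_eqVlt => /predU1P[<- _|st tT].
  by rewrite subrr set_itvoo0 Rintegral_set0.
(* The ramps of the plateau are [s, s + d n] and [t, t + d n]: they must be
   disjoint and end before T. *)
pose d0 := Num.min (t - s) (T - t) / 2.
have d00 : 0 < d0 by rewrite divr_gt0// lt_min !subr_gt0 st.
have d0s : s + d0 <= t.
  rewrite -lerBrDl /d0; apply: (@le_trans _ _ ((t - s) / 2)).
    by rewrite ler_pM2r// ge_min lexx.
  by rewrite ler_pdivrMr// ler_peMr ?subr_ge0 ?ltW// ltr1n.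
have d0t : t + d0 < T.
  rewrite -ltrBrDl /d0; apply: (@le_lt_trans _ _ ((T - t) / 2)).
    by rewrite ler_pM2r// ge_min lexx orbT.
  by rewrite ltr_pdivrMr// ltr_pMr ?subr_gt0// ltr1n.
(* The denominator n.+2 keeps d n strictly below d0, so that at t + d0 all the
   plateaus are constant in a neighbourhood. *)
pose d n : R := d0 / n.+2%:R.
have dp n : 0 < d n by rewrite divr_gt0.
have ddlt n : d n < d0 by rewrite ltr_pdivrMr// ltr_pMr// ltr1n.
have dd0 n : d n <= d0 by rewrite ltW.
have dcv : d n @[n --> \oo] --> (0 : R).
  rewrite -[X in _ --> X](mulr0 d0); apply: cvgMr.
  by have := @cvg_harmonic R; rewrite -(cvg_shiftn 1); under eq_fun do rewrite addn1.
have sn n : s < s + d n by rewrite ltrDl.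
have tn n : t < t + d n by rewrite ltrDl.
have snt n : s + d n <= t by rewrite (le_trans _ d0s)// lerD2l.
have tnT n : t + d n < T by rewrite (le_lt_trans _ d0t)// lerD2l.
pose psi n x := step s (s + d n) x - step t (t + d n) x.
have tpsi n : test_fun 0 T (psi n) by exact: test_plateau.
have psi1 n x : `|psi n x| <= 1.
  rewrite ler_norml /psi; apply/andP; split.
    by rewrite lerBrDl; have := step_ge0 s (s + d n) x; have := step_le1 (tn n) x; lra.
  by have := step_ge0 t (t + d n) x; have := step_le1 (sn n) x; lra.
have mT : measurable (`]0, T[ : set (measurableTypeR R)) by exact: measurable_itv.
have mpsi n : measurable_fun (`]0, T[ : set (measurableTypeR R)) (psi n).
  by apply: meas_cont => x _; apply: smooth_continuous; exact: test_fun_smooth (tpsi n).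
have rhs : \int[leb]_(x in `]0, T[) (g x * psi n x) @[n --> \oo] -->
    \int[leb]_(x in `]s, t[) g x.
  have -> : \int[leb]_(x in `]s, t[) g x =
      \int[leb]_(x in `]0, T[) ((g \_ `]s, t]) x).
    rewrite -Rintegral_mkcondr Rint_oc.
      congr (Rintegral leb _ g); apply/seteqP; split=> x /=; rewrite !in_itv/=.
        by move=> /andP[sx xt]; rewrite sx xt (lt_trans s0)// (le_lt_trans xt).
      by move=> [].
    apply: intble_sub gi => // x /=; rewrite !in_itv/= => /andP[sx xt].
    by rewrite (lt_trans s0 sx) (lt_trans xt tT).
  apply: (@Rintegral_dc _ _ _ _ (fun x => `|g x|)) => //.
  - by move=> n; apply: measurable_funM => //; exact: intble_meas.
  - exact: intble_norm.
  - by move=> n x _; rewrite normrM ler_piMr.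
  - move=> x _; rewrite patchE.
    have [xs|sx] := leP x s.
      rewrite ifF; last by apply/negbTE; rewrite notin_setE/= in_itv/= ltNge xs.
      apply: cvg_near_cst; apply: nearW => n.
      by rewrite /psi !step_left ?subrr ?mulr0// (le_trans xs)// ltW.
    have s1 : \forall n \near \oo, step s (s + d n) x = 1.
      have : \forall n \near \oo, d n < x - s.
        by apply: cvgr_lt dcv _ _; rewrite subr_gt0.
      apply: filterS => n dn; rewrite step_right//.
      by move: dn; rewrite ltrBrDl => /ltW.
    have [xt|tx] := leP x t.
      rewrite ifT; last by rewrite inE/= in_itv/= sx.
      apply: cvg_near_cst; apply: filterS s1 => n.
      by rewrite /psi => ->; rewrite step_left// subr0 mulr1.
    rewrite ifF; last by apply/negbTE; rewrite notin_setE/= in_itv/= sx leNgt tx.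
    have : \forall n \near \oo, d n < x - t.
      by apply: cvgr_lt dcv _ _; rewrite subr_gt0.
    move=> t1; apply: cvg_near_cst; apply: filterS2 s1 t1 => n s1 dn.
    rewrite /psi s1 step_right ?subrr ?mulr0//.
    by move: dn; rewrite ltrBrDl => /ltW.
(* On [a, b] the function f is bounded, which it need not be on ]0, T[. *)
pose a := s / 2; pose b := t + d0.
have a0 : 0 < a by rewrite divr_gt0.
have as_ : a < s by rewrite ltr_pdivrMr// ltr_pMr// ltr1n.
have sub x : a <= x <= b -> 0 < x < T.
  by move=> /andP[ax xb]; rewrite (lt_le_trans a0 ax) (le_lt_trans xb d0t).
have smf p q : p < q -> continuous (derive1 (step p q)).
  by move=> pq; exact/smooth_continuous/smooth_derive/smooth_step.
have lhs : \int[leb]_(x in `]0, T[) (f x * derive1 (psi n) x) @[n --> \oo] -->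
    f s - f t.
  have E n : \int[leb]_(x in `]0, T[) (f x * derive1 (psi n) x) =
     \int[leb]_(x in `]a, b[) (f x * derive1 (step s (s + d n)) x) -
     \int[leb]_(x in `]a, b[) (f x * derive1 (step t (t + d n)) x).
    have D x : derive1 (psi n) x =
        derive1 (step s (s + d n)) x - derive1 (step t (t + d n)) x.
      have -> // : derive1 (psi n) = fun x =>
          derive1 (step s (s + d n)) x - derive1 (step t (t + d n)) x.
      apply: derive1_of => y; apply: isd_sub;
        apply: smooth_is_derive; exact: smooth_step.
    have ic p q : p < q -> intble `]a, b[ (fun x => f x * derive1 (step p q) x).
      move=> pq; apply: intble_cont => x /sub xT; apply: cvgM; first exact: cf.
      exact: smf.
    rewrite -RintegralB//; [|exact: ic..].
    rewrite [LHS]Rintegral_mkcond [RHS]Rintegral_mkcond.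
    apply: eq_Rintegral => x _; rewrite !patchE.
    have -> : (x \in [set` `]a, b[]) = (a < x < b).
      by apply/idP/idP; rewrite inE/= in_itv/=.
    have -> : (x \in [set` `]0, T[]) = (0 < x < T).
      by apply/idP/idP; rewrite inE/= in_itv/=.
    have out : x < s \/ b <= x -> derive1 (psi n) x = 0.
      rewrite D => -[xs|bx].
        by rewrite !derive1_step_out ?subrr//; left => //; exact: lt_trans st.
      have tx : t + d n < x by rewrite (lt_le_trans _ bx)// ltrD2l.
      rewrite !derive1_step_out ?subrr//; right => //.
      by rewrite (le_lt_trans (snt n))// (lt_trans (tn n)).
    have [ax|xa] := ltP a x; last first.
      by case: ifP => // _; rewrite out ?mulr0//; left; rewrite (le_lt_trans xa).
    have [xb|bx] := ltP x b; last first.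
      by case: ifP => // _; rewrite out ?mulr0//; right.
    by rewrite /= sub ?(ltW ax) ?(ltW xb)// D mulrBr.
  rewrite (eq_fun E).
  have one p : a < p -> p <= t ->
      \int[leb]_(x in `]a, b[) (f x * derive1 (step p (p + d n)) x)
        @[n --> \oo] --> f p.
    move=> ap pt; have cfp : {for p, continuous f}.
      by apply: cf; rewrite (lt_trans a0 ap) (le_lt_trans pt tT).
    apply/cvgrPdist_le => e e0.
    have /cvgrPdist_le /(_ e e0) [r /= r0 Hr] := cfp.
    have : \forall n \near \oo, d n < r by apply: cvgr_lt dcv _ _.
    apply: filterS => n dr; rewrite distrC; apply: step_mass.
    - exact: ltW.
    - by rewrite ltrDl.
    - by rewrite lerD// dd0.
    - by move=> x /sub xT; exact: cf.
    - move=> x /andP[px xp]; rewrite distrC; apply: Hr => /=.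
      by rewrite distrC ger0_norm ?subr_ge0// ltrBlDl (le_lt_trans xp)// ltrD2l.
  apply: cvgB; apply: one => //; first exact: ltW.
  exact: lt_trans st.
have lhs' : \int[leb]_(x in `]0, T[) (f x * derive1 (psi n) x) @[n --> \oo] -->
    - \int[leb]_(x in `]s, t[) g x.
  have E n : \int[leb]_(x in `]0, T[) (f x * derive1 (psi n) x) =
    - \int[leb]_(x in `]0, T[) (g x * psi n x) by exact: fg.
  by rewrite (eq_fun E); apply: cvgN.
have := cvg_unique _ lhs lhs' => /(_ (@norm_hausdorff _ _)) H.
by rewrite -[RHS]opprK -H opprB.
Qed.

End weak.

(** * The spaces H1 and H10 *)

Section sobolev.
Context {R : realType}.
Implicit Types (f g u v : R -> R) (x a b k : R).
Let mI := @measurable_I01 R.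

Lemma L2_cont f : continuous f -> L2 f.
Proof.
move=> cf; apply/L2P; split; first by apply: meas_cont => x _; exact: cf.
by apply: intble_cont => x _; apply: cvgM; exact: cf.
Qed.

Lemma L2_smooth f : smooth f -> L2 f.
Proof. by move=> /smooth_continuous; exact: L2_cont. Qed.

Lemma bounded_smooth f : smooth f ->
  exists k, forall x, I01 x -> `|f x| <= k.
Proof.
move=> /smooth_continuous cf.
have [k H] := @bounded_cont R f 0 1 (fun x _ => cf x).
exists k => x; rewrite /I01/= in_itv/= => /andP[x0 x1].
by apply: H; rewrite !ltW.
Qed.

(** By weak_FTC applied to f = 0, the integral of g over every interval
    vanishes; Lebesgue differentiation concludes. *)
Lemma orth_test_ae0 g : L2 g ->
  (forall phi, test_fun 0 1 phi -> \int[leb]_(x in I01) (g x * phi x) = 0) ->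
  {ae leb, forall x, I01 x -> g x = 0}.
Proof.
move=> g2 gphi; have gi := intble_L2 g2.
have int0 s t : 0 < s -> s <= t -> t < 1 -> \int[leb]_(x in `]s, t[) g x = 0.
  move=> s0 st t1.
  rewrite -(@weak_FTC R 1 (fun=> 0) g s t)// ?subrr//; first by move=> x _; exact: cvg_cst.
  move=> psi tpsi; rewrite gphi// oppr0.
  by under eq_Rintegral do rewrite mul0r; rewrite Rintegral_cst// mul0r.
pose h := g \_ I01.
have hi : leb.-integrable setT (EFin \o h).
  have := gi; rewrite /intble => /(integrable_mkcond _ mI).
  by rewrite restrict_EFin.
have hiD (D : set (measurableTypeR R)) : measurable D -> leb.-integrable D (EFin \o h).
  by move=> mD; apply: integrableS hi.
suff H n : {ae leb, forall x, n.+2%:R^-1 < x -> x < 1 -> g x = 0}.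
  have /ae_foralln : forall n, {ae leb, forall x, n.+2%:R^-1 < x -> x < 1 -> g x = 0} by [].
  apply: filterS => x Hx; rewrite /I01/= in_itv/= => /andP[x0 x1].
  pose n := Num.truncn x^-1.
  apply: (Hx n) => //.
  rewrite invf_plt ?posrE// (lt_trans (truncnS_gt _))// ltr_nat.
  by rewrite ltnS.
pose s : R := n.+2%:R^-1.
have s0 : 0 < s by rewrite invr_gt0.
have /= := @FTC1 R h (BRight s) (fun y => hiD _ (measurable_itv _))
   (@open_integrable_locally R setT h openT hi).
apply: filterS => x Hx sx x1.
have [_] := Hx sx.
rewrite /h patchE ifT; last by rewrite inE/I01/= in_itv/= x1 (lt_trans s0).
move=> <-; apply: (@derive1_near_cst _ _ 0); near=> y.
have sy : s < y by near: y; exact: lt_nbhsr.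
have y1 : y < 1 by near: y; exact: lt_nbhsl.
rewrite -(Rintegral_itv_bndo_bndc (hiD _ (measurable_itv _))).
rewrite -(int0 s y)//; last exact: ltW.
apply: eq_Rintegral => z; rewrite inE/= in_itv/= => /andP[sz zy].
by rewrite /h patchE ifT// inE/I01/= in_itv/= (lt_trans s0 sz) (lt_trans zy y1).
Unshelve. all: by end_near. Qed.

Lemma weak_deriv_uniq u g1 g2 : L2 g1 -> L2 g2 ->
  weak_deriv u g1 -> weak_deriv u g2 ->
  {ae leb, forall x, I01 x -> g1 x = g2 x}.
Proof.
move=> h1 h2 w1 w2.
have := @orth_test_ae0 (fun x => g1 x - g2 x) (L2B h1 h2).
case=> [phi tphi|N [mN N0 NS]].
  have p2 : L2 phi by apply: L2_smooth; exact: test_fun_smooth tphi.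
  have := innerBl h1 h2 p2; rewrite /inner => ->.
  by apply/eqP; rewrite subr_eq0 -eqr_opp -(w1 _ tphi) -(w2 _ tphi).
exists N; split => //; apply: subset_trans NS => x /= H Hx; apply: H => Ix.
by apply/eqP; rewrite -subr_eq0; apply/eqP; exact: Hx.
Qed.

Lemma H1_dx u : H1 u -> L2 (dx u) /\ weak_deriv u (dx u).
Proof.
move=> [u2 [g g2 wg]]; rewrite /dx.
by case: xgetP => [y -> []//|/(_ g)]; case.
Qed.

Lemma H1_L2 u : H1 u -> L2 u. Proof. by case. Qed.

Lemma H1_dx_L2 u : H1 u -> L2 (dx u). Proof. by move=> /H1_dx[]. Qed.

(** The representative chosen by dx is not explicit; this is how it is
    computed. *)
Lemma H1_intro u g : L2 u -> L2 g -> weak_deriv u g ->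
  H1 u /\ {ae leb, forall x, I01 x -> dx u x = g x}.
Proof.
move=> u2 g2 ug; have hu : H1 u by split=> //; exists g.
split=> //; have [d2 wd] := H1_dx hu.
exact: weak_deriv_uniq d2 g2 wd ug.
Qed.

Lemma test_L2 (phi : R -> R) : test_fun 0 1 phi -> L2 phi.
Proof. by move=> /test_fun_smooth /L2_smooth. Qed.

Lemma test_dL2 (phi : R -> R) : test_fun 0 1 phi -> L2 (derive1 phi).
Proof. by move=> /test_fun_smooth /smooth_derive /L2_smooth. Qed.

Lemma weak_derivB u v g h : L2 u -> L2 v -> L2 g -> L2 h ->
  weak_deriv u g -> weak_deriv v h ->
  weak_deriv (fun x => u x - v x) (fun x => g x - h x).
Proof.
move=> u2 v2 g2 h2 wu wv phi tphi.
have p2 := test_L2 tphi; have d2 := test_dL2 tphi.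
rewrite -/(inner (fun x => u x - v x) _) -/(inner (fun x => g x - h x) _).
rewrite !innerBl// opprB.
have := wu _ tphi; have := wv _ tphi; rewrite /inner => -> ->.
by rewrite opprK addrC.
Qed.

Lemma weak_deriv_ae u g u' g' : L2 u -> L2 g -> L2 u' -> L2 g' ->
  {ae leb, forall x, I01 x -> u x = u' x} ->
  {ae leb, forall x, I01 x -> g x = g' x} ->
  weak_deriv u g -> weak_deriv u' g'.
Proof.
move=> u2 g2 u2' g2' uu gg wu phi tphi.
have p2 := test_L2 tphi; have d2 := test_dL2 tphi.
have := wu phi tphi; rewrite -!/(inner _ _).
by rewrite (inner_aeS u2 u2' d2 uu) (inner_aeS g2 g2' p2 gg).
Qed.

Lemma H1B u v : H1 u -> H1 v -> H1 (fun x => u x - v x) /\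
  {ae leb, forall x, I01 x -> dx (fun x => u x - v x) x = dx u x - dx v x}.
Proof.
move=> hu hv; have [du wu] := H1_dx hu; have [dv wv] := H1_dx hv.
apply: (@H1_intro _ (fun x => dx u x - dx v x)).
- by apply: L2B; exact: H1_L2.
- exact: L2B.
- by apply: weak_derivB => //; exact: H1_L2.
Qed.

(** The integral of (f phi)' vanishes. *)
Lemma weak_deriv_C1 f g : (forall x, is_derive x 1 f (g x)) -> continuous g ->
  weak_deriv f g.
Proof.
move=> fg cg phi tphi; have sp := test_fun_smooth tphi.
have cf := continuous_of fg.
have cp := smooth_continuous sp; have cp' := smooth_continuous (smooth_derive sp).
have ig : intble I01 (fun x => g x * phi x).
  by apply: intble_cont => x _; apply: cvgM; [exact: cg|exact: cp].
have iF : intble I01 (fun x => f x * derive1 phi x).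
  by apply: intble_cont => x _; apply: cvgM; [exact: cf|exact: cp'].
apply/eqP; rewrite -addr_eq0 addrC -RintegralD//; apply/eqP.
rewrite (FTC ler01 (fun x _ => isd_mul (fg x) (smooth_is_derive x sp))).
  by rewrite !(test_fun_out tphi) ?mulr0 ?subrr//; [left|right].
move=> x _; apply: cvgD; apply: cvgM; [exact: cg|exact: cp|exact: cf|exact: cp'].
Qed.

Lemma H1_smooth f : smooth f -> H1 f /\
  {ae leb, forall x, I01 x -> dx f x = derive1 f x}.
Proof.
move=> sf; apply: H1_intro; first exact: L2_smooth.
  exact/L2_smooth/smooth_derive.
apply: weak_deriv_C1 => [x|]; first exact: smooth_is_derive.
exact/smooth_continuous/smooth_derive.
Qed.

(** Convergence in H1, split into the functions and their derivatives, with
    the classical derivatives of the approximating test functions. *)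
Definition H10_approx u g (phi : nat -> R -> R) :=
  [/\ forall n, test_fun 0 1 (phi n), cvgL2 phi u &
      cvgL2 (fun n => derive1 (phi n)) g].

Lemma H10_H1 u : H10 u -> H1 u. Proof. by case. Qed.

Lemma H10_L2 u : H10 u -> L2 u. Proof. by move=> /H10_H1 /H1_L2. Qed.
Lemma H10_dx_L2 u : H10 u -> L2 (dx u). Proof. by move=> /H10_H1 /H1_dx_L2. Qed.

Lemma le_sqrtD (a b : R) : 0 <= a -> a <= Num.sqrt (a ^+ 2 + b ^+ 2).
Proof.
move=> a0; rewrite -{1}(ger0_norm a0) -sqrtr_sqr ler_wsqrtr//.
by rewrite lerDl sqr_ge0.
Qed.

(** The representative of the weak derivative in the H1 norm can be replaced
    by phi' - dx u, by uniqueness of weak derivatives. *)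
Lemma H10_elim u : H10 u -> exists phi, H10_approx u (dx u) phi.
Proof.
move=> [hu [phi tphi cphi]]; exists phi.
have E n : norm2 (fun x => derive1 (phi n) x - dx u x) =
    norm2 (dx (fun x => phi n x - u x)).
  have [hp pd] := H1_smooth (test_fun_smooth (tphi n)).
  have [hpu d] := H1B hp hu.
  apply: norm2_ae.
  - by apply: L2B; [exact: test_dL2|exact: H1_dx_L2].
  - exact: H1_dx_L2.
  - by apply: filterS2 pd d => x H H' Ix; rewrite H'// H.
split=> //.
- apply: (squeeze_cvgr _ (cvg_cst 0) cphi); near=> n.
  by rewrite norm2_ge0/= le_sqrtD.
- rewrite /cvgL2 (eq_fun E).
  apply: (squeeze_cvgr _ (cvg_cst 0) cphi); near=> n.
  by rewrite norm2_ge0/= /H1_norm addrC le_sqrtD.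
Unshelve. all: by end_near. Qed.

Lemma H10_intro u phi : H1 u -> H10_approx u (dx u) phi -> H10 u.
Proof.
move=> hu [tphi c1 c2]; split=> //; exists phi => //.
have E n : norm2 (fun x => derive1 (phi n) x - dx u x) =
    norm2 (dx (fun x => phi n x - u x)).
  have [hp pd] := H1_smooth (test_fun_smooth (tphi n)).
  have [hpu d] := H1B hp hu.
  apply: norm2_ae.
  - by apply: L2B; [exact: test_dL2|exact: H1_dx_L2].
  - exact: H1_dx_L2.
  - by apply: filterS2 pd d => x H H' Ix; rewrite H'// H.
rewrite /cvgL2 (eq_fun E) in c2.
rewrite /H1_norm -[X in _ --> X]sqrtr0.
apply: continuous_cvg; first exact: sqrt_continuous.
rewrite -[X in _ --> X](addr0 0) -[X in _ --> X + _](mulr0 0) -[X in _ --> _ + X](mulr0 0).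
by apply: cvgD; apply: cvgM.
Qed.

Lemma H10B u v : H10 u -> H10 v -> H10 (fun x => u x - v x).
Proof.
move=> hu hv; have [phi [tp p1 p2]] := H10_elim hu.
have [chi [tc c1 c2]] := H10_elim hv.
have [huv d] := H1B (H10_H1 hu) (H10_H1 hv).
have Ed n : derive1 (fun x => phi n x - chi n x) =
    fun x => derive1 (phi n) x - derive1 (chi n) x.
  apply: derive1_of => x; apply: isd_sub; apply: smooth_is_derive.
    exact: test_fun_smooth (tp n).
  exact: test_fun_smooth (tc n).
have cB (f1 f2 : nat -> R -> R) (g1 g2 : R -> R) :
    (forall n, L2 (f1 n)) -> (forall n, L2 (f2 n)) -> L2 g1 -> L2 g2 ->
    cvgL2 f1 g1 -> cvgL2 f2 g2 ->
    cvgL2 (fun n x => f1 n x - f2 n x) (fun x => g1 x - g2 x).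
  move=> f12 f22 g12 g22 a1 a2.
  have H : norm2 (fun x => f1 n x - g1 x) + norm2 (fun x => f2 n x - g2 x)
    @[n --> \oo] --> (0 : R) by rewrite -[X in _ --> X]addr0; exact: cvgD.
  apply: (squeeze_cvgr _ (cvg_cst 0) H); near=> n; rewrite norm2_ge0/=.
  apply: le_trans (norm2B _ _); [|exact: L2B..].
  rewrite le_eqVlt; apply/orP; left; apply/eqP; congr norm2.
  by apply/funext => x; ring.
apply: (H10_intro (phi := fun n x => phi n x - chi n x) huv); split.
- move=> n; have [d1 [a1 [b1 [h1 h2 h3]]]] := tp n.
  have [d2 [a2 [b2 [k1 k2 k3]]]] := tc n.
  split; first by apply/smoothP/smoothB; apply/smoothP.
  exists (Num.min a1 a2), (Num.max b1 b2).
  rewrite lt_min h1 k1 gt_max h2 k2; split=> // x xn.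
  have [p0|pn] := eqVneq (phi n x) 0.
    have : chi n x != 0 by apply: contra_neq xn => ->; rewrite p0 subrr.
    by move=> /k3 /andP[ax xb]; rewrite ge_min ax orbT le_max xb orbT.
  by have /andP[ax xb] := h3 _ pn; rewrite ge_min ax le_max xb.
- apply: cB => //; try (by move=> n; exact: test_L2).
    exact: H10_L2.
  exact: H10_L2.
- rewrite (eq_fun Ed).
  have := cB _ _ _ _ (fun n => test_dL2 (tp n)) (fun n => test_dL2 (tc n))
    (H10_dx_L2 hu) (H10_dx_L2 hv) p2 c2.
  suff E n : norm2 (fun x => derive1 (phi n) x - derive1 (chi n) x
        - dx (fun x => u x - v x) x) =
      norm2 (fun x => derive1 (phi n) x - derive1 (chi n) x - (dx u x - dx v x)).
    by rewrite /cvgL2 (eq_fun E).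
  apply: norm2_ae.
  + by apply: L2B; [apply: L2B; exact: test_dL2|exact: H1_dx_L2].
  + by apply: L2B; apply: L2B; try exact: test_dL2; exact: H10_dx_L2.
  + by apply: filterS d => x H Ix; rewrite H.
Unshelve. all: by end_near. Qed.

(** The identity holds for test functions, and both sides are continuous in z
    for the H1 norm. *)
Lemma weak_IBP u g z : L2 u -> L2 g -> weak_deriv u g -> H10 z ->
  inner u (dx z) = - inner g z.
Proof.
move=> u2 g2 wu hz; have [phi [tp p1 p2]] := H10_elim hz.
have c1 : inner u (derive1 (phi n)) @[n --> \oo] --> inner u (dx z).
  apply: (cvg_inner (u := fun=> u)) => //; last exact: cvgL2_cst.
    by move=> n; exact: test_dL2.
  exact: H10_dx_L2.
have c2 : inner u (derive1 (phi n)) @[n --> \oo] --> - inner g z.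
  have E n : inner u (derive1 (phi n)) = - inner g (phi n) by exact: wu.
  rewrite (eq_fun E); apply: cvgN.
  apply: (cvg_inner (u := fun=> g)) => //; last exact: cvgL2_cst.
    by move=> n; exact: test_L2.
  exact: H10_L2.
exact: (cvg_unique _ c1 c2).
Qed.

Lemma H1_IBP u z : H1 u -> H10 z -> inner u (dx z) = - inner (dx u) z.
Proof.
by move=> hu hz; have [d wd] := H1_dx hu; apply: weak_IBP => //; exact: H1_L2.
Qed.

End sobolev.

(** * Boundedness and products in H10 *)

Section products.
Context {R : realType}.
Implicit Types (f g u v z : R -> R) (x a b k : R).
Let mI := @measurable_I01 R.

Lemma norm2_1 : norm2 (fun=> 1 : R) = 1.
Proof.
have E : leb (I01 : set R) = 1%E.
  have := @lebesgue_measure_itv R `]0, 1[; rewrite /= lte_fin ltr01 -EFinD subr0; exact.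
rewrite norm2_sqrt /inner Rintegral_cst; last exact: mI.
by rewrite E !mulr1 sqrtr1.
Qed.

(** phi x is the integral of phi' over ]0, x[, and the L1 norm on (0,1) is at
    most the L2 norm. *)
Lemma test_sup (phi : R -> R) x : test_fun 0 1 phi -> I01 x ->
  `|phi x| <= norm2 (derive1 phi).
Proof.
move=> tphi; rewrite /I01/= in_itv/= => /andP[x0 x1].
have sp := test_fun_smooth tphi.
have cp' := smooth_continuous (smooth_derive sp).
have d2 : L2 (derive1 phi) by exact: test_dL2.
have ii : intble I01 (fun x => `|derive1 phi x|) by apply: intble_norm; exact: intble_L2.
have i0 : intble `]0, x[ (derive1 phi) by apply: intble_cont => y _; exact: cp'.
have sub : `]0, x[ `<=` (I01 : set R).
  move=> y /=; rewrite /I01/= !in_itv/= => /andP[-> yx] /=; exact: lt_trans x1.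
have -> : phi x = \int[leb]_(y in `]0, x[) derive1 phi y.
  rewrite (FTC (ltW x0) (fun y _ => smooth_is_derive y sp) (fun y _ => cp' y)).
  by rewrite (@test_fun_out _ 0 1 phi 0) ?subr0//; left.
apply: le_trans (le_normr_Rintegral _ i0) _ => //.
have -> : \int[leb]_(y in `]0, x[) `|derive1 phi y| =
    \int[leb]_(y in I01) ((fun y => `|derive1 phi y|) \_ `]0, x[) y.
  by rewrite -Rintegral_mkcondr setIidr.
apply: (@le_trans _ _ (inner (fun x => `|derive1 phi x|) (fun=> 1))).
  rewrite /inner; under [leRHS]eq_Rintegral do rewrite mulr1.
  apply: le_Rintegral; [exact: mI| |exact: ii|]; last first.
    by move=> y _; rewrite patchE; case: ifP => _; rewrite ?lexx ?normr_ge0.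
  apply: (@le_intble _ _ _ (fun y => `|derive1 phi y|)) => //.
    apply/(measurable_restrict _ _ mI) => //.
    rewrite setIidr//; apply: measurableT_comp => //; exact: intble_meas i0.
  by move=> y _; rewrite patchE; case: ifP; rewrite ?normr_id// normr0.
have n2 : L2 (fun x => `|derive1 phi x|).
  have [md _] := (L2P _).1 d2.
  apply: (L2_sum_sq _ d2 d2); first exact: measurableT_comp.
  by apply: aeW => y _; rewrite normr_id lerDl.
rewrite (le_trans (ler_norm _))// (le_trans (cauchy_schwarz n2 (L2_cst 1)))//.
rewrite norm2_1 mulr1 !norm2_sqrt; rewrite le_eqVlt; apply/orP; left.
apply/eqP; congr Num.sqrt; apply: eq_Rintegral => y _.
by rewrite -!expr2 real_normK ?num_real.
Qed.

Lemma cvgL2_norm (phi : nat -> R -> R) u : (forall n, L2 (phi n)) -> L2 u ->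
  cvgL2 phi u -> norm2 (phi n) @[n --> \oo] --> norm2 u.
Proof.
move=> p2 u2 pu; rewrite norm2_sqrt; under eq_fun do rewrite norm2_sqrt.
apply: continuous_cvg; first exact: sqrt_continuous.
exact: cvg_inner.
Qed.

(** By test_sup, the test functions that approximate u are eventually bounded
    by a common k. The truncation (|u| - k)^+ is at most the distance from u
    to any function bounded by k, hence has norm 0. *)
Lemma H10_bounded u : H10 u ->
  exists k, {ae leb, forall x, I01 x -> `|u x| <= k}.
Proof.
move=> hu; have [phi [tp p1 p2]] := H10_elim hu.
have u2 := H10_L2 hu; have du2 := H10_dx_L2 hu.
pose k := norm2 (dx u) + 1; exists k.
(* T u is dominated by u - phi as soon as phi is bounded by k. *)
pose T x := Num.max (`|u x| - k) 0.
have mT : measurable_fun I01 T.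
  apply: measurable_maxr => //; apply: measurable_funB => //.
  by apply: measurableT_comp => //; exact: L2_meas.
have k0 : 0 <= k by rewrite /k addr_ge0 ?norm2_ge0 ?ler01.
have Tp x : 0 <= T x by rewrite le_max lexx orbT.
have T2 : L2 T.
  apply: (L2_sum_sq mT u2 u2); apply: aeW => x _.
  rewrite ger0_norm// ge_max addr_ge0// andbT lerBlDr -addrA lerDl.
  by rewrite addr_ge0 ?normr_ge0 ?k0.
have nk : \forall n \near \oo, norm2 (derive1 (phi n)) <= k.
  have := cvgL2_norm (fun n => test_dL2 (tp n)) du2 p2.
  by move=> /cvgr_le; apply; rewrite ltrDl.
suff : {ae leb, forall x, I01 x -> T x = 0}.
  apply: filterS => x H Ix; have := H Ix; rewrite /T => /eqP.
  by rewrite eq_maxr subr_le0.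
apply: norm2_small_ae => // e e0.
have pe : \forall n \near \oo, norm2 (fun x => phi n x - u x) <= e.
  by move: p1 => /cvgr_le; apply.
near \oo => n.
have kn : norm2 (derive1 (phi n)) <= k by near: n.
apply: (@le_trans _ _ (norm2 (fun x => phi n x - u x))); last by near: n.
have p2n := test_L2 (tp n).
apply: norm2_le => //; first exact: L2B.
apply: aeW => x Ix; rewrite ger0_norm// ge_max normr_ge0 andbT.
have := test_sup (tp n) Ix; move=> /le_trans /(_ kn) pk.
rewrite lerBlDr (le_trans _ (lerD (lexx _) pk))//.
by rewrite distrC -{1}(subrK (phi n x) (u x)) ler_normD.
Unshelve. all: by end_near. Qed.

Lemma H10_meas u : H10 u -> measurable_fun I01 u.
Proof. by move=> /H10_L2 /L2_meas. Qed.

Lemma H10M_L2 u f : H10 u -> L2 f -> L2 (fun x => u x * f x).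
Proof.
move=> hu f2; have [k uk] := H10_bounded hu.
by apply: L2_boundedM uk f2; exact: H10_meas.
Qed.

Lemma cvgL2_smoothM (chi : R -> R) (phi : nat -> R -> R) u : smooth chi ->
  (forall n, L2 (phi n)) -> L2 u -> cvgL2 phi u ->
  cvgL2 (fun n x => chi x * phi n x) (fun x => chi x * u x).
Proof.
move=> sc p2 u2 pu; have [k ck] := bounded_smooth sc.
apply: (@cvgL2_boundedM _ k) => //; first exact: L2_meas (L2_smooth sc).
by apply: aeW => x; exact: ck.
Qed.

Lemma smoothM_L2 (chi : R -> R) u : smooth chi -> L2 u ->
  L2 (fun x => chi x * u x).
Proof.
move=> sc u2; have [k ck] := bounded_smooth sc.
apply: (@L2_boundedM _ k) => //; first exact: L2_meas (L2_smooth sc).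
by apply: aeW => x; exact: ck.
Qed.

(** The product rule for test functions passes to the limit under L2
    convergence alone when the bounded factor chi, or its derivative, is
    attached to one of the two factors. *)
Lemma weak_deriv_sqr u : H10 u ->
  weak_deriv (fun x => u x * u x) (fun x => 2 * (u x * dx u x)).
Proof.
move=> hu chi tchi; have [phi [tp p1 p2]] := H10_elim hu.
have u2 := H10_L2 hu; have du2 := H10_dx_L2 hu.
have sc := test_fun_smooth tchi; have sc' := smooth_derive sc.
have P2 n := test_L2 (tp n); have D2 n := test_dL2 (tp n).
have c1 : inner (phi n) (fun x => derive1 chi x * phi n x) @[n --> \oo] -->
    inner u (fun x => derive1 chi x * u x).
  apply: cvg_inner => //.
  - by move=> n; exact: smoothM_L2.
  - exact: smoothM_L2.
  - exact: cvgL2_smoothM.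
have c2 : inner (derive1 (phi n)) (fun x => chi x * phi n x) @[n --> \oo] -->
    inner (dx u) (fun x => chi x * u x).
  apply: cvg_inner => //.
  - by move=> n; exact: smoothM_L2.
  - exact: smoothM_L2.
  - exact: cvgL2_smoothM.
have E n : inner (phi n) (fun x => derive1 chi x * phi n x) =
    - (2 * inner (derive1 (phi n)) (fun x => chi x * phi n x)).
  have sp := test_fun_smooth (tp n).
  have := @weak_deriv_C1 R (fun x => phi n x * phi n x) _
    (fun x => isd_mul (smooth_is_derive x sp) (smooth_is_derive x sp)).
  have cc : continuous (fun x => derive1 (phi n) x * phi n x + phi n x * derive1 (phi n) x).
    apply: smooth_continuous; apply: smoothD; apply: smoothM => //; exact: smooth_derive.
  move=> /(_ cc chi tchi) H.
  rewrite -innerZl//; last exact: smoothM_L2.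
  rewrite /inner -[LHS](_ : \int[leb]_(x in I01) (phi n x * phi n x * derive1 chi x) = _).
    rewrite H; congr (- _); apply: eq_Rintegral => x _; ring.
  by apply: eq_Rintegral => x _; ring.
have c3 : inner (phi n) (fun x => derive1 chi x * phi n x) @[n --> \oo] -->
    - (2 * inner (dx u) (fun x => chi x * u x)).
  by rewrite (eq_fun E); apply: cvgN; apply: cvgMr.
have := cvg_unique _ c1 c3 => /(_ (@norm_hausdorff _ _)) H.
transitivity (inner u (fun x => derive1 chi x * u x)).
  by apply: eq_Rintegral => x _; ring.
rewrite H -innerZl//; last exact: smoothM_L2.
by congr (- _); apply: eq_Rintegral => x _; ring.
Qed.

(** The integral of (u z^2)' vanishes. *)
Lemma H10_sqr_IBP u z : H10 u -> H10 z ->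
  inner (fun x => z x * z x) (dx u) = - (2 * inner (fun x => z x * dx z x) u).
Proof.
move=> hu hz; have z2 := H10_L2 hz; have dz2 := H10_dx_L2 hz.
rewrite -innerZl; [|exact: H10M_L2|exact: H10_L2].
apply: (weak_IBP _ _ (weak_deriv_sqr hz)) => //; first exact: H10M_L2.
by apply: L2Z; exact: H10M_L2.
Qed.

(** For z = u, H10_sqr_IBP reads X = - 2 X. *)
Lemma H10_cubic u : H10 u -> inner (fun x => u x * dx u x) u = 0.
Proof.
move=> hu; have := H10_sqr_IBP hu hu.
have -> : inner (fun x => u x * u x) (dx u) = inner (fun x => u x * dx u x) u.
  by apply: eq_Rintegral => x _; ring.
by move=> H; lra.
Qed.

(** This is how an L4 bound enters L2 estimates. *)
Lemma norm2_sqr_L4 f : norm2 (fun x => f x * f x) = Lp_norm 4%:E f ^+ 2.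
Proof.
rewrite norm2_sqrt.
suff -> : inner (fun x => f x * f x) (fun x => f x * f x) = (Lp_norm 4%:E f ^+ 2) ^+ 2.
  by rewrite sqrtr_sqr ger0_norm// sqr_ge0.
rewrite /Lp_norm /inner /Rintegral.
have -> : (\int[leb]_(x in I01) (f x * f x * (f x * f x))%:E =
    'N[leb]_4%:E [EFin \o (f \_ I01)] `^ 4)%E.
  rewrite powR_Lnorm// [LHS]integral_mkcond; apply: eq_integral => x _.
  rewrite /= !patchE; case: ifPn => _ /=.
    rewrite powR_mulrn// -[(_ ^+ 4)%R]/(`|f x| ^+ (2 * 2))%R exprM real_normK ?num_real//. 
  by rewrite ?normr0 powR0.
have := @Lnorm_ge0 _ _ _ leb 4%:E (EFin \o (f \_ I01)).
case: Lnorm => [r||]//=.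
- by rewrite lee_fin => r0; rewrite powR_mulrn// -exprM.
- by move=> _; rewrite ifF ?pnatr_eq0 //= expr0n expr0n.
Qed.

End products.

(** * The inequality of Wirtinger *)

Section wirtinger.
Context {R : realType}.
Implicit Types (f g : R -> R) (x a b c k w : R).

Lemma Rint_split f a b c : a <= c -> c <= b -> intble `]a, b[ f ->
  \int[leb]_(x in `]a, b[) f x =
  \int[leb]_(x in `]a, c[) f x + \int[leb]_(x in `]c, b[) f x.
Proof.
move=> ac cb fi; have [->|cb'] := eqVneq c b.
  by rewrite set_itvoo0 Rintegral_set0 addr0.
have clt : c < b by rewrite lt_neqAle cb'.
have fac : intble `]a, c[ f.
  apply: intble_sub fi => // x /=; rewrite !in_itv/= => /andP[-> xc] /=.
  exact: lt_le_trans cb.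
rewrite (Rint_oc fac) -(@Rintegral_itvB _ f (BRight a) (BLeft b) c)//.
by rewrite addrC subrK.
Qed.

(** With m the midpoint and F = w tan(w (x - m)) f^2, the sum f'^2 - w^2 f^2 +
    F' is the square of f' + w tan(w (x - m)) f, and the integral of F'
    vanishes. The tangent has no pole in [a, b] because w (b - a) < pi. *)
Lemma wirtinger_lt f a b w : a < b -> 0 < w -> w * (b - a) < pi -> smooth f ->
  f a = 0 -> f b = 0 ->
  w ^+ 2 * \int[leb]_(x in `]a, b[) (f x * f x) <=
  \int[leb]_(x in `]a, b[) (derive1 f x * derive1 f x).
Proof.
move=> ab w0 wab sf fa fb; pose m := (a + b) / 2.
have sf' := smooth_derive sf.
pose y x := w * x + - (w * m).
have cosy x : a <= x <= b -> 0 < cos (y x).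
  move=> /andP[ax xb]; apply: cos_gt0_pihalf; rewrite /y /m.
  have H1 : w * a <= w * x by rewrite ler_pM2l.
  have H2 : w * x <= w * b by rewrite ler_pM2l.
  by apply/andP; split; lra.
pose t x := tan (y x).
have dt x : a <= x <= b -> is_derive x 1 t (w * (1 + t x ^+ 2)).
  move=> xab; have c0 := cosy x xab.
  apply: (@isd_affine _ tan x _ w (- (w * m))).
  apply: is_derive_eq (is_derive_tan _) _; first by rewrite gt_eqF.
  by rewrite /t cos2_tan2 ?gt_eqF// exprVn.
have ct x : a <= x <= b -> {for x, continuous t}.
  move=> xab; apply: differentiable_continuous; apply/derivable1_diffP.
  by have [] := dt x xab.
have cf x : {for x, continuous f} by exact: smooth_continuous.
have cf' x : {for x, continuous (derive1 f)} by exact: smooth_continuous.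
pose F x := w * (t x * (f x * f x)).
pose F' x := w * (w * (1 + t x ^+ 2) * (f x * f x) +
   t x * (derive1 f x * f x + f x * derive1 f x)).
have dF x : a <= x <= b -> is_derive x 1 F (F' x).
  move=> xab; apply: isd_scale; apply: isd_mul; first exact: dt.
  by apply: isd_mul; exact: smooth_is_derive.
have cF' x : a <= x <= b -> {for x, continuous F'}.
  move=> xab; have ctx := ct x xab.
  have tt : {for x, continuous (fun x => 1 + t x ^+ 2)}.
    by apply: cvgD; [exact: cvg_cst|exact: cvgM].
  apply: cvgMr; apply: cvgD; apply: cvgM => //.
  - exact: cvgMr.
  - by apply: cvgM; [exact: cf|exact: cf].
  - by apply: cvgD; apply: cvgM; [exact: cf'|exact: cf|exact: cf|exact: cf'].
have iF' := intble_cont cF'.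
have i1 : intble `]a, b[ (fun x => f x * f x).
  by apply: intble_cont => x _; apply: cvgM; exact: cf.
have i2 : intble `]a, b[ (fun x => derive1 f x * derive1 f x).
  by apply: intble_cont => x _; apply: cvgM; exact: cf'.
have mab : measurable (`]a, b[ : set (measurableTypeR R)) by exact: measurable_itv.
have F0 : \int[leb]_(x in `]a, b[) F' x = 0.
  by rewrite (FTC (ltW ab) dF cF') /F fa fb !(mulr0,mul0r) subrr.
rewrite -RintegralZl// -[leRHS]addr0 -F0 -RintegralD//.
apply: le_Rintegral => //; [exact: intbleZ|exact: intbleD|].
move=> x _; rewrite -subr_ge0 /F'.
have -> : derive1 f x * derive1 f x +
  w * (w * (1 + t x ^+ 2) * (f x * f x) +
  t x * (derive1 f x * f x + f x * derive1 f x)) - w ^+ 2 * (f x * f x) =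
  (derive1 f x + w * t x * f x) ^+ 2 by ring.
exact: sqr_ge0.
Qed.

(** Used to reach the sharp constant pi / (b - a), at which the tangent in
    wirtinger_lt blows up. *)
Lemma sqr_lim_le (A B W : R) : 0 <= B -> 0 < W ->
  (forall w, 0 < w -> w < W -> w ^+ 2 * A <= B) -> W ^+ 2 * A <= B.
Proof.
move=> B0 W0 H; rewrite leNgt; apply/negP => BA.
have A0 : 0 < A.
  rewrite ltNge; apply/negP => A0; have := lt_le_trans BA (mulr_ge0_le0 (sqr_ge0 W) A0).
  by rewrite ltNge B0.
have q0 : 0 <= B / A by rewrite divr_ge0// ltW.
pose q := Num.sqrt (B / A).
have qq : q ^+ 2 = B / A by rewrite sqr_sqrtr.
(* Between q, where q^2 A = B, and W, where W^2 A > B, the hypothesis fails.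
   *)
have qW : q < W.
  by rewrite -(@ltr_pXn2r _ 2)// ?nnegrE ?sqrtr_ge0 ?(ltW W0)// qq ltr_pdivrMr.
have q00 : 0 <= q by exact: sqrtr_ge0.
have := H ((q + W) / 2) ltac:(lra) ltac:(lra).
rewrite -ler_pdivlMr// -qq ler_pXn2r// ?nnegrE//; last by lra.
by move=> ?; lra.
Qed.

Lemma wirtinger f a b : a < b -> smooth f -> f a = 0 -> f b = 0 ->
  (pi / (b - a)) ^+ 2 * \int[leb]_(x in `]a, b[) (f x * f x) <=
  \int[leb]_(x in `]a, b[) (derive1 f x * derive1 f x).
Proof.
move=> ab sf fa fb; have ba : 0 < b - a by rewrite subr_gt0.
apply: sqr_lim_le.
- by apply: Rintegral_ge0 => x _; rewrite -expr2 sqr_ge0.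
- by rewrite divr_gt0// pi_gt0.
- move=> w w0 wW; apply: wirtinger_lt => //.
  by rewrite -ltr_pdivlMr.
Qed.

(** Apply wirtinger on each of the n.+1 subintervals and add. *)
Lemma wirtinger_nodes f (n : nat) : smooth f ->
  (forall j, (j <= n.+1)%N -> f (j%:R / n.+1%:R) = 0) ->
  (n.+1%:R * pi) ^+ 2 * inner f f <= inner (derive1 f) (derive1 f).
Proof.
move=> sf f0; pose h : R := n.+1%:R^-1.
have h0 : 0 < h by rewrite invr_gt0.
have cf := smooth_continuous sf; have cf' := smooth_continuous (smooth_derive sf).
suff H j : (j <= n.+1)%N ->
    (n.+1%:R * pi) ^+ 2 * \int[leb]_(x in `]0, (j%:R * h)[) (f x * f x) <=
    \int[leb]_(x in `]0, (j%:R * h)[) (derive1 f x * derive1 f x).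
  by have := H n.+1 (leqnn _); rewrite /h divff.
elim: j => [_|j ih jn].
  by rewrite mul0r set_itvoo0 !Rintegral_set0 mulr0.
have jh : 0 <= j%:R * h by rewrite mulr_ge0// ltW.
have jS : j%:R * h < j.+1%:R * h by rewrite ltr_pM2r// ltr_nat.
rewrite (Rint_split jh (ltW jS)); last first.
  by apply: intble_cont => x _; apply: cvgM; exact: cf.
rewrite (Rint_split jh (ltW jS)); last first.
  by apply: intble_cont => x _; apply: cvgM; exact: cf'.
rewrite mulrDr; apply: lerD; first by apply: ih; exact: ltnW.
have := wirtinger jS sf (f0 j (ltnW jn)) (f0 j.+1 jn).
have -> : j.+1%:R * h - j%:R * h = h by rewrite -mulrBl -natrB// subSnn mul1r.
by rewrite /h invrK [pi * _]mulrC.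
Qed.

End wirtinger.

(** * The spectral gap of the sines *)

Section sines.
Context {R : realType}.
Implicit Types (f g : R -> R) (x a b c : R) (i j k n : nat).

Lemma smooth_sin_cos n : Ck n (@sin R) /\ Ck n (@cos R).
Proof.
elim: n => [|n [ihs ihc]].
  by split; [apply: (CkI (@is_derive_sin R))|apply: (CkI (@is_derive_cos R))].
split; first exact: (CkI (@is_derive_sin R)).
apply: (CkI (@is_derive_cos R)).
under eq_fun do rewrite -mulN1r; exact: CkZ.
Qed.

Definition sine k x : R := Num.sqrt 2 * sin (k%:R * pi * x).
Definition freq k : R := k%:R * pi.
Definition eig k : R := freq k ^+ 2.

Lemma smooth_sine k : smooth (sine k).
Proof.
apply: smoothZ; have := @smooth_aff R sin (k%:R * pi) 0.
by under eq_fun do rewrite addr0; apply => n; have [] := smooth_sin_cos n.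
Qed.

Lemma sine_derive k x :
  is_derive x 1 (sine k) (Num.sqrt 2 * (freq k * cos (freq k * x))).
Proof.
apply: isd_scale; have := @isd_affine R sin x (cos (freq k * x + 0)) (freq k) 0 (is_derive_sin _).
by rewrite addr0; under eq_fun do rewrite addr0.
Qed.

Lemma derive1_sine k :
  derive1 (sine k) = fun x => Num.sqrt 2 * (freq k * cos (freq k * x)).
Proof. exact: derive1_of (sine_derive k). Qed.

Lemma derive2_sine k :
  derive1 (derive1 (sine k)) = fun x => - (eig k * sine k x).
Proof.
rewrite derive1_sine; apply: derive1_of => x.
have H : is_derive x 1 (fun x => cos (freq k * x)) (freq k * - sin (freq k * x)).
  have := @isd_affine R cos x (- sin (freq k * x + 0)) (freq k) 0 (is_derive_cos _).
  by rewrite addr0; under eq_fun do rewrite addr0.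
apply: is_derive_eq (isd_scale _ (isd_scale _ H)) _.
by rewrite /eig /sine /freq; ring.
Qed.

Lemma sin_natpi k : sin (k%:R * pi : R) = 0.
Proof.
elim: k => [|k ih]; first by rewrite mul0r sin0.
by rewrite -natr1 mulrDl mul1r sinDpi ih oppr0.
Qed.

Lemma sine0 k : sine k 0 = 0.
Proof. by rewrite /sine mulr0 sin0 mulr0. Qed.

Lemma sine1 k : sine k 1 = 0.
Proof. by rewrite /sine mulr1 sin_natpi mulr0. Qed.

Lemma L2_sine k : L2 (sine k). Proof. exact/L2_smooth/smooth_sine. Qed.
Lemma L2_dsine k : L2 (derive1 (sine k)).
Proof. exact/L2_smooth/smooth_derive/smooth_sine. Qed.

Lemma eig_ge0 k : 0 <= eig k. Proof. exact: sqr_ge0. Qed.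

Lemma eig_lt j k : (eig j < eig k) = (j < k)%N.
Proof.
rewrite /eig ltr_pXn2r ?nnegrE ?mulr_ge0 ?pi_ge0//.
by rewrite /freq ltr_pM2r ?pi_gt0// ltr_nat.
Qed.

Lemma eig_le j k : (j <= k)%N -> eig j <= eig k.
Proof. by rewrite leq_eqVlt => /predU1P[->//|]; rewrite -eig_lt => /ltW. Qed.

Lemma eig_gt0 k : (0 < k)%N -> 0 < eig k.
Proof. by move=> k0; rewrite (le_lt_trans (eig_ge0 0))// eig_lt. Qed.

Lemma eig_inj : injective eig.
Proof.
by move=> j k jk; case: (ltngtP j k) => //; rewrite -eig_lt jk ltxx.
Qed.

(** The integral of (f (sine k)')' vanishes. *)
Lemma inner_dsine f k : smooth f -> f 0 = 0 -> f 1 = 0 ->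
  inner (derive1 f) (derive1 (sine k)) = eig k * inner f (sine k).
Proof.
move=> sf f0 f1; have ss := smooth_sine k; have ss' := smooth_derive ss.
have sf' := smooth_derive sf.
have D x := isd_mul (smooth_is_derive x sf) (smooth_is_derive x ss').
have f2 := L2_smooth sf; have s2 := L2_sine k.
have : \int[leb]_(x in I01) (derive1 f x * derive1 (sine k) x +
    f x * derive1 (derive1 (sine k)) x) = 0.
  rewrite (FTC ler01 (fun x _ => D x)); first by rewrite f0 f1 !mul0r subrr.
  move=> x _; apply: smooth_continuous; apply: smoothD; apply: smoothM => //.
  exact: smooth_derive.
rewrite RintegralD//; last 3 first.
- exact: measurable_I01.
- by apply: L2M; exact: L2_smooth.
- by apply: L2M; [exact: L2_smooth|exact/L2_smooth/smooth_derive].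
move=> /eqP; rewrite addr_eq0 => /eqP H; apply: (etrans H).
rewrite -[RHS]opprK -mulNr -innerZr//; congr (- _).
by apply: eq_Rintegral => x _; rewrite derive2_sine mulNr.
Qed.

(** If j <> k, integrating by parts in two ways gives eig j X = eig k X. If j
    = k, it shows that sine^2 and sine'^2 / eig k have the same integral, and
    these two functions add up to 2. *)
Lemma sine_orthonormal j k : (0 < k)%N -> inner (sine j) (sine k) = (j == k)%:R.
Proof.
move=> k0; have [->|jk] := eqVneq j k.
  have H := inner_dsine k (smooth_sine k) (sine0 k) (sine1 k).
  have : eig k * inner (sine k) (sine k) +
      inner (derive1 (sine k)) (derive1 (sine k)) = eig k * 2.
    rewrite -innerZl; [|exact: L2_sine..].
    rewrite /inner -RintegralD; last 3 first.
    - exact: measurable_I01.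
    - by apply: L2M; [apply: L2Z|]; exact: L2_sine.
    - by apply: L2M; exact: L2_dsine.
    transitivity (\int[leb]_(x in I01) (eig k * 2)).
      apply: eq_Rintegral => x _; rewrite derive1_sine /sine /eig /freq.
      set y := k%:R * pi * x.
      have s2 : Num.sqrt 2 ^+ 2 = 2 :> R by rewrite sqr_sqrtr.
      rewrite -[in RHS]s2 -[RHS]mulr1 -(cos2Dsin2 y); ring.
    have := norm2_sq (fun=> 1 : R); rewrite norm2_1 expr1n => E.
    rewrite -[RHS]mulr1 E -innerZr//; try exact: L2_cst.
    by apply: eq_Rintegral => x _; rewrite mul1r mulr1.
  have e0 : eig k != 0 by rewrite gt_eqF// eig_gt0.
  rewrite H -mulrDr => /(mulfI e0) => E. rewrite -[RHS]/(1 : R); lra.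
have H1 := inner_dsine k (smooth_sine j) (sine0 j) (sine1 j).
have := inner_dsine j (smooth_sine k) (sine0 k) (sine1 k).
rewrite innerC H1 (innerC (sine k)) => /eqP.
rewrite -subr_eq0 -mulrBl mulf_eq0 subr_eq0 => /predU1P[/eig_inj kj|/eqP//].
by rewrite kj eqxx in jk.
Qed.

(** The coefficient of sine i.+1 has index i. *)
Definition sinep n (c : 'rV[R]_n) x : R := \sum_(i < n) c 0 i * sine i.+1 x.

Lemma smooth_sinep n (c : 'rV[R]_n) : smooth (sinep c).
Proof. by apply: smooth_sum => i; apply: smoothZ; exact: smooth_sine. Qed.

Lemma L2_sinep n (c : 'rV[R]_n) : L2 (sinep c).
Proof. exact/L2_smooth/smooth_sinep. Qed.

Lemma derive1_sinep n (c : 'rV[R]_n) :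
  derive1 (sinep c) = fun x => \sum_(i < n) c 0 i * derive1 (sine i.+1) x.
Proof.
apply: derive1_of => x; rewrite /sinep.
elim: (index_enum _) => [|i r ih].
  by under eq_fun do rewrite big_nil; rewrite big_nil; exact: isd_cst.
under eq_fun do rewrite big_cons; rewrite big_cons; apply: isd_add => //.
by apply: isd_scale; apply: smooth_is_derive; exact: smooth_sine.
Qed.

Lemma sinep0 n (c : 'rV[R]_n) : sinep c 0 = 0.
Proof. by rewrite /sinep big1// => i _; rewrite sine0 mulr0. Qed.

Lemma sinep1 n (c : 'rV[R]_n) : sinep c 1 = 0.
Proof. by rewrite /sinep big1// => i _; rewrite sine1 mulr0. Qed.

Lemma inner_sinep n (c : 'rV[R]_n) f : L2 f ->
  inner (sinep c) f = \sum_(i < n) c 0 i * inner (sine i.+1) f.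
Proof.
move=> f2; rewrite /sinep inner_suml//; last by move=> i; apply: L2Z; exact: L2_sine.
by apply: eq_bigr => i _; rewrite innerZl//; exact: L2_sine.
Qed.

Lemma inner_dsinep n (c : 'rV[R]_n) f : smooth f -> f 0 = 0 -> f 1 = 0 ->
  inner (derive1 (sinep c)) (derive1 f) =
  \sum_(i < n) c 0 i * (eig i.+1 * inner (sine i.+1) f).
Proof.
move=> sf f0 f1; have d2 := L2_smooth (smooth_derive sf).
rewrite derive1_sinep inner_suml//; last by move=> i; apply: L2Z; exact: L2_dsine.
apply: eq_bigr => i _; rewrite innerZl//; last exact: L2_dsine.
by rewrite innerC inner_dsine// innerC.
Qed.

Lemma sinep_coef n (c : 'rV[R]_n) (i : 'I_n) :
  inner (sine i.+1) (sinep c) = c 0 i.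
Proof.
rewrite innerC inner_sinep; last exact: L2_sine.
rewrite (bigD1 i)//= sine_orthonormal// eqxx mulr1 big1 ?addr0// => j ji.
by rewrite sine_orthonormal// eqSS (_ : (j == i :> nat) = false) ?mulr0//; exact/negbTE.
Qed.

Lemma sinep_sqnorm n (c : 'rV[R]_n) :
  inner (sinep c) (sinep c) = \sum_(i < n) c 0 i ^+ 2.
Proof.
rewrite inner_sinep; last exact: L2_sinep.
by apply: eq_bigr => i _; rewrite sinep_coef expr2.
Qed.

Lemma dsinep_sqnorm n (c : 'rV[R]_n) :
  inner (derive1 (sinep c)) (derive1 (sinep c)) =
  \sum_(i < n) eig i.+1 * c 0 i ^+ 2.
Proof.
rewrite inner_dsinep; [|exact: smooth_sinep|exact: sinep0|exact: sinep1].
by apply: eq_bigr => i _; rewrite sinep_coef; ring.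
Qed.

(** A combination of the first n sines that vanishes at the nodes is 0:
    wirtinger_nodes bounds its Dirichlet integral below by eig n.+1 times its
    squared norm, and orthonormality bounds it above by eig n times its
    squared norm. So the square linear system is injective, hence solvable. *)
Lemma interpolation n f : exists c : 'rV[R]_n,
  forall j : 'I_n, sinep c (j.+1%:R / n.+1%:R) = f (j.+1%:R / n.+1%:R).
Proof.
pose M : 'M[R]_n := \matrix_(i, j) sine i.+1 (j.+1%:R / n.+1%:R).
have ME (c : 'rV[R]_n) (j : 'I_n) : (c *m M) 0 j = sinep c (j.+1%:R / n.+1%:R).
  by rewrite mxE; apply: eq_bigr => i _; rewrite mxE.
have inj (c : 'rV[R]_n) : c *m M = 0 -> c = 0.
  move=> cM.
  have nodes j : (j <= n.+1)%N -> sinep c (j%:R / n.+1%:R) = 0.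
    case: j => [_|j]; first by rewrite mul0r sinep0.
    rewrite ltnS leq_eqVlt => /predU1P[->|jn]; first by rewrite divff ?sinep1.
    by rewrite -(ME c (Ordinal jn)) cM mxE.
  have := wirtinger_nodes (smooth_sinep c) nodes.
  rewrite sinep_sqnorm dsinep_sqnorm -/(freq _) -/(eig _) mulr_sumr -subr_ge0 -sumrB => H.
  have : \sum_(i < n) (eig n.+1 - eig i.+1) * c 0 i ^+ 2 = 0.
    apply/eqP; rewrite eq_le; apply/andP; split.
      rewrite -oppr_ge0 -sumrN; apply: le_trans H _; rewrite le_eqVlt; apply/orP; left.
      by apply/eqP; apply: eq_bigr => i _; ring.
    apply: sumr_ge0 => i _; rewrite mulr_ge0 ?sqr_ge0// subr_ge0.
    by rewrite eig_le// ltnS ltnW.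
  move=> /eqP; rewrite psumr_eq0; last first.
    move=> i _; rewrite mulr_ge0 ?sqr_ge0// subr_ge0.
    by rewrite eig_le// ltnS ltnW.
  move=> /allP H0; apply/rowP => i; rewrite mxE.
  have := H0 i (mem_index_enum _); rewrite /= mulf_eq0 subr_eq0 sqrf_eq0.
  by case/predU1P => [/eig_inj[/esym ni]|/eqP//]; have := ltn_ord i; rewrite {1}ni ltnn.
have Mu : M \in unitmx.
  rewrite -row_free_unit; apply/row_freeP.
  have : kermx M == 0.
    apply/eqP/row_matrixP => i; rewrite row0; apply: inj.
    by rewrite -row_mul mulmx_ker row0.
  by rewrite kermx_eq0 => /row_freeP.
exists ((\row_j f (j.+1%:R / n.+1%:R)) *m invmx M) => j.
by rewrite -ME mulmxKV// mxE.
Qed.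

(** Let sinep c interpolate f at the nodes and let a_i be the sine
    coefficients of f. Expanding wirtinger_nodes for f - sinep c by
    orthonormality, each mode contributes (eig n.+1 - eig i)((c_i - a_i)^2 -
    a_i^2), which is at least - eig n.+1 a_i^2. *)
Lemma spectral_gap_smooth n f : smooth f -> f 0 = 0 -> f 1 = 0 ->
  eig n.+1 * (inner f f - \sum_(i < n) inner f (sine i.+1) ^+ 2) <=
  inner (derive1 f) (derive1 f).
Proof.
move=> sf f0 f1; have [c cf] := interpolation n f.
pose q x := f x - sinep c x.
have sp := smooth_sinep c.
have sq : smooth q by exact: smoothB.
have nodes j : (j <= n.+1)%N -> q (j%:R / n.+1%:R) = 0.
  rewrite /q; case: j => [_|j]; first by rewrite mul0r f0 sinep0 subrr.
  rewrite ltnS leq_eqVlt => /predU1P[->|jn]; first by rewrite divff// f1 sinep1 subrr.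
  by rewrite (cf (Ordinal jn)) subrr.
have := wirtinger_nodes sq nodes.
rewrite -/(freq _) -/(eig _).
have f2 := L2_smooth sf; have p2 := L2_sinep c.
have f2' := L2_smooth (smooth_derive sf); have p2' := L2_smooth (smooth_derive sp).
have -> : derive1 q = fun x => derive1 f x - derive1 (sinep c) x.
  by apply: derive1_of => x; apply: isd_sub; exact: smooth_is_derive.
rewrite /q !innerBl ?innerBr//; try exact: L2B.
rewrite (innerC f (sinep c)) (innerC (derive1 f) (derive1 (sinep c))).
rewrite inner_sinep// inner_dsinep// sinep_sqnorm dsinep_sqnorm.
set A := inner f f; set B := inner (derive1 f) _.
have -> : \sum_(i < n) inner f (sine i.+1) ^+ 2 = \sum_(i < n) inner (sine i.+1) f ^+ 2.
  by apply: eq_bigr => i _; rewrite innerC.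
move=> H.
have key : \sum_(i < n) (eig n.+1 - eig i.+1) * (c 0 i ^+ 2 - 2 * (c 0 i * inner (sine i.+1) f))
  >= - (eig n.+1 * \sum_(i < n) inner (sine i.+1) f ^+ 2).
  rewrite mulr_sumr -sumrN; apply: ler_sum => i _.
  have l : eig i.+1 <= eig n.+1 by rewrite eig_le// ltnS ltnW.
  have := eig_ge0 i.+1; set a := inner _ _; set ci := c 0 i => e0.
  have : 0 <= (eig n.+1 - eig i.+1) * (ci - a) ^+ 2 by rewrite mulr_ge0 ?sqr_ge0 ?subr_ge0.
  have : 0 <= eig i.+1 * a ^+ 2 by rewrite mulr_ge0 ?sqr_ge0.
  by lra.
move: key H.
have -> : \sum_(i < n) (eig n.+1 - eig i.+1) * (c 0 i ^+ 2 - 2 * (c 0 i * inner (sine i.+1) f))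
  = eig n.+1 * (\sum_(i < n) c 0 i ^+ 2 - 2 * \sum_(i < n) c 0 i * inner (sine i.+1) f)
  - (\sum_(i < n) eig i.+1 * c 0 i ^+ 2 - 2 * \sum_(i < n) c 0 i * (eig i.+1 * inner (sine i.+1) f)).
  rewrite !mulr_sumr -!sumrB mulr_sumr -sumrB; apply: eq_bigr => i _; ring.
set S1 := \sum_(i < n) _; set S2 := \sum_(i < n) _; set S3 := \sum_(i < n) _.
set S4 := \sum_(i < n) _; set S5 := \sum_(i < n) _.
by lra.
Qed.

End sines.

(** * Smooth functions vanishing at the end points are in H10 *)

Section cutoff.
Context {R : realType}.
Implicit Types (f g : R -> R) (x a b c m : R).
Let mI := @measurable_I01 R.

Lemma lipschitz_smooth f : smooth f -> exists2 k, 0 <= k &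
  forall x y, 0 <= x -> x <= y -> y <= 1 -> `|f y - f x| <= k * (y - x).
Proof.
move=> sf; have cf' := smooth_continuous (smooth_derive sf).
have [k H] := @bounded_cont R (derive1 f) 0 1 (fun x _ => cf' x).
exists k; first by apply: le_trans (H 0 _); rewrite ?lexx ?ler01.
move=> x y x0 xy y1.
have i0 : intble `]x, y[ (derive1 f) by apply: intble_cont => z _; exact: cf'.
rewrite -(FTC xy (fun z _ => smooth_is_derive z sf) (fun z _ => cf' z)).
apply: le_trans (le_normr_Rintegral _ i0) _ => //.
have Ek : \int[leb]_(z in `]x, y[) k = k * (y - x).
  have D (z : R) : is_derive z 1 (fun z => k * z) k.
    by apply: is_derive_eq (isd_scale k (isd_id z)) _; rewrite mulr1.
  have C (z : R) : {for z, continuous (fun _ : R => k)} by exact: cvg_cst.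
  by rewrite (FTC xy (fun z _ => D z) (fun z _ => C z)) mulrBr.
rewrite -Ek; apply: le_Rintegral => //.
- exact: intble_norm.
- exact: intble_cst.
- move=> z; rewrite /= in_itv/= => /andP[xz zy]; apply: H.
  by rewrite (le_trans x0 (ltW xz)) (le_trans (ltW zy) y1).
Qed.

(** The cutoff is a function of m x, so that x cut'(x) is bounded uniformly in
    m. *)
Definition cut m x : R := step 1 2 (m * x).

Let lt12 : (1 : R) < 2. Proof. by rewrite ltr1n. Qed.

Lemma smooth_cut m : smooth (cut m).
Proof.
have := @smooth_aff R (step 1 2) m 0 (smooth_step lt12).
by under eq_fun do rewrite addr0.
Qed.

Lemma cut_derive m x : is_derive x 1 (cut m) (m * derive1 (step 1 2) (m * x)).
Proof.
have := @isd_affine R (step 1 2) x (derive1 (step 1 2) (m * x + 0)) m 0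
  (smooth_is_derive _ (smooth_step lt12)).
by rewrite addr0; under eq_fun do rewrite addr0.
Qed.

Lemma cut_left m x : m * x <= 1 -> cut m x = 0.
Proof. by move=> mx; rewrite /cut step_left. Qed.

Lemma cut_right m x : 2 <= m * x -> cut m x = 1.
Proof. by move=> mx; rewrite /cut (step_right lt12). Qed.

Lemma cut_norm m x : `|cut m x| <= 1.
Proof. by rewrite ger0_norm ?step_ge0// step_le1. Qed.

Lemma cut_derive_bound : exists2 K : R, 0 <= K &
  forall m x, 0 < m -> 0 <= x -> `|x * (m * derive1 (step 1 2) (m * x))| <= K.
Proof.
have cs := smooth_continuous (smooth_derive (smooth_step lt12)).
have [K H] := @bounded_cont R (derive1 (step 1 2)) 1 2 (fun x _ => cs x).
have K0 : 0 <= K by apply: le_trans (H 1 _) => //; rewrite lexx ltW.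
exists (2 * K); first by rewrite mulr_ge0.
move=> m x m0 x0; rewrite mulrA [x * m]mulrC normrM.
have mx0 : 0 <= m * x by rewrite mulr_ge0// ltW.
have [mx1|mx1] := ltP (m * x) 1.
  by rewrite (derive1_step_out lt12) ?normr0 ?mulr0 ?mulr_ge0//; left.
have [mx2|mx2] := ltP 2 (m * x).
  by rewrite (derive1_step_out lt12) ?normr0 ?mulr0 ?mulr_ge0//; right.
by rewrite ger0_norm// ler_pM// H// mx1.
Qed.

(** Dominated convergence, when the sequence is eventually constant at each
    point. *)
Lemma cvgL2_dc (u : nat -> R -> R) f (K : R) : (forall n, L2 (u n)) -> L2 f ->
  (forall n x, I01 x -> `|u n x - f x| <= K) ->
  (forall x, I01 x -> \forall n \near \oo, u n x = f x) ->
  cvgL2 u f.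
Proof.
move=> u2 f2 uK uf; rewrite /cvgL2 -[X in _ --> X]sqrtr0.
under eq_fun do rewrite norm2_sqrt.
apply: continuous_cvg; first exact: sqrt_continuous.
have -> : (0 : R) = \int[leb]_(x in I01) 0 by rewrite Rintegral_cst// mul0r.
apply: (@Rintegral_dc _ _ _ _ (fun=> K * K)) => //.
- by move=> n; apply: intble_meas; apply: L2M; exact: L2B.
- exact: (@intble_cst R 0 1).
- by move=> n x Ix; rewrite normrM ler_pM// uK.
- move=> x Ix; apply: cvg_near_cst; apply: filterS (uf x Ix) => n ->.
  by rewrite subrr mulr0.
Qed.

(** Multiply f by cutoffs at both ends. Since f grows at most linearly from
    the ends, the terms f cut' remain bounded while their supports shrink to
    the end points. *)
Lemma H10_smooth f : smooth f -> f 0 = 0 -> f 1 = 0 -> H10 f.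
Proof.
move=> sf f0 f1; have [hf df] := H1_smooth sf.
have sf' := smooth_derive sf.
pose m n : R := n.+3%:R.
have m0 n : 0 < m n by [].
pose chi n x := cut (m n) x * cut (m n) (1 - x).
have srefl n : smooth (fun x => cut (m n) (1 - x)).
  have := @smooth_aff R (cut (m n)) (- 1) 1 (smooth_cut _).
  by under eq_fun do rewrite mulN1r addrC.
have schi n : smooth (chi n) by apply: smoothM => //; exact: smooth_cut.
pose phi n x := f x * chi n x.
have sphi n : smooth (phi n) by exact: smoothM.
have near_big x : 0 < x -> \forall n \near \oo, 2 < m n * x.
  move=> x0; have : \forall n \near \oo, 2 / x < n%:R :> R by exact: nbhs_infty_gtr.
  apply: filterS => n; rewrite ltr_pdivrMr// => /lt_trans; apply.
  by rewrite ltr_pM2r// /m ltr_nat ltnS -addn2 leq_addr.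
pose D n x := m n * derive1 (step 1 2) (m n * x).
have dchi n x : is_derive x 1 (chi n)
    (D n x * cut (m n) (1 - x) - cut (m n) x * D n (1 - x)).
  have H : is_derive x 1 (fun x => cut (m n) (1 - x)) (- D n (1 - x)).
    have := @isd_affine R (cut (m n)) x (D n (- 1 * x + 1)) (-1) 1 (cut_derive _ _).
    rewrite !mulN1r (addrC _ 1); under eq_fun do rewrite mulN1r addrC; exact.
  by apply: is_derive_eq (isd_mul (cut_derive _ _) H) _; rewrite mulrN.
have dphi n : derive1 (phi n) = fun x => derive1 f x * chi n x + f x * derive1 (chi n) x.
  by apply: derive1_of => x; apply: isd_mul; exact: smooth_is_derive.
have D0 n x : 2 < m n * x -> D n x = 0.
  by move=> mx; rewrite /D (derive1_step_out lt12) ?mulr0//; right.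
have nearchi x : I01 x -> \forall n \near \oo, chi n x = 1 /\ derive1 (chi n) x = 0.
  rewrite /I01/= in_itv/= => /andP[x0 x1].
  have x1' : 0 < 1 - x by rewrite subr_gt0.
  apply: filterS2 (near_big x x0) (near_big _ x1') => n mx mx1; split.
    by rewrite /chi !cut_right ?mulr1 ?ltW.
  by rewrite (derive1_of (dchi n)) (D0 n x mx) (D0 n _ mx1) mul0r mulr0 subrr.
have chi1 n x : `|chi n x| <= 1.
  by rewrite normrM mulr_ile1// cut_norm.
apply: (H10_intro (phi := phi) hf); split.
- move=> n; split; first exact/smoothP.
  exists (m n)^-1, (1 - (m n)^-1).
  rewrite invr_gt0 m0 ltrBlDr ltrDl invr_gt0 m0; split=> // x.
  apply: contraNT; rewrite negb_and -!ltNge => /orP[mx|mx].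
    rewrite /phi /chi cut_left ?mul0r ?mulr0// mulrC -ler_pdivlMr// mul1r.
    exact: ltW.
  rewrite /phi /chi [X in _ * (_ * X)]cut_left ?mulr0// mulrC -ler_pdivlMr// mul1r.
  by rewrite lerBlDl -lerBlDr ltW.
- have [K HK] := bounded_smooth sf.
  apply: (@cvgL2_dc _ _ (2 * K)) => //; try exact: L2_smooth.
  + by move=> n; exact: L2_smooth.
  + move=> n x Ix; have fk := HK x Ix.
    have K0 := le_trans (normr_ge0 _) fk.
    rewrite (le_trans (ler_normB _ _))// mulr_natl mulr2n lerD//.
    by rewrite normrM -[leRHS]mulr1 ler_pM.
  + by move=> x /nearchi; apply: filterS => n [c1 _]; rewrite /phi c1 mulr1.
- have f2' := L2_smooth sf'.
  suff c : cvgL2 (fun n => derive1 (phi n)) (derive1 f).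
    suff E n : norm2 (fun x => derive1 (phi n) x - dx f x) =
        norm2 (fun x => derive1 (phi n) x - derive1 f x).
      by rewrite /cvgL2 (eq_fun E).
    have p2 := L2_smooth (smooth_derive (sphi n)).
    apply: norm2_ae; [by apply: L2B => //; exact: H1_dx_L2|exact: L2B|].
    by apply: filterS df => x H Ix; rewrite H.
  have [K HK] := bounded_smooth sf'.
  have [C C0 HC] := lipschitz_smooth sf.
  have [B B0 HB] := cut_derive_bound.
  apply: (@cvgL2_dc _ _ (2 * K + 2 * (C * B))) => //.
  + by move=> n; exact/L2_smooth/smooth_derive.
  + move=> n x Ix; have fk := HK x Ix.
    move: Ix; rewrite /I01/= in_itv/= => /andP[x0 x1].
    have K0 := le_trans (normr_ge0 _) fk.
    have fx0 : `|f x| <= C * x.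
      by have := HC 0 x (lexx _) (ltW x0) (ltW x1); rewrite f0 !subr0.
    have fx1 : `|f x| <= C * (1 - x).
      by have := HC x 1 (ltW x0) (ltW x1) (lexx _); rewrite f1 sub0r normrN.
    rewrite dphi addrAC; apply: le_trans (ler_normD _ _) _; apply: lerD.
      rewrite (le_trans (ler_normB _ _))// mulr_natl mulr2n lerD//.
      by rewrite normrM -[leRHS]mulr1 ler_pM.
    rewrite (derive1_of (dchi n)) mulrBr.
    rewrite (le_trans (ler_normB _ _))// mulr_natl mulr2n lerD//.
      rewrite mulrA normrM -[leRHS]mulr1 ler_pM ?cut_norm//.
      rewrite normrM; apply: (@le_trans _ _ (C * x * `|D n x|)).
        by rewrite ler_wpM2r.
      rewrite -mulrA ler_wpM2l// -{1}(gtr0_norm x0) -normrM.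
      exact: HB (ltW x0).
    rewrite mulrCA normrM -[leRHS]mul1r ler_pM ?cut_norm//.
    rewrite normrM; apply: (@le_trans _ _ (C * (1 - x) * `|D n (1 - x)|)).
      by rewrite ler_wpM2r.
    have x1' : 0 < 1 - x by rewrite subr_gt0.
    rewrite -mulrA ler_wpM2l// -{1}(gtr0_norm x1') -normrM.
    exact: HB (ltW x1').
  + move=> x /nearchi; apply: filterS => n [c1 c2].
    by rewrite dphi c1 c2 mulr1 mulr0 addr0.
Qed.

End cutoff.

(** * Dirichlet eigensystems *)

Section eigen.
Context {R : realType}.
Implicit Types (f g z : R -> R) (x a b c : R) (i j k n : nat).

Lemma H10_sine k : H10 (@sine R k).
Proof. by apply: H10_smooth; [exact: smooth_sine|exact: sine0|exact: sine1]. Qed.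

Lemma dx_sine k :
  {ae leb, forall x, I01 x -> dx (@sine R k) x = derive1 (sine k) x}.
Proof. by have [] := H1_smooth (@smooth_sine R k). Qed.

(** dx (sine k) is only almost everywhere the classical derivative, so its
    weak derivative is transferred from the latter. *)
Lemma ddx_sine k : H1 (dx (@sine R k)) /\
  {ae leb, forall x, I01 x -> dx (dx (@sine R k)) x = - (eig k * sine k x)}.
Proof.
have ss := smooth_derive (@smooth_sine R k).
have [h1 d1] := H1_smooth ss; rewrite derive2_sine in d1.
have s2 := H10_dx_L2 (H10_sine k).
have e2 : L2 (fun x => - (eig k * @sine R k x)) by apply/L2N/L2Z/L2_sine.
apply: H1_intro => //.
have [d2 wd] := H1_dx h1.
apply: (weak_deriv_ae _ _ _ _ _ _ wd) => //; first exact: L2_dsine.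
by apply: filterS (dx_sine k) => x H Ix; rewrite H.
Qed.

Lemma sine_eigenfunction k : (0 < k)%N -> dirichlet_eigenfunction (eig k) (@sine R k).
Proof.
move=> k0; split.
- exact: H10_sine.
- by split; [exact: H10_H1 (H10_sine k)|have [] := ddx_sine k].
- apply/eqP => H; have := norm2_sq (@sine R k).
  by rewrite H sine_orthonormal// eqxx expr0n/= => /esym/eqP; rewrite oner_eq0.
- have [_] := ddx_sine k; apply: filterS => x H; rewrite inE => Ix.
  by rewrite H// opprK.
Qed.

Lemma spectral_gap_sine n z : H10 z ->
  eig n.+1 * (inner z z - \sum_(i < n) inner z (@sine R i.+1) ^+ 2) <=
  inner (dx z) (dx z).
Proof.
move=> hz; have [phi [tp p1 p2]] := H10_elim hz.
have z2 := H10_L2 hz; have dz2 := H10_dx_L2 hz.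
have P2 m := test_L2 (tp m); have D2 m := test_dL2 (tp m).
have c1 : inner (derive1 (phi m)) (derive1 (phi m)) @[m --> \oo] -->
    inner (dx z) (dx z) by exact: cvg_inner.
have c2 : eig n.+1 * (inner (phi m) (phi m) -
     \sum_(i < n) inner (phi m) (@sine R i.+1) ^+ 2) @[m --> \oo] -->
  eig n.+1 * (inner z z - \sum_(i < n) inner z (@sine R i.+1) ^+ 2).
  apply: cvgMr; apply: cvgB; first exact: cvg_inner.
  elim: (index_enum _) => [|i r ih].
    by under eq_fun do rewrite big_nil; rewrite big_nil; exact: cvg_cst.
  under eq_fun do rewrite big_cons; rewrite big_cons; apply: cvgD => //.
  have ci : inner (phi m) (@sine R i.+1) @[m --> \oo] --> inner z (@sine R i.+1).
    apply: (cvg_inner (w := fun=> @sine R i.+1)) => //.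
    - by move=> _; exact: L2_sine.
    - exact: L2_sine.
    - exact: cvgL2_cst.
  by under eq_fun do rewrite expr2; rewrite expr2; exact: cvgM.
apply: ler_cvg_to c2 c1 _; apply: nearW => m.
apply: spectral_gap_smooth; first exact: test_fun_smooth (tp m).
  by apply: test_fun_out (tp m) _; left.
by apply: test_fun_out (tp m) _; right.
Qed.

Lemma eig_unbounded (a b : R) : 0 <= a ->
  (forall n, eig n.+1 * a <= b) -> a = 0.
Proof.
move=> a0 H; apply/eqP; rewrite eq_le a0 andbT leNgt; apply/negP => ap.
have b0 : 0 <= b by apply: le_trans (H 0%N); rewrite mulr_ge0 ?eig_ge0.
pose n := Num.truncn (b / a).
have := H n; rewrite -ler_pdivlMr// leNgt => /negP; apply.
have bn : b / a < n.+1%:R by exact: truncnS_gt.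
apply: lt_le_trans bn _; rewrite /eig /freq exprMn.
have n1 : 1 <= n.+1%:R :> R by rewrite ler1n.
have p1 : 1 <= pi :> R by rewrite (le_trans _ (pi_ge2 _))// ler1n.
have n2 : n.+1%:R <= n.+1%:R ^+ 2 :> R by rewrite expr2 ler_peMr// ler0n.
apply: le_trans n2 _; rewrite ler_peMr ?sqr_ge0//.
by rewrite exprn_ege1.
Qed.

(** spectral_gap_sine bounds eig n.+1 ||z||^2 independently of n. *)
Lemma orth_sines z : H10 z ->
  (forall k, (0 < k)%N -> inner z (@sine R k) = 0) -> norm2 z = 0.
Proof.
move=> hz H.
have : inner z z = 0.
  apply: (@eig_unbounded _ (inner (dx z) (dx z))); first exact: inner_ge0.
  move=> n; have := spectral_gap_sine n hz.
  by rewrite big1 ?subr0// => i _; rewrite H// expr0n.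
by rewrite norm2_sqrt => ->; rewrite sqrtr0.
Qed.

(** The second derivative is symmetric: integrate by parts from phi to sine k
    and back. *)
Lemma eigen_sine_inner a phi k : dirichlet_eigenfunction a phi ->
  (a - eig k) * inner phi (@sine R k) = 0.
Proof.
move=> [hp [hp1 hp2] _ ap].
have p2 := H10_L2 hp; have dp2 := H1_dx_L2 hp2; have s2 := @L2_sine R k.
have hs := H10_sine k; have [hds ds] := ddx_sine k.
have dds2 := H1_dx_L2 hds.
have e1 := H1_IBP hp2 hs; have e2 := H1_IBP hds hp.
have E1 : inner (dx (dx phi)) (sine k) = - (a * inner phi (sine k)).
  rewrite -mulNr -innerZl//; apply: inner_aeS => //; first exact: L2Z.
  by apply: filterS ap => x H Ix; rewrite mulNr -H ?opprK// inE.
have E2 : inner (dx (dx (@sine R k))) phi = - (eig k * inner (sine k) phi).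
  rewrite -mulNr -innerZl//; apply: inner_aeS => //; first exact: L2Z.
  by apply: filterS ds => x H Ix; rewrite mulNr -H.
have F1 := etrans e1 (congr1 -%R E1); have F2 := etrans e2 (congr1 -%R E2).
have F := etrans (esym F1) (etrans (innerC _ _) F2).
move: F; rewrite !opprK (innerC (sine k) phi) => F.
by rewrite mulrBl F subrr.
Qed.

(** By orth_sines, phi has a nonzero coefficient on some sine k, so that a =
    eig k by eigen_sine_inner. The other coefficients vanish, and orth_sines
    applies to the difference of phi and its component on sine k. *)
Lemma eigen_classification a phi : dirichlet_eigenfunction a phi ->
  exists2 k, (0 < k)%N & a = eig k /\
  {ae leb, forall x, I01 x -> phi x = inner phi (@sine R k) * sine k x}.
Proof.
move=> ep; have [hp _ p0 _] := ep; have p2 := H10_L2 hp.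
have [k [k0 ck]] : exists k, (0 < k)%N /\ inner phi (@sine R k) != 0.
  apply: contrapT => H; move/eqP: p0; apply; apply: orth_sines => // k k0.
  by apply/eqP; apply: contrapT => /negP ck; apply: H; exists k.
exists k => //; have ak : a = eig k.
  have /eqP := eigen_sine_inner k ep.
  by rewrite mulf_eq0 (negPf ck) orbF subr_eq0 => /eqP.
split=> //; set c := inner phi (sine k).
have hcs : H10 (fun x => c * @sine R k x).
  apply: H10_smooth; first by apply: smoothZ; exact: smooth_sine.
    by rewrite sine0 mulr0.
  by rewrite sine1 mulr0.
have hq := H10B hp hcs; have s2 := @L2_sine R k.
have q2 := H10_L2 hq.
have : norm2 (fun x => phi x - c * sine k x) = 0.
  apply: orth_sines => // j j0; rewrite innerBl//; [|exact: L2Z|exact: L2_sine].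
  rewrite innerZl//; last exact: L2_sine.
  rewrite sine_orthonormal//; have [<-|jk] := eqVneq k j; first by rewrite mulr1 subrr.
  rewrite mulr0 subr0; have /eqP := eigen_sine_inner j ep.
  rewrite mulf_eq0 => /orP[|/eqP//]; rewrite ak subr_eq0 => /eqP/eig_inj kj.
  by rewrite kj eqxx in jk.
move=> /(norm2_eq0_ae q2); apply: filterS => x H Ix.
by apply/eqP; rewrite -subr_eq0 H.
Qed.

(** Every lam k is some eig j by eigen_classification, and every eig k is some
    lam i because the sines are eigenfunctions; two increasing enumerations of
    the same set coincide. *)
Lemma eigensystem_classification w lam : dirichlet_eigensystem w lam ->
  forall k, (0 < k)%N -> lam k = eig k :> R /\
  {ae leb, forall x, I01 x -> w k x = inner (w k) (sine k) * sine k x}.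
Proof.
move=> [we _ lmon lex] k k0.
suff lk : lam k = eig k.
  split=> //; have [j j0 []] := eigen_classification (we k k0).
  by rewrite lk => /eig_inj <-.
elim/ltn_ind: k k0 => k ih k0.
have [j j0 [lj _]] := eigen_classification (we k k0).
have [i i0 ei] := lex _ _ (sine_eigenfunction k0).
have ik : (k <= i)%N.
  rewrite leqNgt; apply/negP => ik; move: ei; rewrite ih// => /eig_inj ki.
  by rewrite ki ltnn in ik.
have jk : (j <= k)%N.
  have : lam k <= lam i by move: ik; rewrite leq_eqVlt => /predU1P[->//|/lmon]; move=> /(_ k0)/ltW.
  by rewrite lj -ei => H; rewrite leqNgt -(@eig_lt R) -leNgt.
rewrite lj; congr eig; apply/eqP; rewrite eqn_leq jk/= leqNgt; apply/negP => jk'.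
by have := lmon _ _ j0 jk'; rewrite (ih j jk' j0) lj ltxx.
Qed.

(** Each w k is sine k up to a sign, so the two projections have the same
    norm. *)
Lemma eigensystem_gap w lam n z : dirichlet_eigensystem w lam -> H10 z ->
  lam n.+1 * (inner z z - \sum_(1 <= k < n.+1) inner z (w k) ^+ 2) <=
  inner (dx z) (dx z).
Proof.
move=> wl hz; have W := eigensystem_classification wl.
have [-> _] := W n.+1 isT.
have -> : \sum_(1 <= k < n.+1) inner z (w k) ^+ 2 = \sum_(i < n) inner z (@sine R i.+1) ^+ 2.
  rewrite big_add1 /= big_mkord; apply: eq_bigr => i _.
  have [wew orth _ _] := wl.
  have [hw _ _ _] := wew i.+1 isT.
  have w2 := H10_L2 hw; have z2 := H10_L2 hz; have s2 := @L2_sine R i.+1.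
  have [_ wi] := W i.+1 isT; set c := inner (w i.+1) _ in wi.
  have cs2 := L2Z c s2.
  have cc : c * c = 1.
    have o1 : inner (w i.+1) (w i.+1) = 1 by rewrite orth// eqxx.
    by rewrite -o1 (inner_aeS w2 cs2 w2 wi) innerZl// innerC.
  rewrite innerC (inner_aeS w2 cs2 z2 wi) innerZl// exprMn [c ^+ 2]expr2 cc mul1r.
  by rewrite innerC.
exact: spectral_gap_sine.
Qed.

Lemma eigensystem_gt0 (w : nat -> R -> R) lam k : dirichlet_eigensystem w lam ->
  (0 < k)%N -> 0 < lam k.
Proof.
move=> wl k0; have [-> _] := eigensystem_classification wl k0.
exact: eig_gt0.
Qed.

End eigen.

(** * Energy inequality and Gronwall lemma *)

Section local_global.
Context {R : realType}.

(** The supremum of the points reached from s would be passed by the local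
    hypothesis at that supremum, were it less than t. *)
Lemma local_to_global (P : R -> R -> Prop) (s t : R) : s <= t ->
  (forall a b c, P a b -> P b c -> P a c) ->
  (forall r, s <= r <= t -> exists2 d, 0 < d & forall a b, s <= a -> a <= b ->
     b <= t -> `|a - r| < d -> `|b - r| < d -> P a b) ->
  P s t.
Proof.
move=> st tr loc.
pose A := [set x | s <= x <= t /\ P s x].
have As : A s.
  split; first by rewrite lexx.
  have [|d d0] := loc s; first by rewrite lexx.
  by apply; rewrite ?lexx ?subrr ?normr0.
have ubA : has_sup A by split; [exists s|exists t => x [/andP[]]].
pose y := sup A.
have sy : s <= y by apply: (@ub_le_sup _ A) => //; exact: ubA.2.
have yt : y <= t by apply: (@ge_sup _ A) => //; [exists s|move=> x [/andP[]]].
have [|d d0 H] := loc y; first by rewrite sy yt.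
have [x Ax xy] := sup_adherent d0 ubA.
have xley : x <= y by apply: (@ub_le_sup _ A) => //; exact: ubA.2.
have [/andP[sx xt] Psx] := Ax.
pose z := Num.min (y + d / 2) t.
have yz : y <= z by rewrite le_min yt andbT lerDl divr_ge0// ltW.
have zd : z < y + d by rewrite gt_min ltrD2l ltr_pdivrMr// ltr_pMr// ltr1n.
have Psz : P s z.
  apply: tr Psx _; apply: H => //.
  - exact: le_trans yz.
  - by rewrite ge_min lexx orbT.
  - by rewrite distrC ger0_norm ?subr_ge0// ltrBlDl -ltrBlDr.
  - by rewrite ger0_norm ?subr_ge0// ltrBlDl.
have zt : z <= t by rewrite ge_min lexx orbT.
have Az : A z by split=> //; rewrite zt (le_trans sy yz).
have zy : z <= y by apply: (@ub_le_sup _ A) => //; exact: ubA.2.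
suff tz : z = t by rewrite -tz.
move: zy; rewrite /z ge_min => /orP[|ty].
  by rewrite gerDl leNgt divr_gt0.
by apply/min_idPr; rewrite (le_trans ty)// lerDl divr_ge0// ltW.
Qed.

End local_global.

Section time.
Context {R : realType}.
Implicit Types (z zt v w : R -> R -> R) (T s t : R) (phi psi : R -> R).

(** The integrated form of weak_dt. The function g is needed because the
    pairing of zt with phi is only almost everywhere equal to a measurable
    function of time. *)
Definition weak_time_deriv T z zt := forall phi, L2 phi ->
  exists g, [/\ intble `]0, T[ g,
    {ae leb, forall t, 0 < t < T -> g t = inner (zt t) phi} &
    forall s t, 0 < s -> s <= t -> t < T ->
      inner (z t) phi - inner (z s) phi = \int[leb]_(x in `]s, t[) g x].

Definition L2_continuous z := forall t, 0 < t ->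
  L2 (z t) /\ norm2 (fun x => z s x - z t x) @[s --> t] --> (0 : R).

(** Pairings of simple functions with phi are measurable, and converge almost
    everywhere in time. *)
Lemma Bochner_pairing T w phi : Bochner 2%:E L2 norm2 T w -> L2 phi ->
  exists g, measurable_fun (`]0, T[ : set (measurableTypeR R)) g /\
    {ae leb, forall t, 0 < t < T -> g t = inner (w t) phi}.
Proof.
move=> [aeL2 [sn simple cvs] _] p2.
pose G n t := inner (sn n t) phi.
have mG n : measurable_fun setT (G n).
  have [m [A [c [mA c2 snE]]]] := simple n.
  have -> : G n = fun t => \sum_(i < m) \1_(A i) t * inner (c i) phi.
    apply/funext => t; rewrite /G.
    have -> : sn n t = fun x => \sum_(i < m) \1_(A i) t * c i x.
      by apply/funext => x; exact: snE.
    rewrite inner_suml//; last by move=> i; exact: L2Z.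
    by apply: eq_bigr => i _; rewrite innerZl.
  apply: measurable_sum => i; apply: measurable_funM => //.
have cG : {ae leb, forall t, 0 < t < T -> G n t @[n --> \oo] --> inner (w t) phi}.
  apply: filterS2 aeL2 cvs => t + + tT.
  move=> /(_ tT) w2 /(_ tT) cw.
  have s2 n : L2 (sn n t).
    have [m [A [c [mA c2 snE]]]] := simple n.
    have -> : sn n t = fun x => \sum_(i < m) \1_(A i) t * c i x.
      by apply/funext => x; exact: snE.
    by apply: L2_sum => i; exact: L2Z.
  by apply: (cvg_inner (w := fun=> phi)) => //; exact: cvgL2_cst.
have [N [mN N0 NS]] := cG.
pose D : set (measurableTypeR R) := [set` `]0, T[].
have mD : measurable D by exact: measurable_itv.
exists ((fun t => inner (w t) phi) \_ (~` N)); split; last first.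
  exists N; split => // t /= H; apply: contrapT => Nt; apply: H => _.
  by rewrite patchE mem_set.
apply: (@measurable_fun_cvg _ _ _ D (fun n => (G n) \_ (~` N))).
  move=> n; apply: measurable_funTS.
  by apply: (iffLR (measurable_restrictT (G n) (measurableC mN))); exact: measurable_funTS.
move=> t Dt; rewrite /=.
have [tN|tN] := boolP (t \in ~` N); last first.
  by under eq_fun do rewrite patchE (negPf tN); rewrite patchE (negPf tN); exact: cvg_cst.
under eq_fun do rewrite patchE tN; rewrite patchE tN.
apply: contrapT => H; move: tN; rewrite inE; apply; apply: NS => /= H'; apply: H.
by apply: H'; move: Dt; rewrite /D/= in_itv.
Qed.

(** On a bounded time interval, square integrability implies integrability. *)
Lemma Bochner_norm T w : Bochner 2%:E L2 norm2 T w ->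
  exists h, intble `]0, T[ h /\ {ae leb, forall t, 0 < t < T -> L2 (w t) /\ norm2 (w t) = h t}.
Proof.
move=> [aeL2 _ [h hL hae]]; exists h; split; last first.
  by apply: filterS2 aeL2 hae => t H1 H2 tT; split; [exact: H1|rewrite H2].
have [mh h2] := (Lfun2P h (measurable_itv _)).1 hL.
apply: (@le_intble _ _ _ (fun t => 1 + h t * h t)) => //.
  by apply: intbleD => //; exact: intble_cst.
move=> t _; rewrite -expr2 -[h t ^+ 2]real_normK ?num_real//.
have := normr_ge0 (h t); move: `|h t| => a a0.
by have := sqr_ge0 (a - 1); lra.
Qed.

(** This is weak_FTC for the continuous function (v t, phi). *)
Lemma weak_dt_time_deriv T v w : L2_continuous v ->
  Bochner 2%:E L2 norm2 T w -> weak_dt T v w -> weak_time_deriv T v w.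
Proof.
move=> cv bw dw phi p2.
have [g [mg gE]] := Bochner_pairing bw p2.
have [h [hi hE]] := Bochner_norm bw.
exists g; have gi : intble `]0, T[ g.
  apply: (@intble_ae _ _ _ (fun t => norm2 phi * h t)) => //; first exact: intbleZ.
  apply: filterS2 gE hE => t gt ht; rewrite /= in_itv/= => tT.
  rewrite (gt tT); have [w2 <-] := ht tT.
  by rewrite mulrC; exact: cauchy_schwarz.
split=> // s t s0 st tT.
apply: (@weak_FTC R T (fun t => inner (v t) phi)) => //.
- move=> r /andP[r0 rT]; have [r2 cr] := cv r r0.
  apply/cvgrPdist_le => e e0; rewrite near_simpl.
  have c' : norm2 (fun x => v s x - v r x) * norm2 phi @[s --> r] --> (0 : R).
    by rewrite -(mul0r (norm2 phi)); exact: cvgMl.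
  have rpos : \forall s \near r, 0 < s by exact: lt_nbhsr.
  move/cvgrPdist_le : c' => /(_ e e0); apply: filterS2 rpos => q q0.
  rewrite sub0r normrN ger0_norm ?mulr_ge0 ?norm2_ge0//; apply: le_trans.
  have [q2 _] := cv q q0.
  rewrite distrC -innerBl//; apply: cauchy_schwarz => //; exact: L2B.
- move=> psi tpsi; rewrite dw//; congr (- _); apply: Rintegral_ae_any.
  by apply: filterS gE => r H /=; rewrite in_itv/= => /H ->.
Qed.

Lemma weak_time_derivB T v1 w1 v2 w2 : L2_continuous v1 -> L2_continuous v2 ->
  {ae leb, forall t, 0 < t < T -> L2 (w1 t)} ->
  {ae leb, forall t, 0 < t < T -> L2 (w2 t)} ->
  weak_time_deriv T v1 w1 -> weak_time_deriv T v2 w2 ->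
  weak_time_deriv T (fun t x => v1 t x - v2 t x) (fun t x => w1 t x - w2 t x).
Proof.
move=> c1 c2 l1 l2 d1 d2 phi p2.
have [g1 [i1 e1 f1]] := d1 phi p2; have [g2 [i2 e2 f2]] := d2 phi p2.
exists (fun t => g1 t - g2 t); split; first exact: intbleB.
  apply: filterS2 (filterI l1 l2) (filterI e1 e2) => t [L1 L2'] [E1 E2] tT.
  by rewrite innerBl ?E1 ?E2//; [exact: L1|exact: L2'].
move=> s t s0 st tT; have t0 := lt_le_trans s0 st.
have [a1 _] := c1 t t0; have [a2 _] := c1 s s0.
have [b1 _] := c2 t t0; have [b2 _] := c2 s s0.
have sub : `]s, t[ `<=` `]0, T[.
  move=> x /=; rewrite !in_itv/= => /andP[sx xt].
  by rewrite (lt_trans s0 sx) (lt_trans xt tT).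
rewrite RintegralB//; [|exact: intble_sub i1|exact: intble_sub i2].
by rewrite -f1// -f2// !innerBl//; ring.
Qed.

Lemma L2_continuousB v1 v2 : L2_continuous v1 -> L2_continuous v2 ->
  L2_continuous (fun t x => v1 t x - v2 t x).
Proof.
move=> c1 c2 t t0; have [a1 a2] := c1 t t0; have [b1 b2] := c2 t t0.
split; first exact: L2B.
have H : norm2 (fun x => v1 s x - v1 t x) + norm2 (fun x => v2 s x - v2 t x)
    @[s --> t] --> (0 : R) by rewrite -[X in _ --> X](addr0 0); exact: cvgD.
apply: (squeeze_cvgr _ (cvg_cst 0) H); near=> s.
have s0 : 0 < s by near: s; exact: lt_nbhsr.
have [a3 _] := c1 s s0; have [b3 _] := c2 s s0.
rewrite norm2_ge0/=; apply: le_trans (norm2B _ _); [|exact: L2B..].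
rewrite le_eqVlt; apply/orP; left; apply/eqP; congr norm2.
by apply/funext => x; ring.
Unshelve. all: by end_near. Qed.

Lemma L2_continuous_norm z : L2_continuous z ->
  forall t, 0 < t -> {for t, continuous (fun t => inner (z t) (z t))}.
Proof.
move=> cz t t0; have [z2 c] := cz t t0.
have cn : {for t, continuous (fun t => norm2 (z t))}.
  apply/cvgrPdist_le => e e0; rewrite near_simpl.
  have rpos : \forall s \near t, 0 < s by exact: lt_nbhsr.
  move/cvgrPdist_le : c => /(_ e e0); apply: filterS2 rpos => q q0.
  rewrite sub0r normrN ger0_norm ?norm2_ge0//; apply: le_trans.
  have [q2 _] := cz q q0.
  have H1 : norm2 (z q) <= norm2 (fun x => z q x - z t x) + norm2 (z t).
    have {1}-> : z q = fun x => (z q x - z t x) + z t x.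
      by apply/funext => x; rewrite subrK.
    by apply: norm2D => //; exact: L2B.
  have H2 : norm2 (z t) <= norm2 (fun x => z q x - z t x) + norm2 (z q).
    rewrite norm2BC; have {1}-> : z t = fun x => (z t x - z q x) + z q x.
      by apply/funext => x; rewrite subrK.
    by apply: norm2D => //; exact: L2B.
  by rewrite ler_norml; apply/andP; split; lra.
have -> : (fun t => inner (z t) (z t)) = fun t => norm2 (z t) * norm2 (z t).
  by apply/funext => r; rewrite -norm2_sq expr2.
exact: cvgM.
Qed.

(** Formally, the derivative of ||z||^2 is 2 (zt, z). On a short interval [a,
    b], the difference of ||z b||^2 and ||z a||^2 is the increment of the
    pairing with the fixed vector z b + z a, which is within e of 2 z r for
    all r in [a, b], by continuity. Hence it is at most the integral of G + e
    h. local_to_global adds up the short intervals, and e tends to 0. Only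
    pairings with vectors independent of time are integrated. *)
Lemma energy_le T z zt h (G : R -> R) s t : L2_continuous z ->
  weak_time_deriv T z zt -> intble `]0, T[ h ->
  {ae leb, forall r, 0 < r < T -> L2 (zt r) /\ norm2 (zt r) <= h r} ->
  0 < s -> s <= t -> t < T ->
  (forall r, s <= r <= t -> {for r, continuous G}) ->
  {ae leb, forall r, s < r < t -> 2 * inner (zt r) (z r) <= G r} ->
  inner (z t) (z t) - inner (z s) (z s) <= \int[leb]_(r in `]s, t[) G r.
Proof.
move=> cz dz hi hE s0 st tT cG GE.
have iG := intble_cont cG.
have sub a b : s <= a -> b <= t -> `]a, b[ `<=` `]s, t[.
  move=> sa bt x /=; rewrite !in_itv/= => /andP[ax xb].
  by rewrite (le_lt_trans sa ax) (lt_le_trans xb bt).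
have hst : intble `]s, t[ h.
  apply: intble_sub hi => // x /=; rewrite !in_itv/= => /andP[sx xt].
  by rewrite (lt_trans s0 sx) (lt_trans xt tT).
suff H e : 0 < e -> inner (z t) (z t) - inner (z s) (z s) <=
    \int[leb]_(r in `]s, t[) (G r + e * h r).
  apply/ler_addgt0Pl => e e0.
  have K0 : 0 < `|\int[leb]_(r in `]s, t[) h r| + 1 by rewrite ltr_wpDl.
  (* The term 1 covers the case where the integral of h vanishes. *)
  pose e' := e / (`|\int[leb]_(r in `]s, t[) h r| + 1).
  have e'0 : 0 < e' by rewrite divr_gt0.
  apply: le_trans (H e' e'0) _; rewrite RintegralD//; last exact: intbleZ.
  rewrite addrC lerD2r RintegralZl//.
  apply: le_trans (ler_norm _) _; rewrite normrM gtr0_norm//.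
  by rewrite /e' mulrAC ler_pdivrMr// ler_pM2l// lerDl.
move=> e0.
pose Q a b := [/\ a <= b, s <= a, b <= t &
  inner (z b) (z b) - inner (z a) (z a) <= \int[leb]_(r in `]a, b[) (G r + e * h r)].
have iGh a b : s <= a -> b <= t -> intble `]a, b[ (fun r => G r + e * h r).
  move=> sa bt; apply: (@intble_sub _ `]s, t[) => //; first exact: sub.
  by apply: intbleD => //; exact: intbleZ.
suff [] : Q s t by [].
apply: local_to_global => //.
  move=> a b c [ab sa bt H1] [bc sb ct H2]; split=> //; first exact: le_trans bc.
  rewrite (Rint_split ab bc); last exact: iGh.
  by have := lerD H1 H2; lra.
move=> r /andP[sr rt]; have r0 := lt_le_trans s0 sr.
have [r2 cr] := cz r r0.
(* Four distances of size e / 4: from z a and z b to z r, and twice from z r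
   to the running value z q. *)
have e4 : 0 < e / 4 by rewrite divr_gt0.
move/cvgrPdist_lt : cr => /(_ _ e4) [d /= d0 Hd].
exists d => // a b sa ab bt ad bd; split=> //.
have a0 := lt_le_trans s0 sa; have b0 := lt_le_trans a0 ab.
have [a2 _] := cz a a0; have [b2 _] := cz b b0.
have near c : `|c - r| < d -> norm2 (fun x => z c x - z r x) <= e / 4.
  move=> cd; have := Hd c; rewrite /= distrC => /(_ cd).
  by rewrite sub0r normrN ger0_norm ?norm2_ge0// => /ltW.
have na := near a ad; have nb := near b bd.
have s2 := L2D b2 a2.
have [g [gi gE gF]] := dz _ s2.
have -> : inner (z b) (z b) - inner (z a) (z a) =
    inner (z b) (fun x => z b x + z a x) - inner (z a) (fun x => z b x + z a x).
  by rewrite !innerDr// (innerC (z b) (z a)); ring.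
rewrite gF//; last exact: le_lt_trans tT.
apply: le_Rintegral_ae; [exact: measurable_itv| |exact: iGh|].
  apply: intble_sub gi => // x /=; rewrite !in_itv/= => /andP[ax xb].
  by rewrite (lt_trans a0 ax) (lt_trans xb (le_lt_trans bt tT)).
apply: filterS2 (filterI gE hE) GE => q [gq hq] Gq; rewrite /= in_itv/= => /andP[aq qb].
have sqt : s < q < t by rewrite (le_lt_trans sa aq) (lt_le_trans qb bt).
have qT : 0 < q < T.
  by case/andP: sqt => sq qt; rewrite (lt_trans s0 sq) (lt_trans qt tT).
have [zq2 hqE] := hq qT; rewrite (gq qT).
have [q2 _] := cz q (proj1 (andP qT)).
have qd : `|q - r| < d.
  move: ad bd; rewrite !ltr_norml => /andP[ad1 ad2] /andP[bd1 bd2].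
  by apply/andP; split; lra.
have nq := near q qd.
have tri c : L2 (z c) -> norm2 (fun x => z c x - z r x) <= e / 4 ->
    norm2 (fun x => z c x - z q x) <= e / 2.
  move=> c2 nc.
  have -> : norm2 (fun x => z c x - z q x) =
      norm2 (fun x => (z c x - z r x) - (z q x - z r x)).
    by congr norm2; apply/funext => x; ring.
  apply: le_trans (norm2B _ _) _; [exact: L2B..|].
  by have := lerD nc nq; lra.
have ta := tri a a2 na; have tb := tri b b2 nb.
have -> : inner (zt q) (fun x => z b x + z a x) = 2 * inner (zt q) (z q) +
   inner (zt q) (fun x => (z b x - z q x) + (z a x - z q x)).
  rewrite -innerZr// -innerDr//; [|exact: L2Z|by apply: L2D; exact: L2B].
  by congr inner; apply/funext => x; ring.
apply: lerD; first exact: Gq.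
apply: le_trans (ler_norm _) _; apply: le_trans (cauchy_schwarz _ _) _ => //.
  by apply: L2D; exact: L2B.
rewrite mulrC; apply: ler_pM; rewrite ?norm2_ge0//.
apply: le_trans (norm2D _ _) _; [exact: L2B..|].
by have := lerD tb ta; lra.
Qed.

(** Let F = E - b / a, let J be a primitive of F and Phi = F + a (J - J s),
    which is nonincreasing by hypothesis. Then the derivative of K r = exp (a
    r) (a (J r - J s) - Phi t) is a exp (a r) (Phi r - Phi t) >= 0, and K s <=
    K t is the claim, because Phi s = F s. *)
Lemma gronwall (E : R -> R) (a b s t : R) : 0 < a -> 0 < s -> s <= t ->
  (forall r, 0 < r -> {for r, continuous E}) ->
  (forall p q, s <= p -> p <= q -> q <= t ->
     E q - E p <= \int[leb]_(r in `]p, q[) (b - a * E r)) ->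
  E t <= (E s - b / a) * expR (- a * (t - s)) + b / a.
Proof.
move=> a0 s0 st cE H.
pose F r := E r - b / a.
have cF r : 0 < r -> {for r, continuous F}.
  by move=> r0; apply: cvgB; [exact: cE|exact: cvg_cst].
pose s1 := s / 2.
have s10 : 0 < s1 by rewrite divr_gt0.
have s1s : s1 < s by rewrite ltr_pdivrMr// ltr_pMr// ltr1n.
have iF : leb.-integrable [set` Interval (BRight s1) (BRight (t + 1))] (EFin \o F).
  apply: (@intble_sub R [set` `[s1, t + 1]]) => //.
    by move=> x /=; rewrite !in_itv/= => /andP[/ltW -> ->].
  apply: continuous_compact_integrable; first exact: segment_compact.
  by apply: within_cc => r /andP[r1 _]; apply: cF; exact: lt_le_trans r1.
pose J y := \int[leb]_(r in [set` Interval (BRight s1) (BRight y)]) F r.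
have dJ r : s <= r <= t -> is_derive r 1 J (F r).
  move=> /andP[sr rt].
  have rt1 : r < t + 1 by rewrite (le_lt_trans rt)// ltrDl.
  have s1r : (BRight s1 < BRight r)%O by rewrite bnd_simp (lt_le_trans s1s).
  have [dJ <-] := continuous_FTC1 rt1 iF s1r (cF r (lt_le_trans s0 sr)).
  exact: derivableE.
have Jint p q : s <= p -> p <= q -> q <= t -> \int[leb]_(r in `]p, q[) F r = J q - J p.
  move=> sp pq qt; apply: (FTC pq (f := F)) => r /andP[pr rq].
    by apply: dJ; rewrite (le_trans sp pr) (le_trans rq qt).
  by apply: cF; rewrite (lt_le_trans s0)// (le_trans sp).
pose Phi r := F r + a * (J r - J s).
have Phi_ni p q : s <= p -> p <= q -> q <= t -> Phi q <= Phi p.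
  move=> sp pq qt; have := H p q sp pq qt.
  have -> : \int[leb]_(r in `]p, q[) (b - a * E r) = - (a * (J q - J p)).
    have iFpq : intble `]p, q[ F.
      apply: intble_cont => r /andP[pr rq]; apply: cF.
      by rewrite (lt_le_trans s0)// (le_trans sp).
    rewrite -Jint// -mulNr -RintegralZl//.
    apply: eq_Rintegral => r _; rewrite /F mulNr mulrBr mulrCA divff ?gt_eqF//.
    by rewrite mulr1 opprB.
  by rewrite /Phi /F; lra.
pose K r := expR (a * r) * (a * (J r - J s) - Phi t).
have dK r : s <= r <= t -> is_derive r 1 K (a * expR (a * r) * (Phi r - Phi t)).
  move=> srt.
  have dE : is_derive r 1 (fun r => expR (a * r)) (a * expR (a * r)).
    have := @isd_affine R expR r (expR (a * r + 0)) a 0 (is_derive_expR _).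
    by rewrite addr0; under eq_fun do rewrite addr0.
  have d1 : is_derive r 1 (fun r => a * (J r - J s) - Phi t) (a * F r).
    apply: is_derive_eq (isd_sub (isd_scale a (isd_sub (dJ r srt) (isd_cst _ _))) (isd_cst _ _)) _.
    by rewrite !subr0.
  by apply: is_derive_eq (isd_mul dE d1) _; rewrite /Phi; ring.
have cK r : s <= r <= t -> {for r, continuous K}.
  move=> srt; apply: differentiable_continuous; apply/derivable1_diffP.
  by have [] := dK r srt.
have Kst : K s <= K t.
  apply: (@ger0_derive1_le_cc _ K s t) => //.
  - by move=> r; rewrite in_itv/= => /andP[sr rt]; have [|] := dK r _; rewrite ?(ltW sr) ?(ltW rt).
  - move=> r; rewrite in_itv/= => /andP[sr rt]; rewrite derive1E.
    have [|_ ->] := dK r _; first by rewrite (ltW sr) (ltW rt).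
    rewrite mulr_ge0 ?mulr_ge0 ?expR_ge0 ?(ltW a0)// subr_ge0.
    by apply: Phi_ni; rewrite ?(ltW sr) ?(ltW rt).
  - exact: within_cc.
  - by rewrite in_itv/= lexx st.
  - by rewrite in_itv/= lexx st.
have Pst := Phi_ni s t (lexx _) st (lexx _).
have Ps : Phi s = F s by rewrite /Phi subrr mulr0 addr0.
have key : F t <= F s * expR (- a * (t - s)).
  have Et : 0 < expR (a * t) by exact: expR_gt0.
  rewrite -(ler_pM2l Et).
  have -> : expR (a * t) * (F s * expR (- a * (t - s))) = expR (a * s) * F s.
    rewrite mulrCA -expRD mulrC; congr (expR _ * _); ring.
  have K1 : expR (a * t) * F t = - K t by rewrite /K /Phi; ring.
  rewrite K1; apply: (@le_trans _ _ (- K s)); first by rewrite lerN2.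
  rewrite /K subrr mulr0 sub0r mulrN opprK; apply: ler_wpM2l; first exact: expR_ge0.
  by rewrite -Ps.
by move: key; rewrite /F; lra.
Qed.
End time.

(** * Dissipation inequalities *)

Section dissipation.
Context {R : realType}.

(** Young's inequality with the exponents 4 and 4/3, for p and q chosen so
    that the powers of nu cancel in p q and p^4 / 4 is the viscous term. *)
Lemma gagliardo_young (nu beta K a b L : R) : 0 < nu -> 0 < beta -> 0 <= K ->
  0 <= a -> 0 <= b -> 0 <= L -> L <= beta * a `^ (3 / 4) * b `^ (1 / 4) ->
  K * L ^+ 2 <= nu / 4 * b ^+ 2 +
    3 / 4 * nu `^ (- (1 / 3)) * beta `^ (8 / 3) * K `^ (4 / 3) * a ^+ 2.
Proof.
move=> nu0 beta0 K0 a0 b0 L0 HL.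
pose p := nu `^ (1 / 4) * b `^ (1 / 2).
pose q := nu `^ (- (1 / 4)) * (K * (beta ^+ 2 * a `^ (3 / 2))).
have p0 : 0 <= p by rewrite /p mulr_ge0 ?powR_ge0.
have q0 : 0 <= q.
  rewrite /q; apply: mulr_ge0; first exact: powR_ge0.
  by apply: mulr_ge0 => //; apply: mulr_ge0; rewrite ?sqr_ge0 ?powR_ge0.
have sq (x y : R) : 0 <= x -> (x `^ y) ^+ 2 = x `^ (y * 2).
  by move=> x0; rewrite powRrM powR_mulrn// powR_ge0.
have pq : K * L ^+ 2 <= p * q.
  have -> : p * q = K * (beta * a `^ (3 / 4) * b `^ (1 / 4)) ^+ 2.
    rewrite /p /q !exprMn !sq//.
    have -> : 3 / 4 * 2 = 3 / 2 :> R by field.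
    have -> : 1 / 4 * 2 = 1 / 2 :> R by field.
    have nn : nu `^ (1 / 4) * nu `^ (- (1 / 4)) = 1.
      have c : (1 / 4 + - (1 / 4) == 0 :> R) ==> (nu != 0) by apply/implyP => _; rewrite gt_eqF.
      by rewrite -(powRD c) subrr powRr0.
    rewrite mulrACA nn mul1r; ring.
  by rewrite ler_wpM2l// ler_sqr// ?nnegrE// (le_trans L0).
apply: le_trans pq _.
apply: le_trans (@conjugate_powR _ p q 4 (4 / 3) p0 q0 _ _ _) _; rewrite ?divr_gt0//.
  by field.
rewrite le_eqVlt; apply/orP; left; apply/eqP.
have -> : p `^ 4 = nu * b ^+ 2.
  rewrite powR_mulrn// /p exprMn; congr (_ * _).
    rewrite -[LHS]powR_mulrn ?powR_ge0// -powRrM (_ : 1 / 4 * 4%:R = 1); last by field.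
    by rewrite powRr1// ltW.
  rewrite -[LHS]powR_mulrn ?powR_ge0// -powRrM (_ : 1 / 2 * 4%:R = 2%:R); last by field.
  by rewrite powR_mulrn.
have -> : q `^ (4 / 3) = nu `^ (- (1 / 3)) * beta `^ (8 / 3) * K `^ (4 / 3) * a ^+ 2.
  have HB : (beta ^+ 2) `^ (4 / 3) = beta `^ (8 / 3).
    rewrite -[beta ^+ 2]powR_mulrn ?ltW// -powRrM; congr powR; by field.
  have HA : (a `^ (3 / 2)) `^ (4 / 3) = a ^+ 2.
    rewrite -powRrM -[RHS]powR_mulrn//; congr powR; by field.
  have HN : (nu `^ (- (1 / 4))) `^ (4 / 3) = nu `^ (- (1 / 3)).
    by rewrite -powRrM; congr powR; field.
  have B0 : 0 <= beta ^+ 2 by exact: sqr_ge0.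
  have A0 : 0 <= a `^ (3 / 2) by exact: powR_ge0.
  have N0 : 0 <= nu `^ (- (1 / 4)) by exact: powR_ge0.
  rewrite /q; move: B0 A0 N0 HB HA HN.
  move: (beta ^+ 2) (a `^ (3 / 2)) (nu `^ (- (1 / 4))) => B A N B0 A0 N0 HB HA HN.
  rewrite !powRM ?mulr_ge0// HB HA HN; ring.
by field.
Qed.

(** The rate hypothesis integrates to that of gronwall: energy_le for the part
    in z, the fundamental theorem of calculus for W^2. *)
Lemma dissipation (z : R -> R -> R) (W W' : R -> R) (a b s0 : R) :
  0 < a -> 0 < s0 -> L2_continuous z ->
  (forall t : R, 0 < t -> is_derive t 1 W (W' t)) ->
  (forall t : R, 0 < t -> {for t, continuous W'}) ->
  (forall T, 0 < T -> exists zt h, [/\ weak_time_deriv T z zt, intble `]0, T[ h,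
    {ae leb, forall r, 0 < r < T -> L2 (zt r) /\ norm2 (zt r) <= h r} &
    {ae leb, forall r, 0 < r < T -> s0 <= r ->
       2 * inner (zt r) (z r) + 2 * (W r * W' r) <=
       b - a * (inner (z r) (z r) + W r ^+ 2)}]) ->
  forall s t, s0 <= s -> s <= t ->
  inner (z t) (z t) + W t ^+ 2 <=
  (inner (z s) (z s) + W s ^+ 2 - b / a) * expR (- a * (t - s)) + b / a.
Proof.
move=> a0 s00 cz dW cW' Hz s t s0s st.
have s_gt0 := lt_le_trans s00 s0s.
have cW r : 0 < r -> {for r, continuous W}.
  move=> r0; apply: differentiable_continuous; apply/derivable1_diffP.
  by have [] := dW r r0.
pose E r := inner (z r) (z r) + W r ^+ 2.
have cE r : 0 < r -> {for r, continuous E}.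
  move=> r0; apply: cvgD; first exact: L2_continuous_norm.
  by apply: cvgM; exact: cW.
apply: (@gronwall R E a b s t) => // p q sp pq qt.
have p0 := lt_le_trans s_gt0 sp.
have T0 : 0 < t + 1 by rewrite ltr_wpDl// (le_trans (ltW s_gt0)).
have [zt [h [dz hi hE zE]]] := Hz _ T0.
pose G r := b - a * E r - 2 * (W r * W' r).
have c1 r : p <= r <= q -> {for r, continuous (fun r => b - a * E r)}.
  move=> /andP[pr _]; have r0 := lt_le_trans p0 pr.
  by apply: cvgB; [exact: cvg_cst|apply: cvgMr; exact: cE].
have c2 r : p <= r <= q -> {for r, continuous (fun r => 2 * (W r * W' r))}.
  move=> /andP[pr _]; have r0 := lt_le_trans p0 pr.
  by apply: cvgMr; apply: cvgM; [exact: cW|exact: cW'].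
have qT : q < t + 1 by rewrite (le_lt_trans qt)// ltrDl.
have H : inner (z q) (z q) - inner (z p) (z p) <= \int[leb]_(r in `]p, q[) G r.
  apply: (energy_le cz dz hi hE p0 pq qT).
    by move=> r prq; apply: cvgB; [exact: c1|exact: c2].
  apply: filterS zE => r + /andP[pr rq].
  move=> /(_ _ _); rewrite (lt_trans p0 pr) (lt_trans rq qT).
  rewrite (le_trans s0s (le_trans sp (ltW pr))) => /(_ isT isT).
  by rewrite /G /E; lra.
have I1 := intble_cont c1; have I2 := intble_cont c2.
have H2 : \int[leb]_(r in `]p, q[) (2 * (W r * W' r)) = W q ^+ 2 - W p ^+ 2.
  apply: (@FTC R (fun r => W r ^+ 2)) => // r /andP[pr rq].
  apply: is_derive_eq (isd_exp 2 (dW r (lt_le_trans p0 pr))) _.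
  by rewrite /= expr1 mulrA.
by move: H; rewrite /G RintegralB// H2 /E; lra.
Qed.

(** The exponential term is eventually below the limit value b / a; the factor
    2 leaves room for it. *)
Lemma absorbing (E : R -> R) (a b s : R) : 0 < a -> 0 < b ->
  (forall t, s <= t -> E t <= (E s - b / a) * expR (- a * (t - s)) + b / a) ->
  exists2 t1, s <= t1 & forall t, t1 <= t -> E t <= 2 * b / a.
Proof.
move=> a0 b0 H; have ba : 0 < b / a by rewrite divr_gt0.
have [E0|E0] := leP (E s - b / a) 0.
  exists s => // t st; apply: le_trans (H t st) _.
  have : (E s - b / a) * expR (- a * (t - s)) <= 0 by rewrite mulr_le0_ge0// expR_ge0.
  by rewrite -mulrA; lra.
pose C := E s - b / a.
pose d := C / (b / a) / a.
have d0 : 0 <= d by rewrite !divr_ge0// ltW.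
exists (s + d); first by rewrite lerDl.
move=> t dt; have st : s <= t by rewrite (le_trans _ dt)// lerDl.
apply: le_trans (H t st) _; rewrite -/C.
have ds : d <= t - s by rewrite lerBrDl.
have C_le : C <= b / a * expR (a * (t - s)).
  apply: (@le_trans _ _ (b / a * (1 + a * (t - s)))); last first.
    by rewrite ler_wpM2l ?expR_ge1Dx// ltW.
  apply: (@le_trans _ _ (b / a * (a * d))).
    by rewrite le_eqVlt; apply/orP; left; apply/eqP; rewrite /d; field; rewrite !gt_eqF.
  rewrite ler_wpM2l ?(ltW ba)//.
  have : a * d <= a * (t - s) by rewrite ler_wpM2l// ltW.
  by lra.
have : C * expR (- a * (t - s)) <= b / a.
  by rewrite mulNr expRN ler_pdivrMr ?expR_gt0.
by rewrite -mulrA; lra.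
Qed.

End dissipation.

(** * Dissipation rates of the two systems and of their difference *)

Section rates.
Context {R : realType}.
Implicit Types (a b z adt bdt : R -> R) (nu mu U V : R) (w : nat -> R -> R) (N : nat).

(** The right-hand side of the equation for v. *)
Definition burgers nu U a (x : R) : R :=
  U * a x + nu * dx (dx a) x - 2 * (a x * dx a x).

Definition mode_proj w N a (x : R) : R := \sum_(1 <= k < N.+1) inner a (w k) * w k x.

Lemma L2_burgers nu U a : H10 a -> H2 a -> L2 (burgers nu U a).
Proof.
move=> ha [_ ha2]; apply: L2B; last by apply: L2Z; apply: H10M_L2 => //; exact: H10_dx_L2.
by apply: L2D; apply: L2Z; [exact: H10_L2|exact: H1_dx_L2].
Qed.

Lemma inner_burgers nu U a z : H10 a -> H2 a -> L2 z ->
  inner (burgers nu U a) z =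
  U * inner a z + nu * inner (dx (dx a)) z - 2 * inner (fun x => a x * dx a x) z.
Proof.
move=> ha [_ ha2] z2; have a2 := H10_L2 ha; have da2 := H10_dx_L2 ha.
have dda2 := H1_dx_L2 ha2; have aa := H10M_L2 ha da2.
rewrite /burgers (innerBl (L2D (L2Z U a2) (L2Z nu dda2)) (L2Z 2 aa) z2).
rewrite (innerDl (L2Z U a2) (L2Z nu dda2) z2).
by rewrite (innerZl U a2 z2) (innerZl nu dda2 z2) (innerZl 2 aa z2).
Qed.

(** The quadratic term does not contribute, by H10_cubic. *)
Lemma burgers_energy nu U a : H10 a -> H2 a ->
  inner (burgers nu U a) a = U * inner a a - nu * inner (dx a) (dx a).
Proof.
move=> ha [ha1 ha2]; rewrite inner_burgers//; last exact: H10_L2.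
rewrite H10_cubic// mulr0 subr0.
by have := H1_IBP ha2 ha => ->; rewrite mulrN opprK.
Qed.

Lemma L2_proj w N a : (forall k, (0 < k)%N -> L2 (w k)) -> L2 (mode_proj w N a).
Proof.
move=> w2; rewrite /mode_proj; under eq_fun do rewrite big_add1 big_mkord.
by apply: L2_sum => i; apply: L2Z; exact: w2.
Qed.

Lemma inner_proj w N a b : (forall k, (0 < k)%N -> L2 (w k)) -> L2 b ->
  inner (mode_proj w N a) b = \sum_(1 <= k < N.+1) inner a (w k) * inner b (w k).
Proof.
move=> w2 b2; rewrite /mode_proj; under [X in inner X _]eq_fun do rewrite big_add1 big_mkord.
rewrite big_add1 big_mkord inner_suml//; last by move=> i; apply: L2Z; exact: w2.
by apply: eq_bigr => i _; rewrite innerZl ?(innerC (w _))//; exact: w2.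
Qed.

(** The square of the norm of a - P_N a is nonnegative. *)
Lemma bessel w lam N a : dirichlet_eigensystem w lam -> L2 a ->
  \sum_(1 <= k < N.+1) inner a (w k) ^+ 2 <= inner a a.
Proof.
move=> [we orth _ _] a2.
have w2 k : (0 < k)%N -> L2 (w k) by move=> /we[/H10_L2].
have p2 := L2_proj N a w2.
have pa : inner (mode_proj w N a) a = \sum_(1 <= k < N.+1) inner a (w k) ^+ 2.
  by rewrite inner_proj//; apply: eq_bigr => k _; rewrite expr2.
have pp : inner (mode_proj w N a) (mode_proj w N a) = \sum_(1 <= k < N.+1) inner a (w k) ^+ 2.
  rewrite inner_proj// !big_add1 !big_mkord; apply: eq_bigr => i _.
  rewrite expr2; congr (_ * _).
  rewrite inner_proj//; last exact: w2.
  rewrite big_add1 big_mkord (bigD1 i)//= orth// eqxx mulr1 big1 ?addr0// => j ji.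
  by rewrite orth// eqSS (_ : (i == j :> nat) = false) ?mulr0// eq_sym; exact/negbTE.
have := inner_ge0 (fun x => a x - mode_proj w N a x).
rewrite innerBl ?innerBr//; last exact: L2B.
by rewrite (innerC a (mode_proj w N a)) pa pp; lra.
Qed.

(** The terms U ||a||^2 of the two equations cancel, the Poincare inequality
    bounds the viscous term, and 2 r U <= r^2 / nu + nu U^2. *)
Lemma uncontrolled_rate nu r lam1 U dU a adt : 0 < nu ->
  H10 a -> H2 a -> L2 adt ->
  lam1 * inner a a <= inner (dx a) (dx a) ->
  {ae leb, forall x, I01 x -> adt x = burgers nu U a x} ->
  dU = r - nu * U - inner a a ->
  2 * inner adt a + 2 * (U * dU) <=
  r ^+ 2 / nu - d0 nu lam1 * (inner a a + U ^+ 2).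
Proof.
move=> nu0 ha ha2 adt2 gap ate ->; have a2 := H10_L2 ha.
have aa := inner_ge0 a.
have -> : inner adt a = U * inner a a - nu * inner (dx a) (dx a).
  by rewrite (inner_aeS adt2 (L2_burgers nu U ha ha2) a2 ate) burgers_energy.
have n1 : d0 nu lam1 * U ^+ 2 <= nu * U ^+ 2.
  by rewrite ler_wpM2r ?sqr_ge0// /d0 ler_piMr ?(ltW nu0)// ge_min lexx.
have n2 : d0 nu lam1 * inner a a <= 2 * nu * inner (dx a) (dx a).
  apply: (@le_trans _ _ (2 * nu * (lam1 * inner a a))).
    rewrite mulrA ler_wpM2r// /d0 -mulrA mulrCA ler_wpM2l ?(ltW nu0)//.
    by rewrite ge_min lexx orbT.
  by rewrite ler_wpM2l// mulr_ge0// ltW.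
have n3 : 0 <= (r - nu * U) ^+ 2 / nu by rewrite divr_ge0 ?sqr_ge0// ltW.
have n4 : (r - nu * U) ^+ 2 / nu = r ^+ 2 / nu - 2 * (r * U) + nu * U ^+ 2.
  by field; rewrite gt_eqF.
move: n1 n2 n3; rewrite n4; move: (inner (dx a) (dx a)) (inner a a) (d0 nu lam1) => D A d.
by move: (r ^+ 2 / nu) => q; lra.
Qed.

(** In terms of the coefficients p of a and q of b, the feedback contributes p
    q - p^2 <= q^2 / 4 for each mode, and bessel sums the right-hand sides. *)
Lemma feedback_rate nu mu r lam1 w lam N M U dU a adt b : 0 < nu -> 0 < mu ->
  dirichlet_eigensystem w lam ->
  H10 a -> H2 a -> L2 adt -> L2 b -> inner b b <= M ->
  lam1 * inner a a <= inner (dx a) (dx a) ->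
  {ae leb, forall x, I01 x -> adt x = burgers nu U a x
     - mu * mode_proj w N (fun y => a y - b y) x} ->
  dU = r - nu * U - inner a a ->
  2 * inner adt a + 2 * (U * dU) <=
  r ^+ 2 / nu + mu / 2 * M - d1 nu lam1 * (inner a a + U ^+ 2).
Proof.
move=> nu0 mu0 wl ha ha2 adt2 b2 bM gap ate dUE; have a2 := H10_L2 ha.
have w2 k : (0 < k)%N -> L2 (w k) by have [we _ _ _] := wl; move=> /we[/H10_L2].
have p2 := L2_proj N (fun y => a y - b y) w2.
have bu2 := L2_burgers nu U ha ha2.
have := uncontrolled_rate nu0 ha ha2 bu2 gap (aeW _ (fun _ _ => erefl)) dUE.
have -> : inner adt a = inner (burgers nu U a) a
    - mu * inner (mode_proj w N (fun y => a y - b y)) a.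
  rewrite (inner_aeS adt2 _ a2 ate); last by apply: L2B => //; exact: L2Z.
  by rewrite innerBl ?innerZl//; exact: L2Z.
have key : - (inner (mode_proj w N (fun y => a y - b y)) a) <= M / 4.
  rewrite inner_proj//.
  apply: (@le_trans _ _ (\sum_(1 <= k < N.+1) (inner b (w k) ^+ 2) / 4)).
    rewrite -sumrN !big_add1 !big_mkord; apply: ler_sum => i _.
    rewrite innerBl//; last exact: w2.
    move: (inner a _) (inner b _) => p q.
    by have := sqr_ge0 (p - q / 2); lra.
  rewrite -mulr_suml ler_wpM2r ?invr_ge0//.
  exact: le_trans (bessel _ wl b2) bM.
move: key; rewrite -(ler_pM2l mu0); rewrite /d0 /d1.
move: (inner (mode_proj _ _ _) _) => P.
by move: (nu * Num.min 1 (2 * lam1) * _) => Q; lra.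
Qed.

(** Write b b_x - a a_x = b z_x + z a_x; by H10_sqr_IBP, the pairing of the
    first term with 2 z is minus the integral of z^2 b_x. *)
Lemma nonlinear_difference a b z : H10 a -> H10 b ->
  z = (fun x => b x - a x) ->
  2 * (inner (fun x => b x * dx b x) z - inner (fun x => a x * dx a x) z) =
  2 * inner (fun x => z x * z x) (dx a) - inner (fun x => z x * z x) (dx b).
Proof.
move=> ha hb zE; have hz : H10 z by rewrite zE; exact: H10B.
have a2 := H10_L2 ha; have b2 := H10_L2 hb; have z2 := H10_L2 hz.
have da2 := H10_dx_L2 ha; have db2 := H10_dx_L2 hb; have dz2 := H10_dx_L2 hz.
have dzE : {ae leb, forall x, I01 x -> dx z x = dx b x - dx a x}.
  by rewrite zE; exact: (H1B (H10_H1 hb) (H10_H1 ha)).2.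
have ba := H10M_L2 hb db2; have aa := H10M_L2 ha da2.
have bz := H10M_L2 hb dz2; have za := H10M_L2 hz da2.
have E : inner (fun x => b x * dx b x - a x * dx a x) z =
    inner (fun x => b x * dx z x + z x * dx a x) z.
  apply: inner_aeS => //; [exact: L2B|exact: L2D|].
  by apply: filterS dzE => x H Ix; rewrite H// zE; ring.
rewrite (innerBl ba aa z2) (innerDl bz za z2) in E.
have H := H10_sqr_IBP hb hz.
have E1 : inner (fun x => z x * dx z x) b = inner (fun x => b x * dx z x) z.
  by apply: eq_Rintegral => x _; ring.
have E2 : inner (fun x => z x * dx a x) z = inner (fun x => z x * z x) (dx a).
  by apply: eq_Rintegral => x _; ring.
rewrite E E2 H E1; ring.
Qed.

(** Complete the square (nu V + x)^2. *)
Lemma coupling_algebra (nu V x m y : R) : 0 < nu -> x ^+ 2 <= y * m ->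
  - (V * x) <= nu / 2 * V ^+ 2 + (2 * nu)^-1 * m * y.
Proof.
move=> nu0 H.
have n0 : 0 <= (2 * nu)^-1 by rewrite invr_ge0 mulr_ge0// ltW.
have H' : (2 * nu)^-1 * (x ^+ 2) <= (2 * nu)^-1 * (y * m) by rewrite ler_wpM2l.
have : 0 <= (2 * nu)^-1 * (nu * V + x) ^+ 2 by rewrite mulr_ge0 ?sqr_ge0.
have -> : (2 * nu)^-1 * (nu * V + x) ^+ 2 =
    nu / 2 * V ^+ 2 + V * x + (2 * nu)^-1 * x ^+ 2 by field; rewrite gt_eqF.
have -> : (2 * nu)^-1 * m * y = (2 * nu)^-1 * (y * m) by ring.
move: H'; move: (_ * (y * m)) ((2 * nu)^-1 * x ^+ 2) => p q; lra.
Qed.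

Lemma nonlinear_algebra (p q n c d : R) : `|p| <= n * c -> `|q| <= n * d ->
  - (2 * p - q) <= n * (2 * c + d).
Proof.
by rewrite !ler_norml => /andP[h1 h2] /andP[h3 h4]; rewrite mulrDr; lra.
Qed.

(** Here S stands for the squared norm of the low modes: M S is controlled by
    the feedback mu S, and M (y - S) by the spectral gap. *)
Lemma modes_algebra (mu nu l M S y x : R) : 0 <= S -> 0 <= x -> 0 <= M -> 0 < l ->
  l * (y - S) <= x -> M <= mu -> l^-1 * M <= nu / 4 ->
  M * y <= mu * S + nu / 4 * x.
Proof.
move=> S0 x0 M0 l0 gap Mmu Ml.
have h1 : M * S <= mu * S by rewrite ler_wpM2r.
have h2 : M * (y - S) <= nu / 4 * x.
  apply: (@le_trans _ _ (l^-1 * M * x)); last by rewrite ler_wpM2r.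
  rewrite [l^-1 * _]mulrC -mulrA ler_wpM2l//.
  by rewrite -ler_pdivrMl ?invr_gt0// invrK.
by move: h2; rewrite mulrBr; lra.
Qed.

(** The scalar identity behind difference_rate; z z, z x and so on stand for
    the inner products that occur there. *)
Lemma energy_balance_algebra
  (nu mu U U' V S zt zz zxb zxa zx zb za bz az Bz Az nb na P Q bb aa : R) :
  V = U' - U -> zt = Bz - Az - mu * S -> zxb - zxa = - zx ->
  2 * (nb - na) = 2 * P - Q -> bb - aa = zb + za -> bz = zz + az ->
  za = az -> zb = bz ->
  Bz = U' * bz + nu * zxb - 2 * nb -> Az = U * az + nu * zxa - 2 * na ->
  zt + V * (- nu * V - (bb - aa)) =
  U' * zz - V * zb - nu * zx - (2 * P - Q) - mu * S - nu * V ^+ 2.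
Proof.
move=> -> -> /eqP; rewrite subr_eq => /eqP -> <- -> -> -> -> -> ->; ring.
Qed.

(** The sum of the estimates of difference_rate: the quarters of nu z_x^2
    spent on the nonlinear term and on the high modes leave one half of it. *)
Lemma difference_algebra (nu mu U' V S zz zx zb NL sm mm M5 dd zt dV : R) :
  zt + V * dV = U' * zz - V * zb - nu * zx - NL - mu * S - nu * V ^+ 2 ->
  U' * zz <= sm * zz ->
  - (V * zb) <= nu / 2 * V ^+ 2 + mm * zz ->
  - NL <= nu / 4 * zx + (M5 - (sm + mm)) * zz ->
  M5 * zz <= mu * S + nu / 4 * zx ->
  dd * V ^+ 2 <= nu * V ^+ 2 -> dd * zz <= nu * zx ->
  2 * zt + 2 * (V * dV) <= 0 - dd * (zz + V ^+ 2).
Proof. by move=> H; rewrite -mulrDr H; lra. Qed.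

(** The cubic coupling terms of the two equations combine to U' ||z||^2 - V
    (z, b), which the bound m controls. The bound on the quadratic term is
    what remains of M5 once these two contributions are subtracted, and
    modes_algebra absorbs M5 ||z||^2. *)
Lemma difference_rate nu mu lam w N U U' dU dU' a b z adt bdt m K M5 lam1 :
  0 < nu -> 0 < mu -> 0 <= M5 -> dirichlet_eigensystem w lam -> lam1 = lam 1%N ->
  z = (fun x => b x - a x) ->
  H10 a -> H2 a -> H10 b -> H2 b -> L2 adt -> L2 bdt ->
  inner b b + U' ^+ 2 <= m ->
  norm2 (fun x => z x * z x) * K <=
    nu / 4 * inner (dx z) (dx z) +
    (M5 - (Num.sqrt m + (2 * nu)^-1 * m)) * inner z z ->
  2 * norm2 (dx a) + norm2 (dx b) <= K ->
  M5 <= mu -> (lam N.+1)^-1 * M5 <= nu / 4 ->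
  {ae leb, forall x, I01 x -> adt x = burgers nu U a x} ->
  {ae leb, forall x, I01 x -> bdt x = burgers nu U' b x
     - mu * mode_proj w N z x} ->
  dU' - dU = - nu * (U' - U) - (inner b b - inner a a) ->
  2 * inner (fun x => bdt x - adt x) z
    + 2 * ((U' - U) * (dU' - dU)) <=
  0 - d2 nu lam1 * (inner z z + (U' - U) ^+ 2).
Proof.
move=> nu0 mu0 M50 wl lam1E zE ha ha2 hb hb2 adt2 bdt2 bm HL4 HK M5mu M5lam ate bte ->.
have hz : H10 z by rewrite zE; exact: H10B.
have a2 := H10_L2 ha; have b2 := H10_L2 hb; have z2 := H10_L2 hz.
have da2 := H10_dx_L2 ha; have db2 := H10_dx_L2 hb; have dz2 := H10_dx_L2 hz.
have zz := H10M_L2 hz z2.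
have w2 k : (0 < k)%N -> L2 (w k) by have [we _ _ _] := wl; move=> /we[/H10_L2].
have p2 := L2_proj N z w2.
have A2 := L2_burgers nu U ha ha2; have B2 := L2_burgers nu U' hb hb2.
have [S SE] : exists S, S = \sum_(1 <= k < N.+1) inner z (w k) ^+ 2.
  by exists (\sum_(1 <= k < N.+1) inner z (w k) ^+ 2).
have E1 : inner (fun x => bdt x - adt x) z =
    inner (burgers nu U' b) z - inner (burgers nu U a) z - mu * S.
  rewrite innerBl// (inner_aeS adt2 A2 z2 ate).
  rewrite (inner_aeS bdt2 (L2B B2 (L2Z mu p2)) z2 bte) innerBl//; last exact: L2Z.
  rewrite innerZl// inner_proj//.
  have -> : \sum_(1 <= k < N.+1) inner z (w k) * inner z (w k) = S.
    by rewrite SE; apply: eq_bigr => k _; rewrite expr2.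
  by rewrite addrAC.
have dzE : {ae leb, forall x, I01 x -> dx z x = dx b x - dx a x}.
  by rewrite zE; exact: (H1B (H10_H1 hb) (H10_H1 ha)).2.
have visc : inner (dx (dx b)) z - inner (dx (dx a)) z = - inner (dx z) (dx z).
  have e1 := H1_IBP ha2.2 hz; have e2 := H1_IBP hb2.2 hz.
  have -> : inner (dx z) (dx z) = inner (dx b) (dx z) - inner (dx a) (dx z).
    by rewrite (inner_aeS dz2 (L2B db2 da2) dz2 dzE) innerBl.
  by rewrite e1 e2 opprB opprK addrC.
have nonlin := nonlinear_difference ha hb zE.
have bb : inner b b - inner a a = inner z b + inner z a.
  by rewrite zE !innerBl// (innerC a b); ring.
have bza : inner b z = inner z z + inner a z.
  by rewrite -innerDl//; apply: eq_Rintegral => x _; rewrite zE; ring.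
have za : inner z a = inner a z by exact: innerC.
have zb : inner z b = inner b z by exact: innerC.
have I1 := inner_burgers nu U' hb hb2 z2; have I2 := inner_burgers nu U ha ha2 z2.
have [V VE] : exists V, V = U' - U by exists (U' - U).
have total := energy_balance_algebra VE E1 visc nonlin bb bza za zb I1 I2.
rewrite -VE.
have CS1 := cauchy_schwarz zz da2; have CS2 := cauchy_schwarz zz db2.
have CS3 := cauchy_schwarz z2 b2.
have zz0 := inner_ge0 z; have dd0 := inner_ge0 (dx z).
have m0 : 0 <= m by apply: le_trans bm; rewrite addr_ge0 ?inner_ge0 ?sqr_ge0.
have bb0 := inner_ge0 b.
have U'm : U' <= Num.sqrt m.
  apply: le_trans (ler_norm _) _; rewrite -sqrtr_sqr ler_wsqrtr//.
  by apply: le_trans bm; rewrite lerDr.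
have e_U : U' * inner z z <= Num.sqrt m * inner z z by rewrite ler_wpM2r.
have e_V : - (V * inner z b) <= nu / 2 * V ^+ 2 + (2 * nu)^-1 * m * inner z z.
  apply: coupling_algebra => //.
  rewrite -[inner z b ^+ 2]real_normK ?num_real//.
  apply: (@le_trans _ _ ((norm2 z * norm2 b) ^+ 2)).
    by rewrite ler_sqr// ?nnegrE ?mulr_ge0 ?norm2_ge0.
  rewrite exprMn !norm2_sq ler_wpM2l//; apply: le_trans bm.
  by rewrite lerDl sqr_ge0.
have e_N : - (2 * inner (fun x => z x * z x) (dx a) - inner (fun x => z x * z x) (dx b)) <=
    nu / 4 * inner (dx z) (dx z) + (M5 - (Num.sqrt m + (2 * nu)^-1 * m)) * inner z z.
  apply: le_trans HL4.
  apply: (@le_trans _ _ (norm2 (fun x => z x * z x) * (2 * norm2 (dx a) + norm2 (dx b)))).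
    exact: nonlinear_algebra.
  by rewrite ler_wpM2l// norm2_ge0.
have S0 : 0 <= S by rewrite SE; apply: sumr_ge0 => k _; exact: sqr_ge0.
have lamN0 := eigensystem_gt0 wl (ltn0Sn N).
have gapN := eigensystem_gap N wl hz; rewrite -SE in gapN.
have e_S := modes_algebra S0 dd0 M50 lamN0 gapN M5mu M5lam.
have gap1 := eigensystem_gap 0 wl hz; rewrite big_geq// subr0 -lam1E in gap1.
have n1 : d2 nu lam1 * V ^+ 2 <= nu * V ^+ 2.
  by rewrite ler_wpM2r ?sqr_ge0// /d2 ler_piMr ?(ltW nu0)// ge_min lexx.
have n2 : d2 nu lam1 * inner z z <= nu * inner (dx z) (dx z).
  apply: (@le_trans _ _ (nu * (lam1 * inner z z))).
    by rewrite mulrA ler_wpM2r// /d2 ler_wpM2l ?(ltW nu0)// ge_min lexx orbT.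
  by rewrite ler_wpM2l// ltW.
exact: (difference_algebra total e_U e_V e_N e_S n1 n2).
Qed.

End rates.

(** * Absorbing sets and synchronization *)

Section solutions.
Context {R : realType}.

Lemma solution_L2_continuous (v0 : R -> R) (U0 : R) (v : R -> R -> R)
  (U : R -> R) : solution_class v0 U0 v U ->
  L2_continuous v.
Proof.
move=> [cv _ _ _ _] t t0; have [v2 c] := cv t (ltW t0); split=> //.
apply/cvgrPdist_le => e e0; rewrite near_simpl.
move/cvgrPdist_le : c => /(_ e e0); rewrite near_withinE => c.
have rpos : \forall s \near t, 0 < s by exact: lt_nbhsr.
by apply: filterS2 c rpos => s H s0; apply: H; rewrite /= in_itv/= andbT ltW.
Qed.

Lemma solution_spaces (v0 : R -> R) (U0 T : R) (v : R -> R -> R)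
  (U : R -> R) : solution_class v0 U0 v U -> 0 < T ->
  {ae leb, forall t, 0 < t < T -> H10 (v t) /\ H2 (v t)}.
Proof.
move=> [_ sp _ _ _] T0; have [[h1 _ _] [h2 _ _]] := sp T T0.
by apply: filterS2 h1 h2 => t H1 H2' tT; split; [exact: H1|exact: H2'].
Qed.

Lemma solution_dU (v0 : R -> R) (U0 : R) (v : R -> R -> R)
  (U : R -> R) : solution_class v0 U0 v U ->
  forall t : R, 0 < t -> is_derive t 1 U (derive1 U t).
Proof. by move=> [_ _ dU _ _] t t0; apply: derivableE; case: (dU t t0). Qed.

Lemma solution_cU (v0 : R -> R) (U0 : R) (v : R -> R -> R)
  (U : R -> R) : solution_class v0 U0 v U ->
  forall t : R, 0 < t -> {for t, continuous (derive1 U)}.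
Proof. by move=> [_ _ dU _ _] t t0; case: (dU t t0). Qed.

(** The equation in the form required by the rate estimates, with an
    integrable bound of the time derivative. *)
Lemma strong_data (nu r T : R) (v0 : R -> R) (U0 : R) (v : R -> R -> R)
  (U : R -> R) : strong_solution nu r v0 U0 v U -> 0 < T ->
  exists vt h, [/\ weak_time_deriv T v vt, intble `]0, T[ h,
    {ae leb, forall t, 0 < t < T -> L2 (vt t) /\ norm2 (vt t) <= h t} &
    {ae leb, forall t, 0 < t < T -> [/\ H10 (v t), H2 (v t) &
       {ae leb, forall x, I01 x -> vt t x = burgers nu (U t) (v t) x}]}].
Proof.
move=> [cl eqn _] T0; have [vt [bv dv ev]] := eqn T T0.
have [h [hi hE]] := Bochner_norm bv.
exists vt, h; split=> //.
- by apply: weak_dt_time_deriv => //; exact: solution_L2_continuous cl.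
- by apply: filterS hE => t H /H[? ->].
apply: filterS2 (solution_spaces cl T0) ev => t sp e tT.
have [h1 h2] := sp tT; split=> //.
have := e _ => /(_ tT); apply: filterS => x ex Ix.
apply/eqP; rewrite -subr_eq0 -(ex _) ?inE// /burgers; apply/eqP; ring.
Qed.

Lemma feedback_data (nu r mu T : R) N w (v : R -> R -> R) (v0 : R -> R)
  (U0 : R) v' U' :
  feedback_solution nu r mu N w v v0 U0 v' U' -> 0 < T ->
  exists vt h, [/\ weak_time_deriv T v' vt, intble `]0, T[ h,
    {ae leb, forall t, 0 < t < T -> L2 (vt t) /\ norm2 (vt t) <= h t} &
    {ae leb, forall t, 0 < t < T -> [/\ H10 (v' t), H2 (v' t) &
       {ae leb, forall x, I01 x -> vt t x = burgers nu (U' t) (v' t) x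
         - mu * mode_proj w N (fun y => v' t y - v t y) x}]}].
Proof.
move=> [cl eqn _] T0; have [vt [bv dv ev]] := eqn T T0.
have [h [hi hE]] := Bochner_norm bv.
exists vt, h; split=> //.
- by apply: weak_dt_time_deriv => //; exact: solution_L2_continuous cl.
- by apply: filterS hE => t H /H[? ->].
apply: filterS2 (solution_spaces cl T0) ev => t sp e tT.
have [h1 h2] := sp tT; split=> //.
have := e _ => /(_ tT); apply: filterS => x ex Ix.
apply/eqP; rewrite -subr_eq0 -(ex _) ?inE// /burgers /mode_proj; apply/eqP; ring.
Qed.

Lemma strong_dU (nu r t : R) v0 U0 v U : strong_solution nu r v0 U0 v U -> 0 < t ->
  derive1 U t = r - nu * U t - inner (v t) (v t).
Proof.
move=> [_ _ eqU] t0; have := eqU t t0.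
have -> : \int[leb]_(x in I01) (v t x ^+ 2) = inner (v t) (v t).
  by apply: eq_Rintegral => x _; rewrite expr2.
by move: (inner _ _) => A H; lra.
Qed.

(** absorbing for the rate b = r^2 / nu, a = d0: M1 is 2 b / a. *)
Lemma uncontrolled_absorbing (nu r : R) v0 U0 v U w (lam : nat -> R) :
  0 < nu -> 0 < r -> dirichlet_eigensystem w lam ->
  strong_solution nu r v0 U0 v U ->
  exists2 t1, 1 <= t1 & forall t, t1 <= t ->
    inner (v t) (v t) + U t ^+ 2 <= M1 nu r (lam 1%N).
Proof.
move=> nu0 r0 wl sol; have [cl _ _] := sol.
have lam0 := eigensystem_gt0 wl (ltn0Sn 0).
have a0 : 0 < d0 nu (lam 1%N).
  by rewrite /d0 mulr_gt0// lt_min ltr01 mulr_gt0.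
have b0 : 0 < r ^+ 2 / nu by rewrite divr_gt0// exprn_gt0.
have D := dissipation a0 ltr01 (solution_L2_continuous cl) (solution_dU cl)
  (solution_cU cl) (b := r ^+ 2 / nu).
have [|t1 t11 H] := @absorbing R (fun t => inner (v t) (v t) + U t ^+ 2) _ _ 1 a0 b0.
  move=> t t1; apply: D => // T T0.
  have [vt [h [dv hi hE ev]]] := strong_data sol T0.
  exists vt, h; split=> //; apply: filterS2 hE ev => q hq eq_ qT _.
  have [h1 h2 e] := eq_ qT; have [vt2 _] := hq qT.
  apply: (uncontrolled_rate nu0 h1 h2 vt2 _ e).
    by have := eigensystem_gap 0 wl h1; rewrite big_geq// subr0.
  exact: strong_dU sol (proj1 (andP qT)).
exists t1 => // t t1t; apply: le_trans (H t t1t) _.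
rewrite le_eqVlt; apply/orP; left; apply/eqP; rewrite /M1.
by field; rewrite !gt_eqF.
Qed.

(** absorbing for the rate b = r^2 / nu + (mu / 2) M1, a = d1, valid once v
    satisfies the bound M1: M3 is 2 b / a. *)
Lemma feedback_absorbing (nu r mu : R) N v0 U0 v U v0' U0' v' U' w (lam : nat -> R) :
  0 < nu -> 0 < r -> 0 < mu -> dirichlet_eigensystem w lam ->
  strong_solution nu r v0 U0 v U ->
  feedback_solution nu r mu N w v v0' U0' v' U' ->
  exists2 t1, 1 <= t1 & forall t, t1 <= t ->
    inner (v' t) (v' t) + U' t ^+ 2 <= M3 nu r mu (lam 1%N).
Proof.
move=> nu0 r0 mu0 wl sol fsol; have [cl _ _] := sol; have [fcl _ fU] := fsol.
have lam0 := eigensystem_gt0 wl (ltn0Sn 0).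
have [t1 t11 HM1] := uncontrolled_absorbing nu0 r0 wl sol.
have a0 : 0 < d1 nu (lam 1%N).
  by rewrite /d1 mulr_gt0// lt_min ltr01 mulr_gt0.
have M10 : 0 <= M1 nu r (lam 1%N).
  by apply: le_trans (HM1 t1 (lexx _)); rewrite addr_ge0 ?inner_ge0 ?sqr_ge0.
have b0 : 0 < r ^+ 2 / nu + mu / 2 * M1 nu r (lam 1%N).
  by rewrite ltr_pwDl ?divr_gt0 ?exprn_gt0// mulr_ge0// divr_ge0// ltW.
have t10 := lt_le_trans ltr01 t11.
have D := dissipation a0 t10 (solution_L2_continuous fcl) (solution_dU fcl)
  (solution_cU fcl) (b := r ^+ 2 / nu + mu / 2 * M1 nu r (lam 1%N)).
have [|t2 t12 H] := @absorbing R (fun t => inner (v' t) (v' t) + U' t ^+ 2) _ _ t1 a0 b0.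
  move=> t t1t; apply: D => // T T0.
  have [vt [h [dv hi hE ev]]] := feedback_data fsol T0.
  exists vt, h; split=> //; apply: filterS2 hE ev => q hq eq_ qT t1q.
  have [h1 h2 e] := eq_ qT; have [vt2 _] := hq qT.
  have q0 := proj1 (andP qT).
  have [v2 _] := solution_L2_continuous cl q0.
  apply: (feedback_rate nu0 mu0 wl h1 h2 vt2 v2 _ _ e).
  - by apply: le_trans (HM1 q t1q); rewrite lerDl sqr_ge0.
  - by have := eigensystem_gap 0 wl h1; rewrite big_geq// subr0.
  - by rewrite fU// norm2_sq.
exists t2 => [|t t2t]; first exact: le_trans t12.
apply: le_trans (H t t2t) _.
rewrite le_eqVlt; apply/orP; left; apply/eqP; rewrite /M3.
by field; rewrite !gt_eqF.
Qed.

End solutions.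

Theorem proposition2p1 (R : realType) (nu r mu : R) (N : nat)
  (w : nat -> R -> R) (lam : nat -> R) (beta M2 M4 : R)
  (v0 v0' : R -> R) (U0 U0' : R)
  (v v' : R -> R -> R) (U U' : R -> R) :
  0 < nu -> 0 < r -> 0 < mu -> (0 < N)%N ->
  dirichlet_eigensystem w lam ->
  0 < beta -> gagliardo_nirenberg beta ->
  0 < M2 -> eventual_H1_bound nu r M2 ->
  0 < M4 -> feedback_eventual_H1_bound nu r mu w M4 ->
  H10 v0 -> H10 v0' ->
  strong_solution nu r v0 U0 v U ->
  feedback_solution nu r mu N w v v0' U0' v' U' ->
  M5 nu r mu (lam 1%N) beta M2 M4 <= mu ->
  (lam N.+1)^-1 * M5 nu r mu (lam 1%N) beta M2 M4 <= nu / 4 ->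
  exists2 t0 : R, 0 < t0 & forall t, t0 <= t ->
    norm2 (fun x => v' t x - v t x) ^+ 2 + `|U' t - U t| ^+ 2 <=
    (norm2 (fun x => v t0 x - v' t0 x) ^+ 2 + `|U t0 - U' t0| ^+ 2)
    * expR (- d2 nu (lam 1%N) * (t - t0)).
Proof.
move=> nu0 r0 mu0 N0 wl beta0 gn M20 HM2 M40 HM4 hv0 hv0' sol fsol M5mu M5lam.
have [cl _ _] := sol; have [fcl _ fU] := fsol.
have [T2 T20 B2] := HM2 _ _ _ _ hv0 sol.
have [T4 T40 B4] := HM4 _ _ _ _ _ _ _ _ _ N0 hv0 hv0' sol fsol.
have [T3 T31 B3] := feedback_absorbing nu0 r0 mu0 wl sol fsol.
have lam0 := eigensystem_gt0 wl (ltn0Sn 0).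
pose t0 := Num.max T3 (Num.max T2 T4).
have t00 : 0 < t0 by rewrite lt_max (lt_le_trans ltr01 T31).
have a0 : 0 < d2 nu (lam 1%N) by rewrite /d2 mulr_gt0// lt_min ltr01.
have cz := L2_continuousB (solution_L2_continuous fcl) (solution_L2_continuous cl).
have dV (t : R) : 0 < t -> is_derive t 1 (fun t => U' t - U t) (derive1 U' t - derive1 U t).
  by move=> tp; apply: isd_sub; [exact: (solution_dU fcl)|exact: (solution_dU cl)].
have cV (t : R) : 0 < t -> {for t, continuous (fun t => derive1 U' t - derive1 U t)}.
  by move=> tp; apply: cvgB; [exact: (solution_cU fcl)|exact: (solution_cU cl)].
set m3 := M3 nu r mu (lam 1%N) in B3.
pose K := Num.sqrt M4 + 2 * Num.sqrt M2.
have K0 : 0 <= K by rewrite addr_ge0 ?mulr_ge0 ?sqrtr_ge0.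
set m5 := M5 nu r mu (lam 1%N) beta M2 M4 in M5mu M5lam.
have m30 : 0 <= m3.
  by apply: le_trans (B3 T3 (lexx _)); rewrite addr_ge0 ?inner_ge0 ?sqr_ge0.
(* The coefficient left by the linear terms of M5 is exactly the one given by
   gagliardo_young. *)
have m5E : m5 - (Num.sqrt m3 + (2 * nu)^-1 * m3) =
    3 / 4 * nu `^ (- (1 / 3)) * beta `^ (8 / 3) * K `^ (4 / 3).
  by rewrite /m5 /M5 -/m3 -/K addrC addKr.
have m50 : 0 <= m5.
  rewrite /m5 /M5 -/m3 !addr_ge0 ?sqrtr_ge0//.
    by rewrite mulr_ge0// invr_ge0 mulr_ge0// ltW.
  by rewrite !mulr_ge0 ?powR_ge0.
have D := dissipation a0 t00 cz dV cV (b := 0).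
exists t0 => // t t0t.
have rate T : 0 < T -> exists zt h, [/\ weak_time_deriv T (fun t x => v' t x - v t x) zt,
    intble `]0, T[ h,
    {ae leb, forall r, 0 < r < T -> L2 (zt r) /\ norm2 (zt r) <= h r} &
    {ae leb, forall r, 0 < r < T -> t0 <= r ->
       2 * inner (zt r) (fun x => v' r x - v r x) +
       2 * ((U' r - U r) * (derive1 U' r - derive1 U r)) <=
       0 - d2 nu (lam 1%N) * (inner (fun x => v' r x - v r x) (fun x => v' r x - v r x)
         + (U' r - U r) ^+ 2)}].
  move=> T0.
  have [vt [h [dv hi hE ev]]] := strong_data sol T0.
  have [vt' [h' [dv' hi' hE' ev']]] := feedback_data fsol T0.
  exists (fun t x => vt' t x - vt t x), (fun t => h' t + h t); split.
  - apply: weak_time_derivB => //.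
    + exact: solution_L2_continuous fcl.
    + exact: solution_L2_continuous cl.
    + by apply: filterS hE' => q H /H[].
    + by apply: filterS hE => q H /H[].
  - exact: intbleD.
  - apply: filterS2 hE hE' => q H H' qT; have [l1 n1] := H qT; have [l2 n2] := H' qT.
    split; first exact: L2B.
    by apply: le_trans (norm2B l2 l1) _; exact: lerD.
  - apply: filterS2 (filterI hE hE') (filterI ev ev') => q [H H'] [e e'] qT t0q.
    have [l1 _] := H qT; have [l2 _] := H' qT.
    have [h1 h2 eq1] := e qT; have [h1' h2' eq2] := e' qT.
    have q0 := proj1 (andP qT).
    have [T3q T2q T4q] : [/\ T3 <= q, T2 <= q & T4 <= q].
      by move: t0q; rewrite /t0 !ge_max => /and3P[].
    have hz := H10B h1' h1.
    apply: (difference_rate nu0 mu0 m50 wl (erefl _) (erefl _) h1 h2 h1' h2' l1 l2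
      (B3 q T3q) (K := K) _ _ M5mu M5lam eq1 eq2).
    + rewrite m5E mulrC norm2_sqr_L4 -!norm2_sq.
      apply: gagliardo_young => //; try exact: norm2_ge0.
        by rewrite /Lp_norm fine_ge0// Lnorm_ge0.
      exact: gn.
    + rewrite /K addrC; apply: lerD.
        rewrite -[leLHS]ger0_norm ?norm2_ge0// -sqrtr_sqr ler_wsqrtr//.
        exact: B4.
      rewrite ler_wpM2l// -[leLHS]ger0_norm ?norm2_ge0// -sqrtr_sqr ler_wsqrtr//.
      exact: B2.
    + rewrite (fU q q0) (strong_dU sol q0) norm2_sq; ring.
have := D rate t0 t (lexx _) t0t.
rewrite mul0r subr0 addr0 -!norm2_sq => H.
by rewrite [norm2 (fun x => v t0 x - v' t0 x)]norm2BC [`|U t0 - _|]distrC !real_normK ?num_real.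
Qed.
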